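(* Let $d\ge1$, $p\ge1$ with $p>d/2$, $\gamma>1$. Let $u=(\rho,\rho v,\rho e)\in C^{p+1}([0,T]\times\Omega;\mathcal A)$ be a solution of the compressible Euler equations $$\partial_t\begin{pmatrix}\rho\\ \rho v\\ \rho e\end{pmatrix}+\sum_{m=1}^d\partial_m\begin{pmatrix}\rho v_m\\ \rho v_mv+P\,e_m\\ (\rho e+P)v_m\end{pmatrix}=s,\qquad P=(\gamma-1)\bigl(\rho e-\tfrac12\rho|v|^2\bigr),$$ with either $s\equiv0$ or a continuous and bounded source $s:[0,T]\times\Omega\to\mathbb R^{d+2}$, such that $\rho\ge2\rho_{\min}>0$ and $P\ge2P_{\min}>0$ on $[0,T]\times\Omega$. Let $K$ be the set $$K=\overline{\mathrm{conv}}(\mathcal N_\epsilon)\cap\{\rho\ge\rho_{\min}\}\cap\{P(u)\ge P_{\min}\},$$ where $\mathcal N_\epsilon$ is the union of the closed Euclidean balls of radius $\epsilon$ around the points of the range of $u$ and $\epsilon>0$ is small enough that $\mathcal N_\epsilon\subseteq\{\rho\ge\rho_{\min}\}\cap\{P(u)\ge P_{\min}\}$. Let $(M,Q_1,\dots,Q_d)$ be a family (indexed by $h$) of diagonal-norm periodic SBP operators of order $p$ with fixed local stencil. Then the semidiscretization $$m_i\frac{\mathrm d}{\mathrm dt}u^h_i(t)+\sum_{m=1}^d2\sum_{j=1}^N(Q_m)_{ij}f^{\mathrm{num}}_m(u^h_i(t),u^h_j(t))=m_i\,s(t,x_i),\qquad u^h_i(0)=u(0,x_i),$$ with the two-point fluxes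 $f^{\mathrm{num}}_m$ of the context converges at rate $p$: there are $h_0>0$ and a constant $C_T$ independent of $h$ such that for every member of the family with $0<h<h_0$ it has a unique solution on $[0,T]$, all states $u^h_i(t)$ remain in $K$, and $$\Bigl(\sum_im_i|u^h_i(t)-u(t,x_i)|^2\Bigr)^{1/2}\le C_Th^p,\qquad t\in[0,T].$$ The threshold $h_0$ and the constant $C_T$ depend on $\rho_{\min}$ and $P_{\min}$ through the Hessian bounds $c_U,C_U$, the constant $C_w$, the flux constant $C_S$, and the Lipschitz constant $C_L$.
   Context: **Setting.** $\Omega=(\mathbb R/L\mathbb Z)^d$, $L>0$, $T>0$; $e_m$ is the $m$-th unit vector; $P$ denotes the pressure; $\mathcal A=\{u=(\rho,\rho v,\rho e)\in\mathbb R^{d+2}:\rho>0,\ P(u)>0\}$. **Entropy.** $\varsigma=\log(P\rho^{-\gamma})$, $U=-\rho\varsigma/(\gamma-1)$, $F_m=-\rho v_m\varsigma/(\gamma-1)$, $w=U'$. **Constants.** $0<c_U\le C_U<\infty$ satisfy $c_U\mathrm I\le U''(a)\le C_U\mathrm I$ for $a\in K$; $C_w=\sup_K|U'''|$ if $s\not\equiv0$ and $C_w=0$ otherwise; $C_S=\max_m\sup_{K\times K}|\mathrm D^2f^{\mathrm{num}}_m|$; $C_L=\sup_{t\in[0,T]}\|\nabla_x(w\circ u)(t,\cdot)\|_{L^\infty(\Omega)}$. **Two-point fluxes.** For two states with values $a_L,a_R$ of a quantity $a$: $\{\!\{a\}\!\}=(a_L+a_R)/2$; for positive $a_L,a_R$,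 $\{\!\{a\}\!\}_{\log}=(a_L-a_R)/(\log a_L-\log a_R)$ for $a_L\ne a_R$ and $=a_L$ for $a_L=a_R$; $(\!(a\cdot b)\!)=(a_Lb_R+a_Rb_L)/2$. For direction $m$ and $k\in\{1,\dots,d\}$, the components of $f^{\mathrm{num}}_m$ are $$f^{\mathrm{num}}_\rho=\{\!\{\rho\}\!\}_{\log}\{\!\{v_m\}\!\},\qquad f^{\mathrm{num}}_{\rho v_k}=\{\!\{v_k\}\!\}f^{\mathrm{num}}_\rho+\delta_{km}\{\!\{P\}\!\},$$ $$f^{\mathrm{num}}_{\rho e}=\tfrac12\Bigl(\sum_{k=1}^d(\!(v_k\cdot v_k)\!)\Bigr)f^{\mathrm{num}}_\rho+\frac{1}{(\gamma-1)\{\!\{\rho/P\}\!\}_{\log}}f^{\mathrm{num}}_\rho+(\!(P\cdot v_m)\!).$$ **Operators.** A family of discretizations is indexed by a nominal mesh size $h>0$; all constants are independent of $h$ and $N$. Each member has nodes $x_1,\dots,x_N\in\Omega$ (arbitrary layout, duplicates allowed). *Diagonal-norm periodic SBP operators of order $p\ge1$:* matrices $M,Q_1,\dots,Q_d\in\mathbb R^{N\times N}$, $D_m=M^{-1}Q_m$, with (i) $M=\mathrm{diag}(m_1,\dots,m_N)$, $c_Mh^d\le m_i\le C_Mh^d$, $c_N\le Nh^d\le C_N$, with positive constants; (ii) $Q_m+Q_m^T=0$; (iii) $Q_m\vec1=\vec0$, $\vec1=(1,\dots,1)^T$; (iv) there is $C_D>0$ such that for all $g\in C^{p+1}(\Omega)$,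 all $m$ and $i$: $|(D_m\vec g)_i-(\partial_mg)(x_i)|\le C_Dh^p\|g\|_{C^{p+1}(\Omega)}$, where $\vec g=(g(x_i))_i$ and the norm is the largest sup norm of all partial derivatives of order at most $p+1$. *Fixed local stencil:* there are $\omega,C_q>0$, $\kappa\in\mathbb N$ independent of $N$ such that for each $m$: $(Q_m)_{ij}\ne0$ implies $d_{\mathrm{per}}(x_i,x_j)\le\omega h$ ($d_{\mathrm{per}}$ is the periodic distance on $\Omega$); each row of $Q_m$ has at most $\kappa$ nonzero entries; $|(Q_m)_{ij}|\le C_qh^{d-1}$. *)

(* Defs.v *)
From HB Require Import structures.
From mathcomp Require Import all_boot all_order all_algebra.
From mathcomp Require Import all_classical all_reals all_analysis.

Set Implicit Arguments.
Unset Strict Implicit.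
Unset Printing Implicit Defensive.

Import Order.TTheory GRing.Theory Num.Theory.
Import numFieldNormedType.Exports.

Local Open Scope classical_set_scope.
Local Open Scope ring_scope.

(* The library norm of 'rV[R]_n is the sup norm; this is the Euclidean one. *)
Definition enorm {R : realType} {n : nat} (a : 'rV[R]_n) : R :=
  Num.sqrt (\sum_i a ord0 i ^+ 2).

Definition enorm_pair {R : realType} {n : nat} (z : 'rV[R]_n * 'rV[R]_n) : R :=
  Num.sqrt (enorm z.1 ^+ 2 + enorm z.2 ^+ 2).

Definition evec {R : realType} {n : nat} (m : 'I_n) : 'rV[R]_n :=
  delta_mx ord0 m.

(* Functions on the torus (R/LZ)^d are the functions on R^d that are L-periodic
   in every coordinate; points of the torus are given by representatives. *)
Definition periodic {R : realType} {d : nat} {W : Type} (L : R)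
    (g : 'rV[R]_d -> W) : Prop :=
  forall (m : 'I_d) x, g (x + L *: evec m) = g x.

Definition dper {R : realType} {d : nat} (L : R) (x y : 'rV[R]_d) : R :=
  inf [set enorm (x - y + L *: map_mx intr k) | k in [set: 'rV[int]_d]].

Definition pds {R : realType} {d : nat} {W : normedModType R}
    (s : seq 'I_d) (g : 'rV[R]_d -> W) : 'rV[R]_d -> W :=
  foldr (fun m f x => 'D_(evec m) f x) g s.

Definition Ck_torus {R : realType} {d : nat} {W : normedModType R} (L : R)
    (k : nat) (g : 'rV[R]_d -> W) : Prop :=
  periodic L g /\
  forall s : seq 'I_d, (size s <= k)%N ->
    continuous (pds s g) /\
    ((size s < k)%N -> forall m x, derivable (pds s g) x (evec m)).

Definition Ck_norm {R : realType} {d : nat} (k : nat) (g : 'rV[R]_d -> R) : R :=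
  sup [set r | exists s : seq 'I_d, (size s <= k)%N /\
                 exists x, r = `|pds s g x|].

(* The derivative relative to [0,T], hence one-sided at t = 0 and t = T. *)
Definition time_quot {R : realType} {W : normedModType R} (f : R -> W)
  (t t' : R) : W := (t' - t)^-1 *: (f t' - f t).

Definition time_derivable {R : realType} {W : normedModType R} (T : R)
    (f : R -> W) (t : R) : Prop :=
  cvg (time_quot f t t' @[t' --> within `[0, T] t^']).

Definition time_derive {R : realType} {W : normedModType R} (T : R)
    (f : R -> W) (t : R) : W :=
  lim (time_quot f t t' @[t' --> within `[0, T] t^']).

(* First-order partial derivatives on [0,T] x R^d; None is the time direction. *)
Definition pd_tx {R : realType} {d : nat} {W : normedModType R} (T : R)
    (i : option 'I_d) (f : R -> 'rV[R]_d -> W) : R -> 'rV[R]_d -> W :=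
  fun t x => match i with
             | None => time_derive T (fun t' => f t' x) t
             | Some m => 'D_(evec m) (f t) x
             end.

Definition pd_tx_exists {R : realType} {d : nat} {W : normedModType R} (T : R)
    (i : option 'I_d) (f : R -> 'rV[R]_d -> W) (t : R) (x : 'rV[R]_d) : Prop :=
  match i with
  | None => time_derivable T (fun t' => f t' x) t
  | Some m => derivable (f t) x (evec m)
  end.

Definition pds_tx {R : realType} {d : nat} {W : normedModType R} (T : R)
    (s : seq (option 'I_d)) (f : R -> 'rV[R]_d -> W) : R -> 'rV[R]_d -> W :=
  foldr (pd_tx T) f s.

Definition continuous_tx {R : realType} {d : nat} {W : normedModType R} (T : R)
    (f : R -> 'rV[R]_d -> W) : Prop :=
  {within `[0, T]%classic `*` [set: 'rV[R]_d],
    continuous (fun z : R * 'rV[R]_d => f z.1 z.2)}.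

Definition periodic_tx {R : realType} {d : nat} {W : Type} (L T : R)
    (f : R -> 'rV[R]_d -> W) : Prop :=
  forall t, 0 <= t <= T -> periodic L (f t).

Definition Ck_tx {R : realType} {d : nat} {W : normedModType R} (L T : R)
    (k : nat) (f : R -> 'rV[R]_d -> W) : Prop :=
  periodic_tx L T f /\
  forall s : seq (option 'I_d), (size s <= k)%N ->
    continuous_tx T (pds_tx T s f) /\
    ((size s < k)%N -> forall i t x, 0 <= t <= T ->
       pd_tx_exists T i (pds_tx T s f) t x).

(* States (rho, rho v, rho e) in R^{d+2}, in this block order. *)
Notation state R d := ('rV[R]_(1 + (d + 1))).

Definition mkstate {R : realType} {d : nat} (r : R) (q : 'rV[R]_d) (E : R)
  : state R d := row_mx (const_mx r) (row_mx q (const_mx E)).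

Definition rho {R : realType} {d : nat} (a : state R d) : R :=
  lsubmx a ord0 ord0.

Definition mom {R : realType} {d : nat} (a : state R d) : 'rV[R]_d :=
  lsubmx (rsubmx a).

Definition energy {R : realType} {d : nat} (a : state R d) : R :=
  rsubmx (rsubmx a) ord0 ord0.

Definition vel {R : realType} {d : nat} (a : state R d) : 'rV[R]_d :=
  (rho a)^-1 *: mom a.

Definition pressure {R : realType} {d : nat} (gamma : R) (a : state R d) : R :=
  (gamma - 1) * (energy a - rho a * enorm (vel a) ^+ 2 / 2).

Definition admissible {R : realType} {d : nat} (gamma : R) : set (state R d) :=
  [set a | 0 < rho a /\ 0 < pressure gamma a].

Definition euler_flux {R : realType} {d : nat} (gamma : R) (m : 'I_d)
    (a : state R d) : state R d :=
  mkstate (mom a ord0 m)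
          (vel a ord0 m *: mom a + pressure gamma a *: evec m)
          ((energy a + pressure gamma a) * vel a ord0 m).

Definition euler_solution {R : realType} {d : nat} (gamma T : R)
    (s u : R -> 'rV[R]_d -> state R d) : Prop :=
  forall t x, 0 <= t <= T ->
    time_derive T (fun t' => u t' x) t
      + \sum_(m < d) 'D_(evec m) (fun y => euler_flux gamma m (u t y)) x
    = s t x.

Definition zero_source {R : realType} {d : nat} (T : R)
    (s : R -> 'rV[R]_d -> state R d) : Prop :=
  forall t x, 0 <= t <= T -> s t x = 0.

Definition bounded_tx {R : realType} {d : nat} (T : R)
    (s : R -> 'rV[R]_d -> state R d) : Prop :=
  exists B : R, forall t x, 0 <= t <= T -> enorm (s t x) <= B.

Definition varsigma {R : realType} {d : nat} (gamma : R) (a : state R d) : R :=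
  ln (pressure gamma a * rho a `^ (- gamma)).

Definition entropy {R : realType} {d : nat} (gamma : R) (a : state R d) : R :=
  - (rho a * varsigma gamma a) / (gamma - 1).

Definition entropy_var {R : realType} {d : nat} (gamma : R) (a : state R d)
  : state R d := \row_j 'D_(evec j) (entropy gamma) a.

Definition entropy_hessian {R : realType} {d : nat} (gamma : R) (a : state R d)
  : 'M[R]_(1 + (d + 1)) :=
  \matrix_(i, j) 'D_(evec i) (fun b => 'D_(evec j) (entropy gamma) b) a.

Definition avg {R : realType} (aL aR : R) : R := (aL + aR) / 2.

Definition logmean {R : realType} (aL aR : R) : R :=
  if aL == aR then aL else (aL - aR) / (ln aL - ln aR).

Definition prodmean {R : realType} (aL bL aR bR : R) : R :=
  (aL * bR + aR * bL) / 2.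

Definition fnum {R : realType} {d : nat} (gamma : R) (m : 'I_d)
    (aL aR : state R d) : state R d :=
  let PL := pressure gamma aL in
  let PR := pressure gamma aR in
  let vL k := vel aL ord0 k in
  let vR k := vel aR ord0 k in
  let f_rho := logmean (rho aL) (rho aR) * avg (vL m) (vR m) in
  mkstate f_rho
    (\row_k (avg (vL k) (vR k) * f_rho + (k == m)%:R * avg PL PR))
    (2^-1 * (\sum_k prodmean (vL k) (vL k) (vR k) (vR k)) * f_rho
     + ((gamma - 1) * logmean (rho aL / PL) (rho aR / PR))^-1 * f_rho
     + prodmean PL (vL m) PR (vR m)).

Definition solution_nbhd {R : realType} {d : nat} (T : R)
    (u : R -> 'rV[R]_d -> state R d) (eps : R) : set (state R d) :=
  [set a | exists t x, 0 <= t <= T /\ enorm (a - u t x) <= eps].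

Definition bounded_below {R : realType} {d : nat} (gamma rhomin Pmin : R)
  : set (state R d) := [set a | rhomin <= rho a /\ Pmin <= pressure gamma a].

Definition convex_hull {R : realType} {V : lmodType R} (A : set V) : set V :=
  smallest (@convex_set R V) A.

Definition Kset {R : realType} {d : nat} (gamma T rhomin Pmin : R)
    (u : R -> 'rV[R]_d -> state R d) (eps : R) : set (state R d) :=
  closure (convex_hull (solution_nbhd T u eps))
  `&` bounded_below gamma rhomin Pmin.

(* Derivatives of order two and three are measured in the operator norm of the
   associated multilinear map with respect to Euclidean norms.  All the suprema
   below are over bounded nonempty sets in the situation they are used in. *)

Definition hessian_bounds {R : realType} {d : nat} (gamma : R)
    (K : set (state R d)) (cU CU : R) : Prop :=
  [/\ 0 < cU, cU <= CU &
      forall a, K a -> forall v : state R d,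
        let q := (v *m entropy_hessian gamma a *m v^T) ord0 ord0 in
        cU * enorm v ^+ 2 <= q <= CU * enorm v ^+ 2].

Definition const_w {R : realType} {d : nat} (gamma T : R)
    (s : R -> 'rV[R]_d -> state R d) (K : set (state R d)) : R :=
  if `[< zero_source T s >] then 0 else
  sup [set r | exists a, K a /\ exists v1 v2 v3 : state R d,
    [/\ enorm v1 <= 1, enorm v2 <= 1, enorm v3 <= 1 &
        r = `|'D_v1 (fun b => 'D_v2 (fun c => 'D_v3 (entropy gamma) c) b) a|]].

Definition const_S {R : realType} {d : nat} (gamma : R)
    (K : set (state R d)) : R :=
  \big[Num.max/0]_(m < d)
  sup [set r | exists z, (K `*` K) z /\ exists v1 v2 : state R d * state R d,
    let f y := fnum gamma m y.1 y.2 in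
    [/\ enorm_pair v1 <= 1, enorm_pair v2 <= 1 &
        r = enorm ('D_v1 (fun y => 'D_v2 f y) z)]].

(* The gradient being continuous, its L^oo norm is its sup norm. *)
Definition const_L {R : realType} {d : nat} (gamma T : R)
    (u : R -> 'rV[R]_d -> state R d) : R :=
  sup [set r | exists t x, 0 <= t <= T /\ exists v : 'rV[R]_d,
    enorm v <= 1 /\ r = enorm ('D_v (fun y => entropy_var gamma (u t y)) x)].

Record discretization (R : realType) (d : nat) := Discretization {
  mesh : R;
  nnodes : nat;
  node : 'I_nnodes -> 'rV[R]_d;
  mass : 'rV[R]_nnodes;
  stiff : 'I_d -> 'M[R]_nnodes
}.

Definition diff_op {R : realType} {d : nat} (D : discretization R d) (m : 'I_d)
  : 'M[R]_(nnodes D) := invmx (diag_mx (mass D)) *m stiff D m.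

Definition grid_fun {R : realType} {d : nat} (D : discretization R d)
  (g : 'rV[R]_d -> R) : 'cV[R]_(nnodes D) := \col_i g (node i).

(* A family of discretizations is a set of them; the constants are shared by all
   of its members. *)
Definition sbp_family {R : realType} {d : nat} (L : R) (p : nat)
    (F : set (discretization R d)) : Prop :=
  exists cM CM cN CN CD : R,
    [/\ 0 < cM, 0 < CM, 0 < cN, 0 < CN & 0 < CD] /\
    forall D, F D ->
    [/\ 0 < mesh D,
        (forall i, cM * mesh D ^+ d <= mass D ord0 i <= CM * mesh D ^+ d) /\
          (cN <= (nnodes D)%:R * mesh D ^+ d <= CN),
        (forall m, stiff D m + (stiff D m)^T = 0),
        (forall m, stiff D m *m const_mx 1 = 0 :> 'cV[R]_(nnodes D)) &
        (forall g : 'rV[R]_d -> R, Ck_torus L p.+1 g -> forall m i,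
           `|(diff_op D m *m grid_fun D g) i ord0 - 'D_(evec m) g (node i)|
             <= CD * mesh D ^+ p * Ck_norm p.+1 g)].

Definition fixed_local_stencil {R : realType} {d : nat} (L : R)
    (F : set (discretization R d)) : Prop :=
  exists (omega Cq : R) (kappa : nat),
    [/\ 0 < omega, 0 < Cq &
    forall D, F D -> forall m : 'I_d,
      [/\ (forall i j, stiff D m i j != 0 ->
             dper L (node i) (node j) <= omega * mesh D),
          (forall i, (#|[set j | stiff D m i j != 0%R]%SET| <= kappa)%N) &
          (forall i j, `|stiff D m i j| <= Cq * mesh D ^+ d.-1)]].

(* Solutions take values in the admissible set, the domain of the fluxes. *)
Definition semidiscrete_solution {R : realType} {d : nat} (gamma T : R)
    (s u : R -> 'rV[R]_d -> state R d) (D : discretization R d)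
    (uh : R -> 'I_(nnodes D) -> state R d) : Prop :=
  (forall i, uh 0 i = u 0 (node i)) /\
  forall t i, 0 <= t <= T ->
    [/\ admissible gamma (uh t i),
        time_derivable T (fun t' => uh t' i) t &
        mass D ord0 i *: time_derive T (fun t' => uh t' i) t
          + \sum_(m < d) 2 *: (\sum_j stiff D m i j *:
                                  fnum gamma m (uh t i) (uh t j))
        = mass D ord0 i *: s t (node i)].

Definition discrete_error {R : realType} {d : nat} (D : discretization R d)
    (u : R -> 'rV[R]_d -> state R d) (uh : R -> 'I_(nnodes D) -> state R d)
    (t : R) : R :=
  Num.sqrt (\sum_i mass D ord0 i * enorm (uh t i - u t (node i)) ^+ 2).

(* Main.v *)
Require Import Defs.
From HB Require Import structures.
From mathcomp Require Import all_boot all_order all_algebra.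
From mathcomp Require Import all_classical all_reals all_analysis.
From mathcomp Require Import ring lra zify.

Set Implicit Arguments.
Unset Strict Implicit.
Unset Printing Implicit Defensive.

Import Order.TTheory GRing.Theory Num.Theory.
Import numFieldNormedType.Exports.

Local Open Scope classical_set_scope.
Local Open Scope ring_scope.

(* Let H(a|b) = U(a) - U(b) - w(b).(a - b) be the relative entropy.  The energy
   E = sum_i m_i H(uh_i | u(x_i)) is equivalent to the squared error.  Tadmor's
   condition (w(a) - w(b)).f_m(a, b) = rho v_m(a) - rho v_m(b), the symmetry of f_m,
   the skew-symmetry of Q_m and Q_m 1 = 0 reduce the contribution of the fluxes to E'
   to three kinds of terms: second differences f(uh_i, uh_j) - f(uh_i, u_j)
   - f(u_i, uh_j) + f(u_i, u_j) paired with w(u_i) - w(u_j), products of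
   w(uh_i) - w(u_i) with mixed differences of f in uh_i - u_i and u_i - u_j, and the
   consistency error.  On the stencil u_i - u_j = O(h), which compensates
   Q_m = O(h^(d-1)), and the consistency error is O(h^p); hence
   E' <= C (E + h^(2p)) as long as the discrete states stay near the range of u, and
   E <= C h^(2p) by Gronwall.  Since m_i >= c_M h^d, this gives
   |uh_i - u(x_i)|^2 = O(h^(2p - d)), and 2p > d, so for small h the states cannot
   leave the neighbourhood of the range of u in which these estimates hold. *)

(** * Derivatives relative to [0, T] *)

(** The quotient that defines the logarithmic mean degenerates on the diagonal, so the proof does
    not differentiate the flux twice. The inverse of the mean is the average of
    [1 / (s x + (1 - s) y)] over [s] in [[0, 1]], a family with bounds uniform in [s]. Stability
    takes from it bounds on mixed differences of [fnum], and consistency takes a Taylor expansion to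
    order [p + 1]. The second is needed because SBP accuracy speaks of periodic [C^(p+1)] functions
    on the whole torus. The relative entropy is treated in the same spirit. In density, velocity and
    [rho / P] it is an explicit sum of three nonnegative terms, from which two-sided quadratic
    bounds are read off. The bounds on the entropy Hessian follow from these and not from an
    analysis of the matrix. The scheme is only locally Lipschitz, so existence is proved for a
    truncated system. The exit argument asks for the equation only while the states are near [u]:
    applied to the truncated solution it shows that the truncation is never active, and applied to
    an arbitrary solution of the scheme it gives the bounds behind uniqueness. *)

Section TimeDerivative.
Variables (R : realType) (T : R).
Hypothesis T0 : 0 < T.
Implicit Types (t : R).

Definition is_time_derive {W : normedModType R} (f : R -> W) (t : R) (l : W) :=
  time_quot f t t' @[t' --> within `[0, T] t^'] --> l.

(** Properness makes these limits unique, and it is where [0 < T] enters: [T] is approached from the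
    left, every other point from the right. *)
Lemma within_itv_proper t : 0 <= t <= T ->
  ProperFilter (within `[0, T] (dnbhs t)).
Proof.
move=> /andP[t0 tT]; apply: Build_ProperFilter_ex => A.
rewrite /within /= /dnbhs /within /= => /nbhs_ballP[e /= e0 eA].
have [tl|tT2] := ltP t T.
- pose t' := t + Num.min (e / 2) ((T - t) / 2).
  have m0 : 0 < Num.min (e / 2) ((T - t) / 2).
    by rewrite lt_min !divr_gt0 ?subr_gt0.
  exists t'; apply: (eA t'); rewrite /t'.
  + rewrite /ball /= opprD addrA subrr add0r normrN gtr0_norm //.
    by rewrite gt_min ltr_pdivrMr // ltr_pMr // ltr1n.
  + by rewrite -subr_eq0 addrC addKr gt_eqF.
  + rewrite /= in_itv /= (le_trans t0) ?lerDl ?ltW //=.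
    have : Num.min (e / 2) ((T - t) / 2) <= (T - t) / 2 by rewrite ge_min lexx orbT.
    lra.
- have tE : t = T by apply/eqP; rewrite eq_le tT tT2.
  pose t' := t - Num.min (e / 2) (t / 2).
  have m0 : 0 < Num.min (e / 2) (t / 2).
    by rewrite lt_min !divr_gt0 // tE.
  exists t'; apply: (eA t'); rewrite /t'.
  + rewrite /ball /= opprB addrC subrK gtr0_norm //.
    by rewrite gt_min ltr_pdivrMr // ltr_pMr // ltr1n.
  + by rewrite -subr_eq0 addrAC subrr sub0r oppr_eq0 gt_eqF.
  + have : Num.min (e / 2) (t / 2) <= t / 2 by rewrite ge_min lexx orbT.
    rewrite /= in_itv /=; move: m0; set m := Num.min _ _ => m0 mt.
    by apply/andP; split; lra.
Qed.

Lemma time_derivableP {W : normedModType R} (f : R -> W) t :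
  time_derivable T f t -> is_time_derive f t (time_derive T f t).
Proof. by []. Qed.

Lemma is_time_derive_derivable {W : normedModType R} (f : R -> W) t l :
  is_time_derive f t l -> time_derivable T f t.
Proof. by move=> h; apply/cvg_ex; exists l. Qed.

Lemma is_time_derive_val {W : normedModType R} (f : R -> W) t l : 0 <= t <= T ->
  is_time_derive f t l -> time_derive T f t = l.
Proof.
move=> tT h; have P := within_itv_proper tT.
by apply: cvg_lim => //; exact: norm_hausdorff.
Qed.

Lemma near_within_dnbhs t : \forall t' \near within `[0, T] t^', t' != t.
Proof.
change (t^' (fun x => x \in `[0, T] -> x != t)).
by apply: filterS (nbhs_dnbhs_neq t) => x ? _.
Qed.

Lemma near_within_itv t : \forall t' \near within `[0, T] t^', 0 <= t' <= T.
Proof.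
change (t^' (fun x => x \in `[0, T] -> 0 <= x <= T)).
by apply: filterS (nbhs_dnbhs_neq t) => x _; rewrite in_itv.
Qed.

Lemma eq_is_time_derive {W : normedModType R} (f g : R -> W) t l :
  0 <= t <= T -> (forall t', 0 <= t' <= T -> f t' = g t') ->
  is_time_derive f t l -> is_time_derive g t l.
Proof.
move=> tT fg; apply: cvg_trans; apply: near_eq_cvg.
by near=> t'; rewrite /time_quot !fg //; near: t'; exact: near_within_itv.
Unshelve. all: by end_near. Qed.

Lemma is_time_derive_cvg {W : normedModType R} (f : R -> W) t l :
  is_time_derive f t l -> f t' @[t' --> within `[0, T] t^'] --> f t.
Proof.
move=> h.
have h2 : (t' - t) *: time_quot f t t' + f t
    @[t' --> within `[0, T] t^'] --> (0 : R) *: l + f t.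
  apply: cvgD; last exact: cvg_cst.
  apply: cvgZ => //.
  rewrite -(subrr t); apply: cvgB; last exact: cvg_cst.
  by apply: cvg_within_filter; apply: cvg_within_filter; exact: cvg_id.
rewrite scale0r add0r in h2; apply: cvg_trans h2; apply: near_eq_cvg.
near=> t'; rewrite /time_quot scalerA mulfV ?scale1r ?subrK // subr_eq0.
by near: t'; exact: near_within_dnbhs.
Unshelve. all: by end_near. Qed.

Lemma is_time_derive_within {W : normedModType R} (f : R -> W) t l :
  is_time_derive f t l -> f t' @[t' --> within `[0, T] (nbhs t)] --> f t.
Proof.
move=> /is_time_derive_cvg h A nA; have := h A nA.
change (t^' (fun x => x \in `[0, T] -> A (f x)) ->
  nbhs t (fun x => x \in `[0, T] -> A (f x))).
move=> hA; change (nbhs t (fun x => x != t -> x \in `[0, T] -> A (f x))) in hA.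
apply: filterS hA => x hx xT; have [->|xt] := eqVneq x t; first exact: nbhs_singleton.
exact: hx.
Qed.

Lemma time_derivable_continuous {W : normedModType R} (f : R -> W) t1 : t1 <= T ->
  (forall t, 0 <= t <= t1 -> exists l, is_time_derive f t l) ->
  {within `[0, t1], continuous f}.
Proof.
move=> t1T h; apply/subspace_continuousP => x /=; rewrite in_itv /= => xt.
have [l /is_time_derive_within hl] := h x xt.
apply: cvg_trans hl; apply: cvg_app; apply: within_subset => y /=.
by rewrite !in_itv /= => /andP[-> yt]; exact: le_trans t1T.
Qed.

(** At interior times the restriction to [[0, T]] is invisible to the limit, so the mean value
    theorem becomes available. *)
Lemma is_time_derive_is_derive (f : R -> R) t l : 0 < t < T ->
  is_time_derive f t l -> is_derive t 1 f l.
Proof.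
move=> /andP[t0 tT] h.
have h2 : h^-1 *: ((f \o shift t) (h *: 1) - f t) @[h --> 0^'] --> l.
  have h3 : time_quot f t t' @[t' --> t^'] --> l.
    move=> A nA; have := h A nA.
    change (t^' (fun x => x \in `[0, T] -> A (time_quot f t x)) ->
      t^' (fun x => A (time_quot f t x))).
    have n1 : t^' (fun y => y \in `[0, T]).
      apply: nbhs_dnbhs; have := @near_in_itvoo R 0 T t.
      rewrite in_itv /= t0 tT => /(_ isT).
      by apply: filterS => y; rewrite !in_itv /= => /andP[/ltW -> /ltW ->].
    by move: n1; apply: filterS2 => x hx; apply.
  move=> A /h3.
  change (nbhs t (fun x => x != t -> A (time_quot f t x)) -> nbhs (0 : R)
    (fun k => k != 0 -> A (k^-1 *: ((f \o shift t) (k *: 1) - f t)))).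
  move=> /nbhs_ballP[e /= e0 eA]; apply/nbhs_ballP; exists e => //= k.
  rewrite /ball /= sub0r normrN => ke k0.
  have := eA (k + t); rewrite /ball /= opprD addrCA subrr addr0 normrN => /(_ ke).
  rewrite -subr_eq0 addrK /time_quot addrK => /(_ k0).
  by rewrite (_ : k%:A = k) //; exact: mulr1.
split; first by apply/cvg_ex; exists l.
exact: cvg_lim.
Qed.

Lemma is_time_derive_cst {W : normedModType R} (c : W) t :
  is_time_derive (fun=> c) t 0.
Proof.
rewrite /is_time_derive /time_quot.
under eq_fun do rewrite subrr scaler0.
exact: cvg_cst.
Qed.

Lemma is_time_derive_id t : is_time_derive id t 1.
Proof.
have h : (1 : R) @[t' --> within `[0, T] t^'] --> (1 : R) by exact: cvg_cst.
rewrite /is_time_derive; refine (cvg_trans _ h).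
apply: near_eq_cvg; apply: filterS (near_within_dnbhs t) => y yt.
by rewrite /time_quot /GRing.scale /= mulVf // subr_eq0.
Qed.

Lemma is_time_deriveD {W : normedModType R} (f g : R -> W) t a b :
  is_time_derive f t a -> is_time_derive g t b ->
  is_time_derive (fun x => f x + g x) t (a + b).
Proof.
rewrite /is_time_derive => ha hb; apply: (cvg_trans _ (cvgD ha hb)).
apply: near_eq_cvg.
by apply: nearW => x; rewrite /time_quot opprD addrACA scalerDr.
Qed.

Lemma is_time_deriveZ {W : normedModType R} (k : R) (f : R -> W) t a :
  is_time_derive f t a -> is_time_derive (fun x => k *: f x) t (k *: a).
Proof.
rewrite /is_time_derive => ha; apply: (cvg_trans _ (cvgZ (cvg_cst k) ha)).
apply: near_eq_cvg; apply: nearW => x.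
by rewrite /time_quot -scalerBr !scalerA mulrC.
Qed.

Lemma is_time_deriveN {W : normedModType R} (f : R -> W) t a :
  is_time_derive f t a -> is_time_derive (fun x => - f x) t (- a).
Proof.
move=> ha; have := @is_time_deriveZ _ (-1) f t a ha; rewrite scaleN1r.
by under eq_fun do rewrite scaleN1r.
Qed.

Lemma is_time_deriveB {W : normedModType R} (f g : R -> W) t a b :
  is_time_derive f t a -> is_time_derive g t b ->
  is_time_derive (fun x => f x - g x) t (a - b).
Proof. by move=> ha hb; apply: is_time_deriveD => //; apply: is_time_deriveN. Qed.

Lemma is_time_derive_sum {W : normedModType R} (I : Type) (r : seq I)
  (f : I -> R -> W) t (a : I -> W) :
  (forall i, is_time_derive (f i) t (a i)) ->
  is_time_derive (fun x => \sum_(i <- r) f i x) t (\sum_(i <- r) a i).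
Proof.
move=> h; elim: r => [|i r IH].
  by under eq_fun do rewrite big_nil; rewrite big_nil; exact: is_time_derive_cst.
under eq_fun do rewrite big_cons; rewrite big_cons.
exact: is_time_deriveD.
Qed.

Lemma is_time_deriveM (f g : R -> R) t a b :
  is_time_derive f t a -> is_time_derive g t b ->
  is_time_derive (fun x => f x * g x) t (a * g t + f t * b).
Proof.
move=> ha hb; have fc := is_time_derive_cvg ha; move: ha hb.
rewrite /is_time_derive => ha hb.
apply: (cvg_trans _ (cvgD (cvgM ha (cvg_cst (g t))) (cvgM fc hb))).
apply: near_eq_cvg; apply: nearW => x.
change (time_quot f t x * g t + f x * time_quot g t x = time_quot (fun x0 => f x0 * g x0) t x).
by rewrite /time_quot /GRing.scale /=; ring.
Qed.

Lemma is_time_derive_comp (G : R -> R) (f : R -> R) t a b :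
  is_time_derive f t a -> is_derive (f t) 1 G b ->
  is_time_derive (G \o f) t (b * a).
Proof.
move=> ha [dG Gb].
(* Caratheodory's slope function: it is continuous at [f t], so the quotient of [G \o f] factors
   without dividing by [f x - f t], which may vanish. *)
pose psi y := if y == f t then b else (y - f t)^-1 * (G y - G (f t)).
have cpsi : psi y @[y --> nbhs (f t)] --> psi (f t).
  have h : h^-1 *: ((G \o shift (f t)) (h *: 1) - G (f t)) @[h --> 0^'] --> b.
    by move: dG => /cvg_ex[l hl]; rewrite -Gb /derive (cvg_lim _ hl).
  rewrite {2}/psi eqxx => A nA; have := h A nA.
  change (nbhs (0 : R) (fun k => k != 0 ->
    A (k^-1 *: ((G \o shift (f t)) (k *: 1) - G (f t)))) ->
    nbhs (f t) (fun y => A (psi y))).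
  move=> /nbhs_ballP[e /= e0 eA]; apply/nbhs_ballP; exists e => //= y.
  rewrite /ball /= => ye; rewrite /psi; case: eqVneq => [_|yf].
    exact: nbhs_singleton.
  have := eA (y - f t); rewrite /ball /= sub0r normrN -normrN opprB => /(_ ye).
  rewrite subr_eq0 => /(_ yf).
  by rewrite (_ : (y - f t)%:A = y - f t) ?subrK //; exact: mulr1.
have fc := is_time_derive_cvg ha; move: ha; rewrite /is_time_derive => ha.
have := cvgM (cvg_comp _ _ fc cpsi) ha; rewrite {2}/psi eqxx => /(_ _) hc.
refine (cvg_trans _ hc); apply: near_eq_cvg; apply: nearW => x.
rewrite /time_quot /psi /= /GRing.scale /=; case: eqVneq => [->|xf].
  by rewrite subrr !mulr0 subrr mulr0.
by rewrite mulrCA mulrAC mulVf ?mul1r ?mulrA // subr_eq0.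
Qed.

Lemma is_time_derive_inv (f : R -> R) t a : f t != 0 ->
  is_time_derive f t a -> is_time_derive (fun x => (f x)^-1) t (- a / f t ^+ 2).
Proof.
move=> f0 ha; have := @is_time_derive_comp GRing.inv f t a (- (f t) ^- 2) ha.
rewrite mulNr mulrC -mulNr => h; apply: h.
by have := is_deriveV f0 (is_derive_id (f t) (1 : R)); rewrite /GRing.scale /= mulr1.
Qed.

Lemma is_time_derive_ln (f : R -> R) t a : 0 < f t ->
  is_time_derive f t a -> is_time_derive (fun x => ln (f x)) t (a / f t).
Proof.
move=> f0 ha; have := @is_time_derive_comp (@ln R) f t a (f t)^-1 ha.
by rewrite mulrC => h; apply: h; exact: is_derive1_ln.
Qed.

Lemma time_nonincreasing (f f' : R -> R) t1 : 0 <= t1 <= T ->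
  (forall t, 0 <= t <= t1 -> is_time_derive f t (f' t)) ->
  (forall t, 0 <= t <= t1 -> f' t <= 0) ->
  forall t, 0 <= t <= t1 -> f t <= f 0.
Proof.
move=> /andP[t10 t1T] df f'0 t /andP[t0 tt1].
have d x : x \in `]0, t1[ -> is_derive x 1 f (f' x).
  rewrite in_itv /= => /andP[x0 xt]; apply: is_time_derive_is_derive.
    by rewrite x0 (lt_le_trans xt).
  by apply: df; rewrite !ltW.
apply: (@ler0_derive1_nincr R f 0 t1) => //.
- by move=> x /d[].
- move=> x xt; have [_] := d _ xt; rewrite derive1E => ->; apply: f'0.
  by move: xt; rewrite in_itv /= => /andP[/ltW -> /ltW ->].
- apply: time_derivable_continuous => // x /df ?; by exists (f' x).
Qed.

Lemma gronwall (f f' : R -> R) (C b t1 : R) : 0 <= t1 <= T -> 0 < C ->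
  (forall t, 0 <= t <= t1 -> is_time_derive f t (f' t)) ->
  (forall t, 0 <= t <= t1 -> f' t <= C * f t + b) ->
  forall t, 0 <= t <= t1 -> f t <= (f 0 + b / C) * expR (C * t) - b / C.
Proof.
move=> t1T C0 df hf t tt1.
(* The shift by [b / C] makes the differential inequality homogeneous, and the integrating factor
   then makes [g] nonincreasing. *)
pose g x := (f x + b / C) * expR (- C * x).
pose g' x := f' x * expR (- C * x) + (f x + b / C) * (- C * expR (- C * x)).
have dg x : 0 <= x <= t1 -> is_time_derive g x (g' x).
  move=> xt; apply: is_time_deriveM.
    by rewrite -[f' x]addr0; apply: is_time_deriveD; [exact: df|exact: is_time_derive_cst].
  rewrite mulrC.
  apply: (@is_time_derive_comp (@expR R) (fun y => - C * y) x (- C) (expR (- C * x))).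
    have := is_time_deriveM (is_time_derive_cst (- C) x) (is_time_derive_id x).
    by rewrite mul0r add0r mulr1.
have := @time_nonincreasing g g' t1 t1T dg.
have gle x : 0 <= x <= t1 -> g' x <= 0.
  move=> /hf h; rewrite /g' mulrCA mulrA -mulrDl; apply: mulr_le0_ge0; last exact: expR_ge0.
  have -> : - C * (f x + b / C) = - (C * f x + b) by field; rewrite gt_eqF.
  by rewrite subr_le0.
move=> /(_ gle t tt1); rewrite /g mulr0 expR0 mulr1 mulNr expRN => h.
by rewrite lerBrDr -ler_pdivrMr // expR_gt0.
Qed.

Lemma time_deriv_bound (f f' : R -> R) C t1 : 0 <= t1 <= T ->
  (forall t, 0 <= t <= t1 -> is_time_derive f t (f' t)) ->
  (forall t, 0 <= t <= t1 -> `|f' t| <= C) ->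
  forall t s, 0 <= s <= t -> t <= t1 -> `|f t - f s| <= C * (t - s).
Proof.
move=> /andP[t10 t1T] df f'0 t s /andP[s0 st] tt1.
have d x : x \in `]s, t[ -> is_derive x 1 f (f' x).
  rewrite in_itv /= => /andP[x0 xt]; apply: is_time_derive_is_derive.
    by rewrite (le_lt_trans s0) ?(lt_le_trans xt) ?(le_trans tt1).
  by apply: df; rewrite (le_trans s0 (ltW x0)) (le_trans (ltW xt)).
have [|c] := MVT_segment st d.
  apply: (@continuous_subspaceW _ _ _ `[0, t1]).
    by apply: subset_itv; rewrite bnd_simp.
  by apply: time_derivable_continuous => // x /df ?; exists (f' x).
rewrite in_itv /= => /andP[c0 ct] ->.
rewrite normrM (ger0_norm (_ : 0 <= t - s)) ?subr_ge0 // ler_wpM2r ?subr_ge0 //.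
by apply: f'0; rewrite (le_trans s0 c0) (le_trans ct).
Qed.
End TimeDerivative.

(** * The Picard-Lindelof theorem *)

Section Picard.
Variables (R : realType) (T : R).
Hypothesis T0 : 0 < T.

Lemma is_derive_is_time_derive (f : R -> R) (t l : R) :
  is_derive t 1 f l -> is_time_derive T f t l.
Proof.
move=> [df fl].
have h : h^-1 *: ((f \o shift t) (h *: 1) - f t) @[h --> 0^'] --> l.
  by move: df => /cvg_ex[l' hl]; rewrite -fl /derive (cvg_lim _ hl).
rewrite /is_time_derive => A /h.
change (nbhs (0 : R) (fun k => k != 0 ->
    A (k^-1 *: ((f \o shift t) (k *: 1) - f t))) ->
  nbhs t (fun x => x != t -> x \in `[0, T] -> A (time_quot f t x))).
move=> /nbhs_ballP[e /= e0 eA]; apply/nbhs_ballP; exists e => //= x.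
rewrite /ball /= => xe xt _.
have := eA (x - t); rewrite /ball /= sub0r normrN -normrN opprB => /(_ xe).
rewrite subr_eq0 => /(_ xt).
by rewrite (_ : (x - t)%:A = x - t) ?subrK //; exact: mulr1.
Qed.

Lemma within_continuous_antiderivative (g : R -> R) :
  {within `[0, T], continuous g} ->
  exists2 F : R -> R, F 0 = 0 &
    forall t, 0 <= t <= T -> is_time_derive T F t (g t).
Proof.
(* Clamping the argument extends [g] continuously to the line. Together with an integral that starts
   at [-1], this makes every point of [[0, T]] interior for the fundamental theorem of calculus. *)
move=> cg; pose cl (t : R) := Num.max 0 (Num.min t T).
have clE t : 0 <= t <= T -> cl t = t.
  by move=> /andP[t0 tT]; rewrite /cl (min_idPl tT) (max_idPr t0).
have clI t : 0 <= cl t <= T.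
  by rewrite /cl le_max lexx /= ge_max ge_min lexx orbT andbT ltW.
have ccl : continuous cl.
  move=> x.
  apply: (@continuous_max R R (fun=> 0) (fun t => Num.min t T) x).
    exact: cst_continuous.
  by apply: (@continuous_min R R id (fun=> T) x); [exact: cvg_id|exact: cst_continuous].
have cgcl : continuous (g \o cl).
  move=> x; apply: (@cvg_comp _ _ _ cl g (nbhs x) (within `[0, T] (nbhs (cl x)))).
    move=> A hA; have := ccl x _ hA.
    change (nbhs x (fun y => cl y \in `[0, T] -> A (cl y)) -> nbhs x (fun y => A (cl y))).
    by apply: filterS => y; apply; change (cl y \in `[0, T]); rewrite in_itv; exact: clI.
  by move/subspace_continuousP : cg; apply; change (cl x \in `[0, T]); rewrite in_itv; exact: clI.
have int u : (lebesgue_measure).-integrable `[(-1 : R), u] (EFin \o (g \o cl)).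
  apply: continuous_compact_integrable; first exact: segment_compact.
  exact: continuous_subspaceT.
pose F x := (\int[lebesgue_measure]_(t in `[(-1 : R), x]) (g \o cl) t).
have dF t : 0 <= t <= T -> is_time_derive T F t (g t).
  move=> /[dup] tT /andP[t0 _].
  have [|||] := @continuous_FTC1_closed _ (g \o cl) (-1) t (t + 1) _ (int _).
  - by rewrite ltrDl.
  - by rewrite (lt_le_trans _ t0).
  - exact: cgcl.
  move=> dF Fg; apply: is_derive_is_time_derive.
  by split => //; rewrite -derive1E Fg /= clE.
exists (fun x => F x - F 0); first by rewrite subrr.
move=> t tT; rewrite -[g t]subr0; apply: is_time_deriveB; first exact: dF.
exact: is_time_derive_cst.
Qed.

Lemma le_geometric0 (x C : R) : (forall k, x <= C / 2 ^+ k) -> x <= 0.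
Proof.
move=> h; rewrite leNgt; apply/negP => x0.
have [k hk] : exists k : nat, C / x < k%:R.
  by exists (Num.bound `|C / x|); exact: le_lt_trans (ler_norm _) (archi_boundP (normr_ge0 _)).
have := h k; rewrite ler_pdivlMr ?exprn_gt0 // leNgt => /negP; apply.
move: hk; rewrite ltr_pdivrMr // mulrC => /lt_le_trans; apply.
by rewrite ler_wpM2l ?(ltW x0) // -natrX ler_nat ltnW // ltn_expl.
Qed.

(** The intervals around [u k] whose radius is the tail [2 * B / 2 ^+ k] of the geometric series are
    nested; the supremum of their left ends lies in all of them, which gives the limit together with
    its rate. *)
Lemma geometric_cauchy (u : nat -> R) B :
  (forall k, `|u k.+1 - u k| <= B / 2 ^+ k) ->
  exists l, forall k, `|l - u k| <= 2 * B / 2 ^+ k.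
Proof.
move=> h; pose e k := 2 * B / 2 ^+ k.
have eS k : e k = e k.+1 + B / 2 ^+ k.
  by rewrite /e exprS; field; rewrite expf_neq0.
have B0 : 0 <= B by have := le_trans (normr_ge0 _) (h 0%N); rewrite expr0 divr1.
have e0 k : 0 <= e k by rewrite divr_ge0 ?mulr_ge0 ?exprn_ge0.
have hk k : u k - e k <= u k.+1 - e k.+1 /\ u k.+1 + e k.+1 <= u k + e k.
  by have := h k; rewrite ler_norml eS => /andP[]; split; lra.
have inc k n : u k - e k <= u (n + k)%N - e (n + k)%N.
  elim: n => [|n IH]; first by rewrite add0n.
  by rewrite addSn (le_trans IH) // (hk _).1.
have dec k n : u (n + k)%N + e (n + k)%N <= u k + e k.
  elim: n => [|n IH]; first by rewrite add0n.
  by rewrite addSn (le_trans _ IH) // (hk _).2.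
have ub k m : u k - e k <= u m + e m.
  rewrite (le_trans (inc k m)) // (le_trans _ (dec m k)) // addnC.
  by have := e0 (k + m)%N; lra.
pose S := [set u k - e k | k in [set: nat]].
have S0 : S !=set0 by exists (u 0%N - e 0%N); exists 0%N.
have Sb : has_ubound S by exists (u 0%N + e 0%N) => _ [k _ <-].
exists (sup S) => k; rewrite ler_norml -/(e k); apply/andP; split.
  by rewrite lerBrDr addrC; apply: ub_le_sup => //; exists k.
by rewrite lerBlDr addrC; apply: ge_sup => // _ [m _ <-]; exact: ub.
Qed.

Lemma time_deriv_compare (f f' h h' : R -> R) :
  (forall t, 0 <= t <= T -> is_time_derive T f t (f' t)) ->
  (forall t, 0 <= t <= T -> is_time_derive T h t (h' t)) ->
  (forall t, 0 <= t <= T -> `|f' t| <= h' t) -> f 0 = 0 -> 0 <= h 0 ->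
  forall t, 0 <= t <= T -> `|f t| <= h t.
Proof.
move=> df dh fh f0 h0 t tT.
have T01 : 0 <= T <= T by rewrite lexx ltW.
have d1 x : 0 <= x <= T -> is_time_derive T (fun x => f x - h x) x (f' x - h' x).
  by move=> xT; apply: is_time_deriveB; [exact: df|exact: dh].
have d2 x : 0 <= x <= T -> is_time_derive T (fun x => - f x - h x) x (- f' x - h' x).
  by move=> xT; apply: is_time_deriveB; [apply: is_time_deriveN; exact: df|exact: dh].
have fh' x : 0 <= x <= T -> - h' x <= f' x <= h' x by rewrite -ler_norml; exact: fh.
have := time_nonincreasing T01 d1 _ tT; have := time_nonincreasing T01 d2 _ tT.
rewrite f0 ler_norml => h1 h2; apply/andP; split.
  by have : - f t - h t <= - 0 - h 0; [apply: h1 => x /fh'/andP[]|]; lra.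
by have : f t - h t <= 0 - h 0; [apply: h2 => x /fh'/andP[]|]; lra.
Qed.

(** The Lipschitz bound is global in the states, so a single iteration covers all of [[0, T]].
    Continuity of [G] is asked along continuous paths only, which is how the integrands of the
    iterates arise. *)
Lemma picard_lindelof (C : finType) (G : R -> (C -> R) -> C -> R) (Lam : R)
    (y0 : C -> R) :
  0 <= Lam ->
  (forall t y z c, 0 <= t <= T ->
     `|G t y c - G t z c| <= Lam * \sum_k `|y k - z k|) ->
  (forall y : R -> C -> R, (forall c, {within `[0, T], continuous (y^~ c)}) ->
     forall c, {within `[0, T], continuous (fun t => G t (y t) c)}) ->
  exists y : R -> C -> R, (forall c, y 0 c = y0 c) /\
    forall t c, 0 <= t <= T -> is_time_derive T (y^~ c) t (G t (y t) c).
Proof.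
move=> Lam0 lip cont.
(* A total antiderivative operator, with arbitrary values on functions that are not continuous, so
   that the iteration can be defined before its continuity is known. *)
pose PI (g F : R -> R) := {within `[0, T], continuous g} ->
  F 0 = 0 /\ forall t, 0 <= t <= T -> is_time_derive T F t (g t).
have [I HI] : {I : (R -> R) -> R -> R & forall g, PI g (I g)}.
  apply: choice => g; rewrite /PI.
  have [cg|ncg] := pselect {within `[0, T], continuous g}; last by exists g.
  by have [F F0 dF] := within_continuous_antiderivative cg; exists F.
pose step (y : R -> C -> R) t c := y0 c + I (fun s => G s (y s) c) t.
pose cnt (y : R -> C -> R) := forall c, {within `[0, T], continuous (y^~ c)}.
have T01 : 0 <= T <= T by rewrite lexx ltW.
have stepD y : cnt y -> forall t c, 0 <= t <= T ->
    is_time_derive T (step y ^~ c) t (G t (y t) c).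
  move=> cy t c tT; rewrite -[G _ _ _]add0r; apply: is_time_deriveD.
    exact: is_time_derive_cst.
  exact: (HI _ (cont _ cy c)).2.
have step0 y c : cnt y -> step y 0 c = y0 c.
  by move=> cy; rewrite /step (HI _ (cont _ cy c)).1 addr0.
have stepC y : cnt y -> cnt (step y).
  move=> cy c; apply: (@time_derivable_continuous _ T) => // t tT.
  by exists (G t (y t) c); exact: stepD.
pose y k := iter k step (fun=> y0).
have yC k : cnt (y k).
  elim: k => [c|k IH]; last exact: stepC.
  by apply: continuous_subspaceT; exact: cst_continuous.
have yE0 k c : y k.+1 0 c = y0 c by exact: (step0 (y k) c (yC k)).
pose n : R := #|C|%:R.
have [A A0 hA] : exists2 A : R, 0 <= A & forall t c, 0 <= t <= T -> `|y 1%N t c - y 0%N t c| <= A.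
  pose PA c (A : R) := forall t, 0 <= t <= T -> `|y 1%N t c - y 0%N t c| <= A.
  have [A hA] : {A : C -> R & forall c, PA c (A c)}.
    apply: choice => c; rewrite /PA.
    have cc : {within `[0, T], continuous (fun t => `|y 1%N t c - y 0%N t c|)}.
      by move=> x; apply: cvg_norm; apply: cvgB; exact: yC.
    have [t _ ht] := EVT_max (ltW T0) cc.
    by exists (`|y 1%N t c - y 0%N t c|) => s sT; apply: ht; rewrite in_itv.
  exists (\sum_c `|A c|) => [|t c tT]; first by apply: sumr_ge0.
  rewrite (le_trans (hA c t tT)) // (bigD1 c) //=.
  by rewrite (le_trans (ler_norm _)) // lerDl sumr_ge0.
(* In the norm weighted by [expR (- mu * t)] the Picard map contracts by [Lam * n / mu], which is
   below one half; hence no restriction to short times. *)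
pose mu := 2 * Lam * n + 1.
have n0 : 0 <= n by [].
have mu0 : 0 < mu by rewrite ltr_wpDl // !mulr_ge0.
have dexp a t : is_time_derive T (fun t => a * expR (mu * t)) t (a * (mu * expR (mu * t))).
  apply: is_derive_is_time_derive.
  have h : is_derive t 1 (fun t : R => mu * t) mu.
    by have := is_deriveZ mu (is_derive_id t (1 : R)); rewrite /GRing.scale /= mulr1.
  have h2 := is_derive1_comp (is_derive_expR (mu * t)) h.
  have := is_deriveZ a h2; rewrite /GRing.scale /= [mu * expR _]mulrC; exact.
have key k : forall t c, 0 <= t <= T ->
    `|y k.+1 t c - y k t c| <= A / 2 ^+ k * expR (mu * t).
  elim: k => [|k IH] t c tT.
    rewrite expr0 divr1 (le_trans (hA _ _ tT)) // ler_peMr // -expR0 ler_expR.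
    by rewrite mulr_ge0 ?(ltW mu0) //; case/andP: tT.
  apply: (@time_deriv_compare (fun t => y k.+2 t c - y k.+1 t c)
    (fun t => G t (y k.+1 t) c - G t (y k t) c)
    (fun t => A / 2 ^+ k.+1 * expR (mu * t))
    (fun t => A / 2 ^+ k.+1 * (mu * expR (mu * t)))) => //.
  - move=> s sT; apply: is_time_deriveB.
      exact: (stepD (y k.+1) (yC _) s c sT).
    exact: (stepD (y k) (yC _) s c sT).
  - move=> s sT; rewrite (le_trans (lip _ _ _ _ sT)) //.
    have : \sum_k0 `|y k.+1 s k0 - y k s k0| <= n * (A / 2 ^+ k * expR (mu * s)).
      rewrite /n mulr_natl -sumr_const; apply: ler_sum => j _; exact: IH.
    move=> /(ler_wpM2l Lam0) /le_trans; apply.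
    rewrite exprS invfM !mulrA.
    have -> : A / 2 / 2 ^+ k * mu * expR (mu * s) =
      (A / 2 ^+ k * expR (mu * s)) * (mu / 2) by field; rewrite expf_neq0.
    have -> : Lam * n * A / 2 ^+ k * expR (mu * s) =
      (A / 2 ^+ k * expR (mu * s)) * (Lam * n) by field; rewrite expf_neq0.
    rewrite ler_wpM2l ?mulr_ge0 ?expR_ge0 ?invr_ge0 ?exprn_ge0 //.
    by rewrite /mu; lra.
  - by rewrite !yE0 subrr.
  - by rewrite !mulr_ge0 ?expR_ge0 // invr_ge0 exprn_ge0.
pose B := A * expR (mu * T).
have B0 : 0 <= B by rewrite mulr_ge0 ?expR_ge0.
have keyB k t c : 0 <= t <= T -> `|y k.+1 t c - y k t c| <= B / 2 ^+ k.
  move=> tT; rewrite (le_trans (key k t c tT)) // /B mulrAC.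
  rewrite ler_wpM2r ?invr_ge0 ?exprn_ge0 // ler_wpM2l // ler_expR.
  by rewrite ler_wpM2l ?(ltW mu0) //; case/andP: tT.
have [z hz] : exists z : R -> C -> R, forall t c, 0 <= t <= T ->
    forall k, `|z t c - y k t c| <= 2 * B / 2 ^+ k.
  pose PZ (tc : R * C) (z : R) := 0 <= tc.1 <= T ->
    forall k, `|z - y k tc.1 tc.2| <= 2 * B / 2 ^+ k.
  have [z hz] : {z : R * C -> R & forall tc, PZ tc (z tc)}.
    apply: choice => -[t c]; rewrite /PZ /=.
    have [tT|ntT] := pselect (0 <= t <= T); last by exists 0.
    have [l hl] := @geometric_cauchy (fun k => y k t c) B (fun k => keyB k t c tT).
    by exists l.
  by exists (fun t c => z (t, c)) => t c; exact: (hz (t, c)).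
have zC : cnt z.
  move=> c; apply/subspace_continuousP => x /=; rewrite in_itv /= => xT.
  apply/cvgrPdist_le => e e0.
  have [k hk] : exists k, 2 * B / 2 ^+ k <= e / 3.
    apply: contrapT => /forallNP h.
    have : e / 3 <= 0.
      by apply: (@le_geometric0 _ (2 * B)) => k; have /negP := h k; rewrite -ltNge => /ltW.
    lra.
  have /subspace_continuousP/(_ x) := yC k c; rewrite /= in_itv /= => /(_ xT).
  move=> /cvgrPdist_le /(_ (e / 3)) h.
  have {}h := h ltac:(lra); move: h.
  change (nbhs x (fun t => t \in `[0, T] -> `|y k x c - y k t c| <= e / 3) ->
    nbhs x (fun t => t \in `[0, T] -> `|z x c - z t c| <= e)).
  apply: filterS => t ht tT; have {}ht := ht tT.
  rewrite in_itv /= in tT.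
  have h1 := le_trans (hz x c xT k) hk; have h2 := le_trans (hz t c tT k) hk.
  move: ht h1 h2; rewrite !ler_norml => /andP[? ?] /andP[? ?] /andP[? ?].
  by apply/andP; split; lra.
(* Both sides are within a multiple of [2 ^- k] of the iterate [y k.+1], for every [k]. *)
have zE t c : 0 <= t <= T -> step z t c = z t c.
  move=> tT; apply/eqP; rewrite -subr_eq0 -normr_le0.
  apply: (@le_geometric0 _ (Lam * (n * (2 * B)) * T + B)) => k.
  have h1 : `|(fun t => step z t c - y k.+1 t c) t - (fun t => step z t c - y k.+1 t c) 0|
      <= (Lam * (n * (2 * B / 2 ^+ k))) * (t - 0).
    apply: (@time_deriv_bound R T (fun t => step z t c - y k.+1 t c)
      (fun t => G t (z t) c - G t (y k t) c) (Lam * (n * (2 * B / 2 ^+ k))) T) => //.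
    - move=> s sT; apply: is_time_deriveB; first exact: (stepD z zC s c sT).
      exact: (stepD (y k) (yC _) s c sT).
    - move=> s sT; rewrite (le_trans (lip _ _ _ _ sT)) // ler_wpM2l //.
      by rewrite /n mulr_natl -sumr_const; apply: ler_sum => j _; exact: hz.
    - by rewrite lexx; case/andP: tT.
    - by case/andP: tT.
  move: h1; rewrite step0 // yE0 subrr subr0 => h1.
  rewrite subr0 in h1.
  have h2 := hz t c tT k.+1.
  rewrite -(subrK (y k.+1 t c) (step z t c)) -addrA (le_trans (ler_normD _ _)) //.
  rewrite mulrDl lerD //.
    rewrite (le_trans h1) // -!mulrA ler_wpM2l // ler_wpM2l // ler_wpM2l // ler_wpM2l //.
    rewrite ler_wpM2l ?expR_ge0 // mulrC ler_wpM2r ?invr_ge0 ?exprn_ge0 //.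
    by case/andP: tT.
  rewrite distrC (le_trans h2) // exprS le_eqVlt; apply/orP; left; apply/eqP.
  by field; rewrite expf_neq0.
exists z; split => [c|t c tT].
  by rewrite -zE ?step0 // lexx ltW.
apply: (@eq_is_time_derive _ T _ (step z ^~ c)) => // [s sT|].
  exact: zE.
exact: stepD.
Qed.
End Picard.

(** * Lipschitz bounds and cross differences *)

Section NormHelpers.
Variable R : realType.
Implicit Types x y z a b c : R.

Lemma normM_le x y a b : `|x| <= a -> `|y| <= b -> `|x * y| <= a * b.
Proof. by move=> xa yb; rewrite normrM ler_pM. Qed.

Lemma normD_le x y a b : `|x| <= a -> `|y| <= b -> `|x + y| <= a + b.
Proof. by move=> xa yb; rewrite (le_trans (ler_normD _ _)) // lerD. Qed.

Lemma normB_le x y a b : `|x| <= a -> `|y| <= b -> `|x - y| <= a + b.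
Proof. by move=> xa yb; rewrite (le_trans (ler_normB _ _)) // lerD. Qed.

Lemma mean_bound (g g' : R -> R) (C : R) :
  (forall s : R, 0 <= s <= 1 -> is_derive s 1 g (g' s)) ->
  (forall s, 0 <= s <= 1 -> `|g' s| <= C) -> `|g 1 - g 0| <= C.
Proof.
move=> dg hC.
have [| |s] := @MVT_segment R g g' 0 1 ler01.
- by move=> x; rewrite in_itv /= => /andP[x0 x1]; apply: dg; rewrite !ltW.
- apply: derivable_within_continuous => x; rewrite in_itv /= => xI.
  by have [] := dg x xI.
by rewrite in_itv /= => sI ->; rewrite subr0 mulr1; exact: hC.
Qed.
End NormHelpers.

Section CrossDifferences.
Variables (R : realType) (X : Type) (S : set X) (dst : X -> X -> R).
Hypothesis dst0 : forall a b, 0 <= dst a b.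
Implicit Types (f g : X -> R) (F G : X -> X -> R) (c C D : R).

Definition lip_bounded f := exists2 C : R, 0 <= C & forall a b, S a -> S b ->
  `|f a| <= C /\ `|f a - f b| <= C * dst a b.

(* Bounds on cross differences take the place of bounds on second derivatives:
   they are stable under products and inverses without any convexity of [S]. *)
Definition cross_diff F a a' b b' := F a' b' - F a' b - F a b' + F a b.

(** Values and first differences are included because the mixed difference of a product involves
    them. *)
Definition cross_bound C F := forall a a' b b', S a -> S a' -> S b -> S b' ->
  [/\ `|F a b| <= C, `|F a' b - F a b| <= C * dst a' a,
      `|F a b' - F a b| <= C * dst b' b &
      `|cross_diff F a a' b b'| <= C * (dst a' a * dst b' b)].

Definition cross_bounded F := exists2 C : R, 0 <= C & cross_bound C F.

Lemma lip_bounded_cst c : lip_bounded (fun=> c).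
Proof.
exists `|c| => // a b Sa Sb; split => //.
by rewrite subrr normr0 mulr_ge0.
Qed.

Lemma lip_boundedD f g :
  lip_bounded f -> lip_bounded g -> lip_bounded (fun a => f a + g a).
Proof.
move=> [C C0 hC] [D D0 hD]; exists (C + D); first exact: addr_ge0.
move=> a b Sa Sb; have [f1 f2] := hC a b Sa Sb; have [g1 g2] := hD a b Sa Sb.
split; first exact: normD_le.
by rewrite opprD addrACA mulrDl normD_le.
Qed.

Lemma lip_boundedM f g :
  lip_bounded f -> lip_bounded g -> lip_bounded (fun a => f a * g a).
Proof.
move=> [C C0 hC] [D D0 hD]; exists (C * D + C * D).
  by rewrite addr_ge0 ?mulr_ge0.
move=> a b Sa Sb; have [f1 f2] := hC a b Sa Sb; have [g1 g2] := hD a b Sa Sb.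
have [g1' _] := hD b b Sb Sb; split.
  by rewrite (le_trans (normM_le f1 g1)) // lerDl mulr_ge0.
have -> : f a * g a - f b * g b = f a * (g a - g b) + (f a - f b) * g b by ring.
rewrite [X in _ <= X]mulrDl normD_le //.
  by rewrite -mulrA normM_le.
by rewrite (le_trans (normM_le f2 g1')) // mulrAC.
Qed.

Lemma lip_boundedN f : lip_bounded f -> lip_bounded (fun a => - f a).
Proof.
move=> [C C0 hC]; exists C => // a b Sa Sb; have [h1 h2] := hC a b Sa Sb.
by rewrite normrN -opprD normrN.
Qed.

Lemma lip_boundedB f g :
  lip_bounded f -> lip_bounded g -> lip_bounded (fun a => f a - g a).
Proof. by move=> hf hg; apply: lip_boundedD => //; apply: lip_boundedN. Qed.

Lemma lip_bounded_sum (I : Type) (r : seq I) (f : I -> X -> R) :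
  (forall i, lip_bounded (f i)) -> lip_bounded (fun a => \sum_(i <- r) f i a).
Proof.
move=> h; elim: r => [|i r IH].
  by under eq_fun do rewrite big_nil; exact: lip_bounded_cst.
by under eq_fun do rewrite big_cons; exact: lip_boundedD.
Qed.

Lemma lip_boundedV f c0 : 0 < c0 -> (forall a, S a -> c0 <= f a) ->
  lip_bounded f -> lip_bounded (fun a => (f a)^-1).
Proof.
move=> c00 fc [C C0 hC]; exists (c0^-1 + C / c0 ^+ 2).
  by rewrite addr_ge0 ?divr_ge0 ?invr_ge0 ?exprn_ge0 // ltW.
have f0 a : S a -> 0 < f a by move=> /fc; exact: lt_le_trans.
have fV a : S a -> `|(f a)^-1| <= c0^-1.
  by move=> Sa; rewrite gtr0_norm ?invr_gt0 ?f0 // lef_pV2 ?posrE ?f0 ?fc.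
move=> a b Sa Sb; have [_ h2] := hC a b Sa Sb; split.
  by rewrite (le_trans (fV _ Sa)) // lerDl divr_ge0 ?exprn_ge0 // ltW.
have -> : (f a)^-1 - (f b)^-1 = - (f a - f b) * ((f a)^-1 * (f b)^-1).
  by field; rewrite !gt_eqF ?f0.
have : `|- (f a - f b) * ((f a)^-1 * (f b)^-1)| <= C * dst a b * (c0^-1 * c0^-1).
  by apply: normM_le; [rewrite normrN|apply: normM_le; exact: fV].
move=> /le_trans; apply; rewrite mulrDl.
have -> : C * dst a b * (c0^-1 * c0^-1) = C / c0 ^+ 2 * dst a b.
  by rewrite expr2 invfM; ring.
by rewrite lerDr mulr_ge0 // invr_ge0 ltW.
Qed.

Lemma lip_bounded_ln f c0 : 0 < c0 -> (forall a, S a -> c0 <= f a) ->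
  lip_bounded f -> lip_bounded (fun a => ln (f a)).
Proof.
move=> c00 fc [C C0 hC].
have f0 a : S a -> 0 < f a by move=> /fc; exact: lt_le_trans.
have key (x y : R) : 0 < x -> 0 < y -> ln x - ln y <= (x - y) / y.
  move=> x0 y0; rewrite -ln_div ?posrE //.
  have := @le_ln1Dx R (x / y - 1).
  have -> : 1 + (x / y - 1) = x / y by ring.
  have -> : (x - y) / y = x / y - 1 by rewrite mulrBl divff ?gt_eqF.
  by apply; rewrite ltrBrDl subrr divr_gt0.
have key2 (x y : R) : c0 <= x -> c0 <= y -> `|ln x - ln y| <= c0^-1 * `|x - y|.
  move=> cx cy; have x0 := lt_le_trans c00 cx; have y0 := lt_le_trans c00 cy.
  have h z w : c0 <= w -> (z - w) / w <= c0^-1 * `|z - w|.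
    move=> cw; have w0 := lt_le_trans c00 cw.
    rewrite (le_trans (ler_norm _)) // normrM mulrC ler_wpM2r //.
    by rewrite gtr0_norm ?invr_gt0 // lef_pV2.
  rewrite ler_norml; apply/andP; split.
    by rewrite lerNl opprB (le_trans (key _ _ y0 x0)) // distrC h.
  by rewrite (le_trans (key _ _ x0 y0)) // h.
exists (`|ln c0| + c0^-1 * (C + c0) + c0^-1 * C).
  by rewrite !addr_ge0 ?mulr_ge0 ?addr_ge0 ?invr_ge0 // ltW.
move=> a b Sa Sb; have [h1 h2] := hC a b Sa Sb; split.
  rewrite -(subrK (ln c0) (ln (f a))).
  have h3 : `|ln (f a) - ln c0| <= c0^-1 * (C + c0).
    rewrite (le_trans (key2 _ _ (fc _ Sa) (lexx _))) // ler_wpM2l ?invr_ge0 ?(ltW c00) //.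
    by apply: normB_le => //; rewrite ger0_norm // ltW.
  rewrite (le_trans (ler_normD _ _)) //.
  have : 0 <= c0^-1 * C by rewrite mulr_ge0 // invr_ge0 ltW.
  lra.
rewrite (le_trans (key2 _ _ (fc _ Sa) (fc _ Sb))) //.
rewrite (@le_trans _ _ (c0^-1 * C * dst a b)) //.
  by rewrite -mulrA ler_wpM2l // invr_ge0 ltW.
by rewrite ler_wpM2r // lerDr addr_ge0 ?mulr_ge0 ?addr_ge0 ?invr_ge0 // ltW.
Qed.

Lemma eq_lip_bounded f g : (forall a, S a -> f a = g a) ->
  lip_bounded f -> lip_bounded g.
Proof. by move=> fg [C C0 h]; exists C => // a b Sa Sb; rewrite -!fg //; exact: h. Qed.

Lemma cross_bound_le C C' F : C <= C' -> cross_bound C F -> cross_bound C' F.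
Proof.
move=> CC h a a' b b' Sa Sa' Sb Sb'; have [h1 h2 h3 h4] := h a a' b b' Sa Sa' Sb Sb'.
split.
- exact: le_trans CC.
- by rewrite (le_trans h2) // ler_wpM2r.
- by rewrite (le_trans h3) // ler_wpM2r.
- by rewrite (le_trans h4) // ler_wpM2r ?mulr_ge0.
Qed.

Lemma cross_bounded_l f : lip_bounded f -> cross_bounded (fun a _ => f a).
Proof.
move=> [C C0 hC]; exists C => // a a' b b' Sa Sa' Sb Sb'.
have [h1 _] := hC a a Sa Sa; have [_ h2] := hC a' a Sa' Sa; split => //.
  by rewrite subrr normr0 mulr_ge0.
by rewrite /cross_diff subrr sub0r addNr normr0 !mulr_ge0.
Qed.

Lemma cross_bounded_r f : lip_bounded f -> cross_bounded (fun _ b => f b).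
Proof.
move=> [C C0 hC]; exists C => // a a' b b' Sa Sa' Sb Sb'.
have [h1 _] := hC b b Sb Sb; have [_ h2] := hC b' b Sb' Sb; split => //.
  by rewrite subrr normr0 mulr_ge0.
rewrite /cross_diff (_ : _ + _ = 0) ?normr0 ?mulr_ge0 //; ring.
Qed.

Lemma cross_boundD F G C D : cross_bound C F -> cross_bound D G ->
  cross_bound (C + D) (fun a b => F a b + G a b).
Proof.
move=> hC hD a a' b b' Sa Sa' Sb Sb'.
have [f1 f2 f3 f4] := hC a a' b b' Sa Sa' Sb Sb'.
have [g1 g2 g3 g4] := hD a a' b b' Sa Sa' Sb Sb'.
split; first exact: normD_le.
- by rewrite opprD addrACA mulrDl normD_le.
- by rewrite opprD addrACA mulrDl normD_le.
- rewrite mulrDl (_ : cross_diff _ _ _ _ _ = cross_diff F a a' b b' + cross_diff G a a' b b').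
    exact: normD_le.
  by rewrite /cross_diff; ring.
Qed.

Lemma cross_boundedD F G : cross_bounded F -> cross_bounded G ->
  cross_bounded (fun a b => F a b + G a b).
Proof.
move=> [C C0 hC] [D D0 hD]; exists (C + D); first exact: addr_ge0.
exact: cross_boundD.
Qed.

Lemma cross_boundedM F G : cross_bounded F -> cross_bounded G ->
  cross_bounded (fun a b => F a b * G a b).
Proof.
move=> [C C0 hC] [D D0 hD]; pose E := C * D; exists (4 * E).
  by rewrite !mulr_ge0.
have E0 : 0 <= E by rewrite mulr_ge0.
move=> a a' b b' Sa Sa' Sb Sb'.
have [f1 f2 f3 f4] := hC a a' b b' Sa Sa' Sb Sb'.
have [g1 g2 g3 g4] := hD a a' b b' Sa Sa' Sb Sb'.
have [g1' _ _ _] := hD a' a b b' Sa' Sa Sb Sb'.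
have [g1'' _ _ _] := hD a a' b' b Sa Sa' Sb' Sb.
have [G1 _ _ _] := hD a' a b' b Sa' Sa Sb' Sb.
have [_ g2' _ _] := hD a a' b' b Sa Sa' Sb' Sb.
have [_ _ g3' _] := hD a' a b b' Sa' Sa Sb Sb'.
have p1 : 0 <= E * dst a' a by rewrite mulr_ge0.
have p2 : 0 <= E * dst b' b by rewrite mulr_ge0.
have p3 : 0 <= E * (dst a' a * dst b' b) by rewrite !mulr_ge0.
split.
- by rewrite (le_trans (normM_le f1 g1)) // -/E; lra.
- have -> : F a' b * G a' b - F a b * G a b =
    (F a' b - F a b) * G a' b + F a b * (G a' b - G a b) by ring.
  have h1 := normM_le f2 g1'; have h2 := normM_le f1 g2.
  rewrite (le_trans (normD_le h1 h2)) //.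
  rewrite mulrAC -/E mulrA -/E -mulrA; lra.
- have -> : F a b' * G a b' - F a b * G a b =
    (F a b' - F a b) * G a b' + F a b * (G a b' - G a b) by ring.
  have h1 := normM_le f3 g1''; have h2 := normM_le f1 g3.
  rewrite (le_trans (normD_le h1 h2)) //.
  rewrite mulrAC -/E mulrA -/E -mulrA; lra.
- have -> : cross_diff (fun a b => F a b * G a b) a a' b b' =
    (cross_diff F a a' b b' * G a' b' + (F a' b - F a b) * (G a' b' - G a' b))
    + ((F a b' - F a b) * (G a' b' - G a b') + F a b * cross_diff G a a' b b').
    by rewrite /cross_diff; ring.
  have h1 := normM_le f4 G1; have h2 := normM_le f2 g3'.
  have h3 := normM_le f3 g2'; have h4 := normM_le f1 g4.
  rewrite (le_trans (normD_le (normD_le h1 h2) (normD_le h3 h4))) //.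
  rewrite le_eqVlt; apply/orP; left; apply/eqP; rewrite /E; ring.
Qed.

Lemma cross_bounded_sum (I : Type) (r : seq I) (F : I -> X -> X -> R) :
  (forall i, cross_bounded (F i)) ->
  cross_bounded (fun a b => \sum_(i <- r) F i a b).
Proof.
move=> h; elim: r => [|i r IH].
  under eq_fun do under eq_fun do rewrite big_nil.
  exact: (cross_bounded_l (lip_bounded_cst 0)).
under eq_fun do under eq_fun do rewrite big_cons.
exact: cross_boundedD.
Qed.

(** Explicit, and not hidden under an existential, because the logarithmic mean needs one constant
    for a whole family of functions [F]. *)
Definition inv_cross_const C c0 : R :=
  c0^-1 + C / c0 ^+ 2 + (C / c0 + 2 * (C * (C / c0 ^+ 2))) / c0.

(* Applying the product rule for cross differences to F * F^-1 = 1 expresses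
   the cross difference of F^-1 through that of F. *)
Lemma cross_boundV F C c0 : 0 < c0 -> 0 <= C ->
  (forall a b, S a -> S b -> c0 <= F a b) -> cross_bound C F ->
  cross_bound (inv_cross_const C c0) (fun a b => (F a b)^-1).
Proof.
move=> c00 C0 Fc hC.
have F0 a b : S a -> S b -> 0 < F a b by move=> Sa Sb; exact: lt_le_trans (Fc _ _ Sa Sb).
have FV a b : S a -> S b -> `|(F a b)^-1| <= c0^-1.
  move=> Sa Sb; rewrite gtr0_norm ?invr_gt0 ?F0 //.
  by rewrite lef_pV2 ?posrE ?F0 ?Fc.
have q1 : 0 <= c0^-1 by rewrite invr_ge0 ltW.
have q2 : 0 <= C / c0 ^+ 2 by rewrite mulr_ge0 ?invr_ge0 ?exprn_ge0 // ltW.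
have q3 : 0 <= (C / c0 + 2 * (C * (C / c0 ^+ 2))) / c0.
  by rewrite mulr_ge0 // addr_ge0 //; apply: mulr_ge0 => //; apply: mulr_ge0.
have dV (x y D : R) : c0 <= x -> c0 <= y -> `|x - y| <= C * D ->
    `|x^-1 - y^-1| <= C / c0 ^+ 2 * D.
  move=> cx cy h; have x0 := lt_le_trans c00 cx; have y0 := lt_le_trans c00 cy.
  have -> : x^-1 - y^-1 = - (x - y) * (x^-1 * y^-1) by field; rewrite !gt_eqF.
  have -> : C / c0 ^+ 2 * D = C * D * (c0^-1 * c0^-1) by rewrite expr2 invfM; ring.
  apply: normM_le; first by rewrite normrN.
  by apply: normM_le; rewrite gtr0_norm ?invr_gt0 // lef_pV2.
move=> a a' b b' Sa Sa' Sb Sb'.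
have [f1 f2 f3 f4] := hC a a' b b' Sa Sa' Sb Sb'.
have [_ f2' _ _] := hC a a' b' b Sa Sa' Sb' Sb.
have [_ _ f3' _] := hC a' a b b' Sa' Sa Sb Sb'.
have g2' := dV _ _ _ (Fc _ _ Sa' Sb') (Fc _ _ Sa Sb') f2'.
have g3' := dV _ _ _ (Fc _ _ Sa' Sb') (Fc _ _ Sa' Sb) f3'.
split.
- by rewrite (le_trans (FV _ _ Sa Sb)) // /inv_cross_const -addrA lerDl addr_ge0.
- rewrite (le_trans (dV _ _ _ (Fc _ _ Sa' Sb) (Fc _ _ Sa Sb) f2)) // ler_wpM2r //.
  by rewrite /inv_cross_const addrAC lerDr addr_ge0.
- rewrite (le_trans (dV _ _ _ (Fc _ _ Sa Sb') (Fc _ _ Sa Sb) f3)) // ler_wpM2r //.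
  by rewrite /inv_cross_const addrAC lerDr addr_ge0.
- have -> : cross_diff (fun a b => (F a b)^-1) a a' b b' =
    - ((cross_diff F a a' b b' * (F a' b')^-1
       + (F a' b - F a b) * ((F a' b')^-1 - (F a' b)^-1)
       + (F a b' - F a b) * ((F a' b')^-1 - (F a b')^-1)) * (F a b)^-1).
    by rewrite /cross_diff; field; rewrite !gt_eqF ?F0.
  rewrite normrN.
  have h1 := normM_le f4 (FV _ _ Sa' Sb').
  have h2 := normM_le f2 g3'; have h3 := normM_le f3 g2'.
  have := normM_le (normD_le (normD_le h1 h2) h3) (FV _ _ Sa Sb).
  move=> /le_trans; apply; set D := dst a' a; set D' := dst b' b.
  have -> : (C * (D * D') / c0 + C * D * (C / c0 ^+ 2 * D')
    + C * D' * (C / c0 ^+ 2 * D)) / c0 =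
    (C / c0 + 2 * (C * (C / c0 ^+ 2))) / c0 * (D * D') by ring.
  apply: ler_wpM2r; first by rewrite mulr_ge0 // /D /D'.
  by rewrite /inv_cross_const lerDr addr_ge0.
Qed.

Lemma cross_boundedV F c0 : 0 < c0 -> (forall a b, S a -> S b -> c0 <= F a b) ->
  cross_bounded F -> cross_bounded (fun a b => (F a b)^-1).
Proof.
move=> c00 Fc [C C0 hC]; exists (inv_cross_const C c0); last exact: cross_boundV.
by rewrite /inv_cross_const !addr_ge0 ?mulr_ge0 ?addr_ge0 ?mulr_ge0 ?invr_ge0 ?exprn_ge0 ?(ltW c00).
Qed.
End CrossDifferences.

(** * The logarithmic mean *)

Section LogMean.
Variable R : realType.
Implicit Types x y s : R.

Lemma eq_is_derive1 (f g : R -> R) (x a b : R) : f =1 g -> a = b ->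
  is_derive x 1 f a -> is_derive x 1 g b.
Proof. by move=> /funext -> ->. Qed.

Lemma is_derive_affine (a b x : R) : is_derive x 1 (fun t => a + b * t) b.
Proof.
have h := is_deriveD (is_derive_cst a x (1 : R)) (is_deriveZ b (is_derive_id x (1 : R))).
by apply: eq_is_derive1 h => //; rewrite add0r /GRing.scale /= mulr1.
Qed.

(* The primitive in [s] of [1 / (s x + (1 - s) y)], so that the logarithmic mean
   is the inverse of the mean of [1 / (s x + (1 - s) y)] over [s] in [0, 1]. *)
Definition log_interp x y s : R :=
  if x == y then s / y else (ln (s * x + (1 - s) * y) - ln y) / (x - y).

Lemma log_interp0 x y : log_interp x y 0 = 0.
Proof.
by rewrite /log_interp; case: ifP; rewrite ?mul0r // add0r subr0 mul1r subrr mul0r.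
Qed.

Lemma log_interp1 x y : log_interp x y 1 = (logmean x y)^-1.
Proof.
rewrite /log_interp /logmean; case: eqVneq => [->|_]; first exact: mul1r.
by rewrite mul1r subrr mul0r addr0 invf_div.
Qed.

Lemma interp_gt0 x y s : 0 < x -> 0 < y -> 0 <= s <= 1 -> 0 < s * x + (1 - s) * y.
Proof.
move=> x0 y0 /andP[s0 s1]; have [->|sn] := eqVneq s 0.
  by rewrite mul0r add0r subr0 mul1r.
by rewrite ltr_wpDr ?mulr_ge0 ?subr_ge0 ?(ltW y0) // mulr_gt0 // lt_def sn.
Qed.

Lemma is_derive_log_interp x y s : 0 < x -> 0 < y -> 0 <= s <= 1 ->
  is_derive s 1 (log_interp x y) (s * x + (1 - s) * y)^-1.
Proof.
move=> x0 y0 s01; have p := interp_gt0 x0 y0 s01.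
have [->|xy] := eqVneq x y.
  have := is_derive_affine 0 y^-1 s; apply: eq_is_derive1 => [t|].
    by rewrite /log_interp eqxx add0r mulrC.
  by congr (_^-1); ring.
have h1 := is_derive_affine y (x - y) s.
have h2 : is_derive (y + (x - y) * s) 1 (@ln R) (y + (x - y) * s)^-1.
  by apply: is_derive1_ln; rewrite (_ : _ + _ = s * x + (1 - s) * y) //; ring.
have h3 := @is_derive1_comp R (@ln R) (fun t => y + (x - y) * t) s _ _ h2 h1.
have h4 := is_deriveZ (x - y)^-1 (is_deriveB h3 (is_derive_cst (ln y) s (1 : R))).
apply: eq_is_derive1 h4 => [t|].
  rewrite /log_interp (negbTE xy) mulrC; congr (_ * _).
  by rewrite /=; congr (ln _ - _); ring.
rewrite subr0 /GRing.scale /= mulrC -mulrA divff ?mulr1 ?subr_eq0 //.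
by congr (_^-1); ring.
Qed.

Lemma inv_logmean_mean x y : 0 < x -> 0 < y ->
  exists2 s, 0 <= s <= 1 & (logmean x y)^-1 = (s * x + (1 - s) * y)^-1.
Proof.
move=> x0 y0.
have d s : 0 <= s <= 1 -> is_derive s 1 (log_interp x y) (s * x + (1 - s) * y)^-1.
  exact: is_derive_log_interp.
have [||s] := @MVT_segment R (log_interp x y) (fun s => (s * x + (1 - s) * y)^-1) 0 1 ler01.
- by move=> s; rewrite in_itv /= => /andP[s0 s1]; apply: d; rewrite !ltW.
- apply: derivable_within_continuous => s; rewrite in_itv /= => sI.
  by have [] := d s sI.
rewrite in_itv /= => sI; rewrite log_interp0 log_interp1 !subr0 mulr1 => E.
by exists s.
Qed.

Lemma logmean_between x y c0 C : 0 < c0 -> c0 <= x <= C -> c0 <= y <= C ->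
  c0 <= logmean x y <= C.
Proof.
move=> c00 /andP[cx xC] /andP[cy yC].
have x0 := lt_le_trans c00 cx; have y0 := lt_le_trans c00 cy.
have [s /andP[s0 s1] /invr_inj ->] := inv_logmean_mean x0 y0.
have := mulr_ge0 s0; have s1' : 0 <= 1 - s by rewrite subr_ge0.
move=> h; have h2 := @mulr_ge0 _ _ _ s1'.
have := h (x - c0); have := h (C - x); have := h2 (y - c0); have := h2 (C - y).
rewrite !subr_ge0 => /(_ yC) ? /(_ cy) ? /(_ xC) ? /(_ cx) ?.
by apply/andP; split; lra.
Qed.

Lemma logmeanC x y : logmean x y = logmean y x.
Proof.
rewrite /logmean eq_sym; case: eqVneq => [->//|_].
by rewrite -opprB -(opprB (ln y)) invrN mulrNN.
Qed.

Lemma logmeanxx x : logmean x x = x.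
Proof. by rewrite /logmean eqxx. Qed.

Lemma logmean_mul_ln x y : 0 < x -> 0 < y -> logmean x y * (ln x - ln y) = x - y.
Proof.
move=> x0 y0; rewrite /logmean; case: eqVneq => [->|xy]; first by rewrite !subrr mulr0.
rewrite divfK // subr_eq0; apply: contra xy => /eqP h.
by apply/eqP; apply: ln_inj h; rewrite posrE.
Qed.

Section Cross.
Variables (X : Type) (S : set X) (dst : X -> X -> R).
Hypothesis dst0 : forall a b, 0 <= dst a b.

(** The functions [r s] are inverses of affine combinations and satisfy one cross bound for all [s].
    The mean value theorem, applied in [s] to the matching differences of [log_interp], hands this
    bound to the inverse mean. *)
Lemma cross_bounded_logmean (f : X -> R) c0 : 0 < c0 ->
  (forall a, S a -> c0 <= f a) -> lip_bounded S dst f ->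
  cross_bounded S dst (fun a b => logmean (f a) (f b)).
Proof.
move=> c00 fc lf; have [C C0 hC] := lf.
have fC a : S a -> c0 <= f a <= C.
  by move=> Sa; rewrite fc // (le_trans (ler_norm _)) // (hC a a Sa Sa).1.
have f0 a : S a -> 0 < f a by move=> /fc; exact: lt_le_trans.
pose K := inv_cross_const C c0.
pose r s a b := (s * f a + (1 - s) * f b)^-1.
have hr s : 0 <= s <= 1 -> cross_bound S dst K (r s).
  move=> /andP[s0 s1]; have s1' : 0 <= 1 - s by rewrite subr_ge0.
  apply: cross_boundV => // [a b Sa Sb|a a' b b' Sa Sa' Sb Sb'].
    have := mulr_ge0 s0; have := mulr_ge0 s1'; move=> h2 h.
    have := h (f a - c0); have := h2 (f b - c0).
    by rewrite !subr_ge0 => /(_ (fc _ Sb)) ? /(_ (fc _ Sa)) ?; lra.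
  have [ha _] := hC a a Sa Sa; have [hb _] := hC b b Sb Sb.
  have [_ ha'] := hC a' a Sa' Sa; have [_ hb'] := hC b' b Sb' Sb.
  split.
  - rewrite (le_trans (ler_normD _ _)) // !normrM (ger0_norm s0) (ger0_norm s1').
    by have := ler_wpM2l s0 ha; have := ler_wpM2l s1' hb; lra.
  - rewrite (_ : _ - _ = s * (f a' - f a)); last by ring.
    by rewrite normrM (ger0_norm s0) (le_trans _ ha') // ler_piMl.
  - rewrite (_ : _ - _ = (1 - s) * (f b' - f b)); last by ring.
    by rewrite normrM (ger0_norm s1') (le_trans _ hb') // ler_piMl // gerBl.
  - rewrite /cross_diff (_ : _ + _ = 0); last by ring.
    by rewrite normr0 !mulr_ge0.
have dl a b s : S a -> S b -> 0 <= s <= 1 ->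
    is_derive s 1 (log_interp (f a) (f b)) (r s a b).
  by move=> Sa Sb sI; apply: is_derive_log_interp => //; exact: f0.
have hinv : cross_bounded S dst (fun a b => (logmean (f a) (f b))^-1).
  exists K.
    by rewrite /K /inv_cross_const !addr_ge0 ?mulr_ge0 ?addr_ge0 ?mulr_ge0 ?invr_ge0 ?exprn_ge0 ?(ltW c00).
  move=> a a' b b' Sa Sa' Sb Sb'.
  pose L (u v : X) s := log_interp (f u) (f v) s.
  have E (u v : X) : (logmean (f u) (f v))^-1 = L u v 1 - L u v 0.
    by rewrite /L log_interp0 log_interp1 subr0.
  have K1 s : 0 <= s <= 1 -> _ := fun sI => hr s sI a a' b b' Sa Sa' Sb Sb'.
  split.
  - rewrite E; apply: (@mean_bound _ _ (fun s => r s a b)) => s sI; first exact: dl.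
    by have [] := K1 s sI.
  - rewrite !E (_ : _ - _ = (fun s => L a' b s - L a b s) 1 - (fun s => L a' b s - L a b s) 0).
      apply: (@mean_bound R (fun s => L a' b s - L a b s) (fun s => r s a' b - r s a b)) => s sI.
        by apply: is_deriveB; exact: dl.
      by have [] := K1 s sI.
    ring.
  - rewrite !E (_ : _ - _ = (fun s => L a b' s - L a b s) 1 - (fun s => L a b' s - L a b s) 0).
      apply: (@mean_bound R (fun s => L a b' s - L a b s) (fun s => r s a b' - r s a b)) => s sI.
        by apply: is_deriveB; exact: dl.
      by have [] := K1 s sI.
    ring.
  - rewrite /cross_diff !E (_ : _ + _ = (fun s => L a' b' s - L a' b s - L a b' s + L a b s) 1
      - (fun s => L a' b' s - L a' b s - L a b' s + L a b s) 0).
      apply: (@mean_bound R (fun s => L a' b' s - L a' b s - L a b' s + L a b s)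
        (fun s => cross_diff (r s) a a' b b')) => s sI.
        have d1 := dl _ _ s Sa' Sb' sI; have d2 := dl _ _ s Sa' Sb sI.
        have d3 := dl _ _ s Sa Sb' sI; have d4 := dl _ _ s Sa Sb sI.
        exact: (is_deriveD (is_deriveB (is_deriveB d1 d2) d3) d4).
      by have [] := K1 s sI.
    ring.
have Cp : 0 < C + 1 by rewrite ltr_wpDl.
(* The mean is the inverse of its inverse, which stays above [(C + 1)^-1]; the summand 1 only keeps
   the denominator positive. *)
rewrite (_ : (fun a b => _) = fun a b => ((logmean (f a) (f b))^-1)^-1); last first.
  by apply/funext => a; apply/funext => b; rewrite invrK.
apply: (@cross_boundedV _ _ _ _ dst0 _ (C + 1)^-1) hinv => [|a b Sa Sb].
  by rewrite invr_gt0.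
have /andP[h1 h2] := logmean_between c00 (fC a Sa) (fC b Sb).
rewrite lef_pV2 ?posrE // ?(lt_le_trans c00) // (le_trans h2) //.
by rewrite lerDl.
Qed.
End Cross.

(** Since [s x + (1 - s) y = x - (1 - s) (x - y)], its inverse is a geometric series in
    [(1 - s) (x - y) / x]. Integration of the truncated series over [s] produces the factors
    [1 / (k + 1)], and the remainder is of order [n]. *)
Lemma inv_logmean_taylor x y c0 n : 0 < c0 -> c0 <= x -> c0 <= y ->
  `|(logmean x y)^-1 - \sum_(k < n) (x - y) ^+ k / (k.+1%:R * x ^+ k.+1)|
    <= `|x - y| ^+ n / c0 ^+ n.+1.
Proof.
move=> c00 cx cy; have x0 := lt_le_trans c00 cx; have y0 := lt_le_trans c00 cy.
pose P s := \sum_(k < n) (x - y) ^+ k / x ^+ k.+1 * ((1 - (1 - s) ^+ k.+1) / k.+1%:R).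
pose P' s := \sum_(k < n) (x - y) ^+ k / x ^+ k.+1 * (1 - s) ^+ k.
have dP s : is_derive s 1 P (P' s).
  have h (k : 'I_n) : is_derive s 1
      (fun s => (x - y) ^+ k / x ^+ k.+1 * ((1 - (1 - s) ^+ k.+1) / k.+1%:R))
      ((x - y) ^+ k / x ^+ k.+1 * (1 - s) ^+ k).
    have h1 := is_deriveX k.+1 (is_derive_affine 1 (-1) s).
    have h2 := is_deriveZ (- ((x - y) ^+ k / x ^+ k.+1 / k.+1%:R)) h1.
    have h3 := is_deriveD (is_derive_cst ((x - y) ^+ k / x ^+ k.+1 / k.+1%:R) s (1 : R)) h2.
    apply: eq_is_derive1 h3 => [t|].
      change ((x - y) ^+ k / x ^+ k.+1 / k.+1%:R + (- ((x - y) ^+ k / x ^+ k.+1 / k.+1%:R))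
        * ((fun t => 1 + -1 * t) ^+ k.+1) t = (x - y) ^+ k / x ^+ k.+1 * ((1 - (1 - t) ^+ k.+1) / k.+1%:R)).
      rewrite exprfctE (_ : 1 + -1 * t = 1 - t); last by ring.
      by move: ((x - y) ^+ k / x ^+ k.+1) ((1 - t) ^+ k.+1) (k.+1%:R : R) => A B D; ring.
    rewrite add0r /GRing.scale /=.
    have -> : 1 + -1 * s = 1 - s by ring.
    have k0 : k.+1%:R != 0 :> R by rewrite pnatr_eq0.
    move: k0.
    by move: ((x - y) ^+ k / x ^+ k.+1) ((1 - s) ^+ k) (k.+1%:R : R) => A B D D0; field.
  have := is_derive_sum h; apply: eq_is_derive1 => // t.
  by rewrite /P fct_sumE.
have E : (logmean x y)^-1 - \sum_(k < n) (x - y) ^+ k / (k.+1%:R * x ^+ k.+1) =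
    (log_interp x y 1 - P 1) - (log_interp x y 0 - P 0).
  rewrite log_interp0 log_interp1 sub0r opprK.
  have -> : P 0 = 0.
    by apply: big1 => k _; rewrite subr0 expr1n subrr mul0r mulr0.
  rewrite addr0; congr (_ - _); apply: eq_bigr => k _.
  by rewrite subrr expr0n /= subr0 mul1r invfM mulrCA mulrC -mulrA.
rewrite E; apply: (@mean_bound _ (fun s => log_interp x y s - P s)
  (fun s => (s * x + (1 - s) * y)^-1 - P' s)) => s sI.
  exact: (is_deriveB (is_derive_log_interp x0 y0 sI) (dP s)).
have p := interp_gt0 x0 y0 sI.
have pc : c0 <= s * x + (1 - s) * y.
  case/andP: sI => s0 s1; have s1' : 0 <= 1 - s by rewrite subr_ge0.
  have := mulr_ge0 s0; have := mulr_ge0 s1'; move=> h2 h.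
  have := h (x - c0); have := h2 (y - c0).
  by rewrite !subr_ge0 => /(_ cy) ? /(_ cx) ?; lra.
have -> : (s * x + (1 - s) * y)^-1 - P' s =
    ((1 - s) * (x - y)) ^+ n * (x ^+ n * (s * x + (1 - s) * y))^-1.
  have geo : x ^+ n - ((1 - s) * (x - y)) ^+ n =
      (s * x + (1 - s) * y) * (x ^+ n * P' s).
    rewrite subrXX; congr (_ * _); first by ring.
    rewrite /P' mulr_sumr; apply: eq_bigr => k _.
    rewrite exprMn; have kn := ltn_ord k.
    have -> : x ^+ n = x ^+ (n.-1 - k) * x ^+ k.+1.
      by rewrite -exprD; congr (_ ^+ _); lia.
    have : x ^+ k.+1 != 0 by rewrite expf_neq0 ?gt_eqF.
    move: (x ^+ k.+1) (x ^+ (n.-1 - k)) ((x - y) ^+ k) ((1 - s) ^+ k) => A B D G A0.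
    by field.
  have xn : x ^+ n != 0 by rewrite expf_neq0 ?gt_eqF.
  have -> : P' s = (x ^+ n - ((1 - s) * (x - y)) ^+ n) / (x ^+ n * (s * x + (1 - s) * y)).
    by rewrite geo; field; rewrite xn gt_eqF.
  by field; rewrite xn gt_eqF.
have x1 : 0 <= 1 - s by case/andP: sI => _; rewrite subr_ge0.
have s1 : 1 - s <= 1 by case/andP: sI => s0 _; rewrite gerBl.
apply: normM_le.
  rewrite normrX lerXn2r ?nnegrE // normrM (ger0_norm x1).
  by rewrite ler_piMl.
rewrite gtr0_norm ?invr_gt0 ?mulr_gt0 ?exprn_gt0 // lef_pV2 ?posrE ?mulr_gt0 ?exprn_gt0 //.
rewrite exprSr ler_pM ?exprn_ge0 ?(ltW c00) // lerXn2r ?nnegrE ?(ltW c00) //.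
exact: ltW.
Qed.
End LogMean.

(** * States *)

Section StateAlgebra.
Variables (R : realType) (d : nat).
Implicit Types (a b x y z : state R d) (c : R).

Lemma rho_mkstate r (q : 'rV[R]_d) E : rho (mkstate r q E) = r.
Proof. by rewrite /rho /mkstate row_mxKl mxE. Qed.

Lemma mom_mkstate r (q : 'rV[R]_d) E : mom (mkstate r q E) = q.
Proof. by rewrite /mom /mkstate row_mxKr row_mxKl. Qed.

Lemma energy_mkstate r (q : 'rV[R]_d) E : energy (mkstate r q E) = E.
Proof. by rewrite /energy /mkstate !row_mxKr mxE. Qed.

Definition state_mkE := (rho_mkstate, mom_mkstate, energy_mkstate).

Lemma state_eq a b : rho a = rho b -> (forall k, mom a ord0 k = mom b ord0 k) ->
  energy a = energy b -> a = b.
Proof.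
rewrite /rho /mom /energy => h1 h2 h3.
rewrite -(hsubmxK a) -(hsubmxK b); congr row_mx.
  by apply/rowP => i; rewrite !ord1.
rewrite -(hsubmxK (rsubmx a)) -(hsubmxK (rsubmx b)); congr row_mx.
  by apply/rowP => i; exact: h2.
by apply/rowP => i; rewrite !ord1.
Qed.

(** Nested options turn the block structure into one finite index type, so that constants found
    component by component can be chosen and summed. *)
Definition state_coord (o : option (option 'I_d)) a : R :=
  match o with
  | None => rho a
  | Some None => energy a
  | Some (Some k) => mom a ord0 k
  end.

Lemma state_coord_is_linear o : linear (state_coord o).
Proof.
move=> c x y; case: o => [[k|]|] /=; rewrite /rho /mom /energy.
all: by rewrite !mxE.
Qed.

HB.instance Definition _ o := @GRing.isLinear.Build R (state R d) R *:%R
  (state_coord o) (state_coord_is_linear o).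

Definition state_index (o : option (option 'I_d)) : 'I_(1 + (d + 1)) :=
  match o with
  | None => lshift (d + 1) ord0
  | Some None => rshift 1 (rshift d ord0)
  | Some (Some k) => rshift 1 (lshift 1 k)
  end.

Lemma state_coordE o a : state_coord o a = a ord0 (state_index o).
Proof. by case: o => [[k|]|]; rewrite /= /rho /mom /energy !mxE. Qed.

Lemma state_index_sur (j : 'I_(1 + (d + 1))) : exists o, j = state_index o.
Proof.
have [i ->|i ->] := split_ordP j; first by exists None; rewrite (ord1 i).
have [k ->|k ->] := split_ordP i; first by exists (Some (Some k)).
by exists (Some None); rewrite (ord1 k).
Qed.

Lemma state_norm_coord o a : `|state_coord o a| <= `|a|.
Proof.
rewrite state_coordE [X in _ <= X]/Num.Def.normr /= mx_normrE.
exact: (@le_bigmax_cond _ _ _ _ (ord0, state_index o) _ (fun i => `|a i.1 i.2|)).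
Qed.

Lemma state_norm_le a c : 0 <= c -> (forall o, `|state_coord o a| <= c) -> `|a| <= c.
Proof.
move=> c0 h; rewrite [X in X <= _]/Num.Def.normr /= mx_normrE.
apply: bigmax_le => // -[i j] _ /=; rewrite (ord1 i).
by have [k ->] := state_index_sur j; rewrite -state_coordE.
Qed.

Definition sdot x y : R :=
  rho x * rho y + \sum_k mom x ord0 k * mom y ord0 k + energy x * energy y.

Lemma sdotE x y : sdot x y = \sum_j x ord0 j * y ord0 j.
Proof.
rewrite /sdot big_split_ord /= big_ord1 -addrA; congr (_ + _).
  by rewrite /rho !mxE.
rewrite big_split_ord /= big_ord1; congr (_ + _); last by rewrite /energy !mxE.
by apply: eq_bigr => k _; rewrite /mom !mxE.
Qed.

Lemma sdotC x y : sdot x y = sdot y x.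
Proof. by rewrite !sdotE; apply: eq_bigr => j _; rewrite mulrC. Qed.

Lemma sdotDr x y z : sdot x (y + z) = sdot x y + sdot x z.
Proof.
by rewrite !sdotE -big_split; apply: eq_bigr => j _; rewrite mxE mulrDr.
Qed.

Lemma sdotZr c x y : sdot x (c *: y) = c * sdot x y.
Proof. by rewrite !sdotE mulr_sumr; apply: eq_bigr => j _; rewrite mxE mulrCA. Qed.

Lemma sdotNr x y : sdot x (- y) = - sdot x y.
Proof. by rewrite -scaleN1r sdotZr mulN1r. Qed.

Lemma sdotBr x y z : sdot x (y - z) = sdot x y - sdot x z.
Proof. by rewrite sdotDr sdotNr. Qed.

Lemma sdotDl x y z : sdot (y + z) x = sdot y x + sdot z x.
Proof. by rewrite sdotC sdotDr !(sdotC x). Qed.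

Lemma sdotNl x y : sdot (- y) x = - sdot y x.
Proof. by rewrite sdotC sdotNr sdotC. Qed.

Lemma sdotBl x y z : sdot (y - z) x = sdot y x - sdot z x.
Proof. by rewrite sdotDl sdotNl. Qed.

Lemma sdot0r x : sdot x 0 = 0.
Proof. by rewrite -(scale0r (0 : state R d)) sdotZr mul0r. Qed.

Lemma sdot_sumr (I : Type) (r : seq I) (P : pred I) x (y : I -> state R d) :
  sdot x (\sum_(i <- r | P i) y i) = \sum_(i <- r | P i) sdot x (y i).
Proof.
elim: r => [|i r IH]; first by rewrite !big_nil sdot0r.
by rewrite !big_cons; case: ifP => _ //; rewrite sdotDr IH.
Qed.

(** The factor lost in passing between the sup norm, in which the estimates are made, and Euclidean
    quantities. *)
Definition sdim : R := (1 + (d + 1))%:R.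

Lemma sdim_gt0 : 0 < sdim.
Proof. by rewrite ltr0n. Qed.

Lemma sdot_norm x y : `|sdot x y| <= sdim * (`|x| * `|y|).
Proof.
rewrite sdotE (le_trans (ler_norm_sum _ _ _)) // /sdim mulr_natl.
have -> : (`|x| * `|y|) *+ (1 + (d + 1)) = \sum_(j < 1 + (d + 1)) `|x| * `|y|.
  by rewrite sumr_const card_ord.
apply: ler_sum => j _; apply: normM_le; have [k ->] := state_index_sur j.
  by rewrite -state_coordE state_norm_coord.
by rewrite -state_coordE state_norm_coord.
Qed.

Lemma enorm_sqr n (v : 'rV[R]_n) : enorm v ^+ 2 = \sum_i v ord0 i ^+ 2.
Proof. by rewrite /enorm sqr_sqrtr // sumr_ge0 // => i _; exact: sqr_ge0. Qed.

Lemma enorm_ge0 n (v : 'rV[R]_n) : 0 <= enorm v.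
Proof. exact: sqrtr_ge0. Qed.

Lemma state_enorm_sdot x : enorm x ^+ 2 = sdot x x.
Proof. by rewrite enorm_sqr sdotE; apply: eq_bigr => j _; rewrite expr2. Qed.

Lemma norm_le_enorm x : `|x| <= enorm x.
Proof.
apply: state_norm_le => [|o]; first exact: enorm_ge0.
rewrite state_coordE /enorm -sqrtr_sqr ler_sqrt; last first.
  by apply: sumr_ge0 => i _; exact: sqr_ge0.
by rewrite (bigD1 (state_index o)) //= lerDl sumr_ge0 // => i _; exact: sqr_ge0.
Qed.

Lemma enorm_le_norm x : enorm x ^+ 2 <= sdim * `|x| ^+ 2.
Proof.
rewrite state_enorm_sdot (le_trans (ler_norm _)) // (le_trans (sdot_norm _ _)) //.
Qed.
End StateAlgebra.

(** * Entropy conservation of the two-point flux *)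

Section EulerAlgebra.
Variables (R : realType) (d : nat) (gamma : R).
Hypothesis hg : 1 < gamma.
Implicit Types (a b x y : state R d).

Let g1 : gamma - 1 != 0.
Proof. by rewrite subr_eq0 gt_eqF. Qed.
Let g0 : 0 < gamma - 1.
Proof. by rewrite subr_gt0. Qed.

(** The inverse temperature up to a constant factor. The entropy variables are polynomial in [beta],
    the velocity and the logarithms of [beta] and [rho]. *)
Definition beta a : R := rho a / pressure gamma a.
Definition velc a k : R := vel a ord0 k.

Lemma velcE a k : velc a k = mom a ord0 k / rho a.
Proof. by rewrite /velc /vel mxE mulrC. Qed.

Lemma momE a k : rho a != 0 -> mom a ord0 k = rho a * velc a k.
Proof. by move=> h; rewrite velcE mulrC divfK. Qed.

Lemma pressureE a :
  pressure gamma a = (gamma - 1) * (energy a - rho a * (\sum_k velc a k ^+ 2) / 2).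
Proof. by rewrite /pressure enorm_sqr. Qed.

Lemma energyE a : energy a =
  pressure gamma a / (gamma - 1) + rho a * (\sum_k velc a k ^+ 2) / 2.
Proof. by rewrite pressureE; field. Qed.

Lemma pressure_beta a : 0 < rho a -> 0 < pressure gamma a ->
  pressure gamma a = rho a / beta a.
Proof. by move=> r0 P0; rewrite /beta invf_div mulrCA divff ?mulr1 ?gt_eqF. Qed.

Lemma beta_gt0 a : admissible gamma a -> 0 < beta a.
Proof. by move=> [r0 P0]; rewrite divr_gt0. Qed.

(** The closed form of the entropy variables [w = U']; [is_derive_entropy] identifies it as the
    gradient of [entropy] at admissible states. *)
Definition evar a : state R d :=
  mkstate (gamma / (gamma - 1) + ln (beta a) / (gamma - 1) + ln (rho a)
             - beta a * (\sum_k velc a k ^+ 2) / 2)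
          (\row_k (beta a * velc a k)) (- beta a).

Lemma entropyE a : admissible gamma a ->
  entropy gamma a = rho a * ln (beta a) / (gamma - 1) + rho a * ln (rho a).
Proof.
move=> [r0 P0]; rewrite /entropy /varsigma lnM ?posrE ?powR_gt0 // ln_powR.
rewrite /beta lnM ?posrE ?invr_gt0 // lnV ?posrE //.
by field.
Qed.

Lemma sum_delta (f : 'I_d -> R) m : \sum_k f k * (k == m)%:R = f m.
Proof.
rewrite (bigD1 m) //= eqxx mulr1 big1 ?addr0 // => k /negbTE ->.
by rewrite mulr0.
Qed.

Definition frho m a b := logmean (rho a) (rho b) * avg (velc a m) (velc b m).

Lemma rho_fnum m a b : rho (fnum gamma m a b) = frho m a b.
Proof. by rewrite /fnum state_mkE. Qed.

Lemma mom_fnum m a b k : mom (fnum gamma m a b) ord0 k =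
  avg (velc a k) (velc b k) * frho m a b
  + (k == m)%:R * avg (pressure gamma a) (pressure gamma b).
Proof. by rewrite /fnum state_mkE mxE. Qed.

Lemma energy_fnum m a b : energy (fnum gamma m a b) =
  2^-1 * (\sum_k velc a k * velc b k) * frho m a b
  + ((gamma - 1) * logmean (beta a) (beta b))^-1 * frho m a b
  + prodmean (pressure gamma a) (velc a m) (pressure gamma b) (velc b m).
Proof.
rewrite /fnum state_mkE; congr (_ * _ * _ + _ + _).
by apply: eq_bigr => k _; rewrite /prodmean /velc; field.
Qed.

Lemma sdot_evar c x : sdot (evar c) x =
  (gamma / (gamma - 1) + ln (beta c) / (gamma - 1) + ln (rho c)
    - beta c * (\sum_k velc c k ^+ 2) / 2) * rho x
  + beta c * (\sum_k velc c k * mom x ord0 k) - beta c * energy x.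
Proof.
rewrite /sdot /evar !state_mkE mulNr; congr (_ + _ - _).
by rewrite mulr_sumr; apply: eq_bigr => k _; rewrite mxE mulrA.
Qed.

Lemma sum_velc_mom_fnum c m a b : \sum_k velc c k * mom (fnum gamma m a b) ord0 k =
  (\sum_k velc c k * velc a k + \sum_k velc c k * velc b k) / 2 * frho m a b
  + velc c m * avg (pressure gamma a) (pressure gamma b).
Proof.
rewrite -(sum_delta (velc c)) !mulr_suml -!big_split /= mulr_suml mulr_suml -big_split /=.
by apply: eq_bigr => k _; rewrite mom_fnum /avg; field.
Qed.

Lemma logmean_gt0 (x y : R) : 0 < x -> 0 < y -> 0 < logmean x y.
Proof.
move=> x0 y0.
have := @logmean_between R x y (Num.min x y) (Num.max x y).
rewrite lt_min x0 y0 !ge_min !le_max !lexx !orbT /= => /(_ isT isT isT) /andP[h _].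
by case/orP: h; exact: lt_le_trans.
Qed.

Lemma entropy_conservative m a b : admissible gamma a -> admissible gamma b ->
  sdot (evar a - evar b) (fnum gamma m a b) =
  rho a * velc a m - rho b * velc b m.
Proof.
move=> ha hb; have ba := beta_gt0 ha; have bb := beta_gt0 hb.
case: ha hb => [ra Pa] [rb Pb].
have Lr := logmean_mul_ln ra rb; have Lb := logmean_mul_ln ba bb.
have rl0 := logmean_gt0 ra rb; have bl0 := logmean_gt0 ba bb.
rewrite sdotBl !sdot_evar !sum_velc_mom_fnum rho_fnum energy_fnum.
rewrite (pressure_beta ra Pa) (pressure_beta rb Pb).
have -> : \sum_k velc b k * velc a k = \sum_k velc a k * velc b k.
  by apply: eq_bigr => k _; rewrite mulrC.
have sqE c : \sum_k velc c k ^+ 2 = \sum_k velc c k * velc c k.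
  by apply: eq_bigr => k _; rewrite expr2.
rewrite !sqE /frho.
set rl := logmean (rho a) (rho b) in Lr rl0 *.
set bl := logmean (beta a) (beta b) in Lb bl0 *.
(* Once the logarithms at [a] are expressed through those at [b] and the means, the claim is an
   identity of rational functions. *)
have E1 : ln (rho a) = ln (rho b) + (rho a - rho b) / rl.
  by rewrite -Lr mulrC mulKf ?gt_eqF // addrC subrK.
have E2 : ln (beta a) = ln (beta b) + (beta a - beta b) / bl.
  by rewrite -Lb mulrC mulKf ?gt_eqF // addrC subrK.
rewrite E1 E2 /prodmean /avg.
have ba0 : beta a != 0 by rewrite gt_eqF.
have bb0 : beta b != 0 by rewrite gt_eqF.
have {}rl0 : rl != 0 by rewrite gt_eqF.
have {}bl0 : bl != 0 by rewrite gt_eqF.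
by field; rewrite ?ba0 ?bb0 ?rl0 ?bl0 ?g1.
Qed.

Lemma avgC (x y : R) : avg x y = avg y x.
Proof. by rewrite /avg addrC. Qed.

Lemma frhoC m a b : frho m a b = frho m b a.
Proof. by rewrite /frho logmeanC avgC. Qed.

Lemma fnumC m a b : fnum gamma m a b = fnum gamma m b a.
Proof.
apply: state_eq => [|k|].
- by rewrite !rho_fnum frhoC.
- by rewrite !mom_fnum frhoC avgC [avg (pressure _ _) _]avgC.
- rewrite !energy_fnum frhoC logmeanC /prodmean [X in X / 2]addrC.
  by congr (_ * _ * _ + _ + _); apply: eq_bigr => k _; rewrite mulrC.
Qed.

Lemma fnum_diag m a : admissible gamma a -> fnum gamma m a a = euler_flux gamma m a.
Proof.
move=> [r0 P0]; have r0' : rho a != 0 by rewrite gt_eqF.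
have avgxx (x : R) : avg x x = x by rewrite /avg; field.
apply: state_eq => [|k|]; rewrite /euler_flux state_mkE.
- by rewrite rho_fnum /frho logmeanxx avgxx momE.
- have -> : (vel a ord0 m *: mom a + pressure gamma a *: evec m) ord0 k =
      velc a m * mom a ord0 k + pressure gamma a * (k == m)%:R.
    by rewrite mxE [in X in X + _]mxE [in X in _ + X]mxE [evec m ord0 k]mxE.
  by rewrite mom_fnum /frho logmeanxx !avgxx (momE _ r0'); ring.
- rewrite energy_fnum /frho !logmeanxx avgxx energyE /prodmean -/(velc a m) /beta.
  have -> : \sum_k velc a k * velc a k = \sum_k velc a k ^+ 2.
    by apply: eq_bigr => k _; rewrite expr2.
  by field; rewrite r0' g1 gt_eqF.
Qed.
End EulerAlgebra.

(** * Relative entropy *)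

Section RelativeEntropy.
Variables (R : realType) (d : nat) (gamma : R).
Hypothesis hg : 1 < gamma.
Implicit Types (a b x y : state R d).

Local Notation beta := (beta gamma).
Local Notation evar := (evar gamma).

Let g1 : gamma - 1 != 0.
Proof. by rewrite subr_eq0 gt_eqF. Qed.
Let g0 : 0 < gamma - 1.
Proof. by rewrite subr_gt0. Qed.

(** Agrees with [entropy] on admissible states by [entropyE], and has only the logarithms that occur
    in [evar]. *)
Definition phys_entropy a : R :=
  rho a * ln (beta a) / (gamma - 1) + rho a * ln (rho a).

Definition rel_entropy a b : R :=
  phys_entropy a - phys_entropy b - sdot (evar b) (a - b).

(** After expansion by [vdot_lin], the sums over velocity components are atoms for [field]. *)
Definition vdot (f g : 'I_d -> R) : R := \sum_k f k * g k.

Lemma vdotC f g : vdot f g = vdot g f.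
Proof. by apply: eq_bigr => k _; rewrite mulrC. Qed.

Lemma vdotDl f f' g : vdot (fun k => f k + f' k) g = vdot f g + vdot f' g.
Proof. by rewrite /vdot -big_split; apply: eq_bigr => k _; rewrite mulrDl. Qed.

Lemma vdotDr f f' g : vdot g (fun k => f k + f' k) = vdot g f + vdot g f'.
Proof. by rewrite vdotC vdotDl !(vdotC g). Qed.

Lemma vdotZl c f g : vdot (fun k => c * f k) g = c * vdot f g.
Proof. by rewrite /vdot mulr_sumr; apply: eq_bigr => k _; rewrite mulrA. Qed.

Lemma vdotZr c f g : vdot g (fun k => c * f k) = c * vdot g f.
Proof. by rewrite vdotC vdotZl vdotC. Qed.

Lemma vdotNl f g : vdot (fun k => - f k) g = - vdot f g.
Proof. by rewrite /vdot -sumrN; apply: eq_bigr => k _; rewrite mulNr. Qed.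

Lemma vdotNr f g : vdot g (fun k => - f k) = - vdot g f.
Proof. by rewrite vdotC vdotNl vdotC. Qed.

Definition vdot_lin := (vdotDl, vdotDr, vdotZl, vdotZr, vdotNl, vdotNr).

Lemma sdot_evarE c x : sdot (evar c) x =
  (gamma / (gamma - 1) + ln (beta c) / (gamma - 1) + ln (rho c)
    - beta c * vdot (velc c) (velc c) / 2) * rho x
  + beta c * vdot (velc c) (fun k => mom x ord0 k) - beta c * energy x.
Proof.
rewrite sdot_evar; congr (_ * _ + _ - _); congr (_ - _ * _ / _).
Qed.

Lemma energy_beta a : admissible gamma a ->
  energy a = rho a / beta a / (gamma - 1) + rho a * vdot (velc a) (velc a) / 2.
Proof.
move=> [r0 P0]; rewrite (energyE hg) (pressure_beta r0 P0).
by congr (_ + _ * _ / _); apply: eq_bigr => k _; rewrite expr2.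
Qed.

Lemma mom_fun a : rho a != 0 -> (fun k => mom a ord0 k) = (fun k => rho a * velc a k).
Proof. by move=> h; apply/funext => k; exact: momE. Qed.

(** The primitive variables separate. With [z - 1 - ln z] nonnegative and quadratic near [z = 1],
    both the upper and the lower bound on the relative entropy can be read off. *)
Lemma rel_entropyE a b : admissible gamma a -> admissible gamma b ->
  rel_entropy a b =
    rho a * beta b * vdot (fun k => velc a k - velc b k) (fun k => velc a k - velc b k) / 2
    + rho a / (gamma - 1) * (beta b / beta a - 1 - ln (beta b / beta a))
    + rho a * (rho b / rho a - 1 - ln (rho b / rho a)).
Proof.
move=> ha hb; have ba := beta_gt0 ha; have bb := beta_gt0 hb.
have [ra Pa] := ha; have [rb Pb] := hb.
have ra0 : rho a != 0 by rewrite gt_eqF.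
have rb0 : rho b != 0 by rewrite gt_eqF.
have ba0 : beta a != 0 by rewrite gt_eqF.
have bb0 : beta b != 0 by rewrite gt_eqF.
rewrite /rel_entropy sdotBr !sdot_evarE !mom_fun // !energy_beta // /phys_entropy.
rewrite !vdot_lin (vdotC (velc b) (velc a)) !ln_div ?posrE //.
by field; rewrite ?ra0 ?rb0 ?ba0 ?bb0 ?g1.
Qed.

(** This and the next two are the derivatives at [b] in the direction [x] of velocity, pressure and
    [beta], justified by the [is_time_derive] lemmas below. *)
Definition dvel b x k : R := (mom x ord0 k - rho x * velc b k) / rho b.

Definition dpress b x : R := (gamma - 1) *
  (energy x - vdot (velc b) (fun k => mom x ord0 k)
   + rho x * vdot (velc b) (velc b) / 2).

Definition dbeta b x : R :=
  rho x / pressure gamma b - rho b * dpress b x / pressure gamma b ^+ 2.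

(* The derivative of the entropy variables at [b] in the direction [x]. *)
Definition devar b x : state R d :=
  mkstate (dbeta b x / (beta b * (gamma - 1)) + rho x / rho b
             - dbeta b x * vdot (velc b) (velc b) / 2
             - beta b * vdot (velc b) (dvel b x))
          (\row_k (dbeta b x * velc b k + beta b * dvel b x k)) (- dbeta b x).

Lemma mom_dvel b x : admissible gamma b ->
  (fun k => mom x ord0 k) = (fun k => rho b * dvel b x k + rho x * velc b k).
Proof.
by move=> [r0 _]; apply/funext => k; rewrite /dvel; field; rewrite gt_eqF.
Qed.

(** With [mom_dvel], this rewrites a direction [x] in terms of [rho x], [dvel b x] and [dbeta b x],
    the coordinates in which the expansions below simplify. *)
Lemma energy_dbeta b x : admissible gamma b ->
  energy x = (rho x / beta b - rho b * dbeta b x / beta b ^+ 2) / (gamma - 1)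
    + rho x * vdot (velc b) (velc b) / 2 + rho b * vdot (velc b) (dvel b x).
Proof.
move=> hb; have [r0 P0] := hb.
rewrite /dbeta /dpress (mom_dvel x hb) !vdot_lin /beta.
by field; rewrite ?g1 ?gt_eqF.
Qed.

Lemma sdot_devar b x y : admissible gamma b -> sdot (devar b x) y =
  (dbeta b x / (beta b * (gamma - 1)) + rho x / rho b
     - dbeta b x * vdot (velc b) (velc b) / 2
     - beta b * vdot (velc b) (dvel b x)) * rho y
  + dbeta b x * vdot (velc b) (fun k => mom y ord0 k)
  + beta b * vdot (dvel b x) (fun k => mom y ord0 k) - dbeta b x * energy y.
Proof.
move=> hb; rewrite /sdot /devar !state_mkE mulNr -!addrA; congr (_ + _).
rewrite !addrA; congr (_ - _); rewrite /vdot !mulr_sumr -big_split /=.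
by apply: eq_bigr => k _; rewrite mxE; ring.
Qed.

(** The Taylor remainder of the entropy variables at [b], paired with [x]; symmetry of the Hessian
    places [x] inside [devar] and [a - b] outside. The right-hand side is arranged so that each term
    visibly vanishes to second order as [a] tends to [b]. *)
Lemma evar_expansion a b x : admissible gamma a -> admissible gamma b ->
  sdot (evar a - evar b) x - sdot (devar b x) (a - b) =
    rho x * ((beta a / beta b - 1 - ln (beta a / beta b)) * - (gamma - 1)^-1
             - (rho a / rho b - 1 - ln (rho a / rho b))
             - beta a * vdot (fun k => velc a k - velc b k) (fun k => velc a k - velc b k) / 2)
    + (rho b * (beta a - beta b) - (rho a - rho b) * beta b)
      * vdot (dvel b x) (fun k => velc a k - velc b k)
    + dbeta b x * ((beta a - beta b) * (rho b * (beta a - beta b) - (rho a - rho b) * beta b)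
                     * ((beta b ^+ 2)^-1 * (beta a)^-1 * (gamma - 1)^-1)
             + rho a * vdot (fun k => velc a k - velc b k) (fun k => velc a k - velc b k) / 2).
Proof.
move=> ha hb; have ba := beta_gt0 ha; have bb := beta_gt0 hb.
have [ra Pa] := ha; have [rb Pb] := hb.
have ra0 : rho a != 0 by rewrite gt_eqF.
have rb0 : rho b != 0 by rewrite gt_eqF.
have ba0 : beta a != 0 by rewrite gt_eqF.
have bb0 : beta b != 0 by rewrite gt_eqF.
rewrite sdotBl !sdot_evarE sdotBr !sdot_devar //.
rewrite (energy_dbeta x hb) (mom_dvel x hb) !(mom_fun ra0) !(mom_fun rb0).
rewrite !energy_beta // !vdot_lin (vdotC (velc b) (velc a)).
rewrite (vdotC (dvel b x) (velc a)) (vdotC (dvel b x) (velc b)) !ln_div ?posrE //.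
by field; rewrite ?ra0 ?rb0 ?ba0 ?bb0 ?g1.
Qed.

(** Both bounds are [ln z <= z - 1], applied to [z] and to [z^-1]. *)
Lemma sub1_ln_bounds (z : R) : 0 < z ->
  0 <= z - 1 - ln z <= (z - 1) ^+ 2 / z.
Proof.
move=> z0; apply/andP; split.
  have := @le_ln1Dx R (z - 1); rewrite (_ : 1 + (z - 1) = z); last by ring.
  by rewrite ltrBrDl subrr => /(_ z0); lra.
have zi : 0 < z^-1 by rewrite invr_gt0.
have := @le_ln1Dx R (z^-1 - 1); rewrite (_ : 1 + (z^-1 - 1) = z^-1); last by ring.
rewrite ltrBrDl subrr lnV ?posrE // => /(_ zi) h.
have -> : (z - 1) ^+ 2 / z = z - 2 + z^-1 by field; rewrite gt_eqF.
lra.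
Qed.

(* [ln z = 2 ln (sqrt z) <= 2 (sqrt z - 1)] *)
Lemma sub1_ln_lower (z Z : R) : 0 < z -> z <= Z ->
  (z - 1) ^+ 2 <= (Num.sqrt Z + 1) ^+ 2 * (z - 1 - ln z).
Proof.
move=> z0 zZ; pose q := Num.sqrt z.
have q0 : 0 < q by rewrite sqrtr_gt0.
have zE : z = q ^+ 2 by rewrite sqr_sqrtr // ltW.
have h : ln q <= q - 1.
  have := @le_ln1Dx R (q - 1); rewrite (_ : 1 + (q - 1) = q); last by ring.
  by rewrite ltrBrDl subrr => /(_ q0).
have lnz : ln z = 2 * ln q.
  by rewrite zE expr2 lnM ?posrE //; ring.
have h2 : (q - 1) ^+ 2 <= z - 1 - ln z by rewrite lnz zE; lra.
have -> : (z - 1) ^+ 2 = (q + 1) ^+ 2 * (q - 1) ^+ 2 by rewrite zE; ring.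
apply: ler_pM => //; rewrite ?sqr_ge0 // lerXn2r ?nnegrE ?addr_ge0 ?sqrtr_ge0 ?(ltW q0) //.
by rewrite lerD2r ler_wsqrtr.
Qed.

(** * Time derivatives of entropy, entropy variables and relative entropy along a path *)

Section TimeDer.
Variable T : R.
Hypothesis T0 : 0 < T.

Lemma state_coord_continuous (o : option (option 'I_d)) :
  continuous (state_coord o : state R d -> R).
Proof.
have -> : (state_coord o : state R d -> R) = fun a => a ord0 (state_index o).
  by apply/funext => a; rewrite state_coordE.
exact: coord_continuous.
Qed.

Lemma state_coord_time_quot (o : option (option 'I_d)) (f : R -> state R d) t s :
  state_coord o (time_quot f t s) = time_quot (fun s => state_coord o (f s)) t s.
Proof. by rewrite /time_quot linearZ /= linearB. Qed.

Lemma is_time_derive_coord (o : option (option 'I_d)) (f : R -> state R d) t l :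
  is_time_derive T f t l ->
  is_time_derive T (fun s => state_coord o (f s)) t (state_coord o l).
Proof.
rewrite /is_time_derive => h.
have h2 := cvg_comp _ _ h (@state_coord_continuous o l).
refine (cvg_trans _ h2); apply: near_eq_cvg; apply: nearW => s.
exact: state_coord_time_quot.
Qed.

Lemma is_time_derive_state (f : R -> state R d) t l :
  (forall o, is_time_derive T (fun s => state_coord o (f s)) t (state_coord o l)) ->
  is_time_derive T f t l.
Proof.
move=> h; rewrite /is_time_derive; apply/cvgrPdist_le => e e0.
have {}h o : \forall s \near within `[0, T] t^',
    `|state_coord o l - state_coord o (time_quot f t s)| <= e.
  move/cvgrPdist_le : (h o) => /(_ e e0); apply: filterS => s.
  by rewrite state_coord_time_quot.
have : \forall s \near within `[0, T] t^', forall o,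
    `|state_coord o l - state_coord o (time_quot f t s)| <= e.
  exact: filter_forall.
apply: filterS => s hs; apply: state_norm_le => [|o]; first exact: ltW.
by rewrite linearB; exact: hs.
Qed.

Section Along.
Variables (f : R -> state R d) (t : R) (l : state R d).
Hypothesis df : is_time_derive T f t l.
Hypothesis ft : admissible gamma (f t).

Let r0 : rho (f t) != 0. Proof. by case: ft => h _; rewrite gt_eqF. Qed.
Let p0 : pressure gamma (f t) != 0. Proof. by case: ft => _ h; rewrite gt_eqF. Qed.

Let dcoord o := @is_time_derive_coord o f t l df.
Let drho := @dcoord None.

Lemma is_time_derive_velc k :
  is_time_derive T (fun s => velc (f s) k) t (dvel (f t) l k).
Proof.
under eq_fun do rewrite velcE.
have h := is_time_deriveM (@dcoord (Some (Some k)))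
  (@is_time_derive_inv R T (fun s => rho (f s)) t _ r0 drho).
rewrite (_ : dvel _ _ _ = rho l * 0 + dvel (f t) l k); last by ring.
move: h; congr is_time_derive; rewrite /dvel velcE /=.
by field.
Qed.

Lemma is_time_derive_vdot (g h : R -> 'I_d -> R) (g' h' : 'I_d -> R) :
  (forall k, is_time_derive T (g^~ k) t (g' k)) ->
  (forall k, is_time_derive T (h^~ k) t (h' k)) ->
  is_time_derive T (fun s => vdot (g s) (h s)) t (vdot g' (h t) + vdot (g t) h').
Proof.
move=> dg dh; rewrite /vdot -big_split /=; apply: is_time_derive_sum => k.
exact: is_time_deriveM.
Qed.

Lemma is_time_derive_pressure :
  is_time_derive T (fun s => pressure gamma (f s)) t (dpress (f t) l).
Proof.
have E s : pressure gamma (f s) =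
    (gamma - 1) * (energy (f s) - rho (f s) * vdot (velc (f s)) (velc (f s)) * 2^-1).
  by rewrite pressureE; congr (_ * (_ - _ * _ / _)).
under eq_fun do rewrite E.
have dv := is_time_derive_vdot is_time_derive_velc is_time_derive_velc.
have h1 := is_time_deriveM (is_time_deriveM drho dv) (is_time_derive_cst T (2^-1 : R) t).
have h2 := is_time_deriveM (is_time_derive_cst T (gamma - 1) t)
  (is_time_deriveB (@dcoord (Some None)) h1).
move: h2; congr is_time_derive; rewrite /dpress (mom_dvel l ft) !vdot_lin /=.
by rewrite (vdotC (dvel _ _)); field.
Qed.

Lemma is_time_derive_beta :
  is_time_derive T (fun s => beta (f s)) t (dbeta (f t) l).
Proof.
have h := is_time_deriveM drho (@is_time_derive_inv R T (fun s => pressure gamma (f s)) t _ p0 is_time_derive_pressure).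
by move: h; congr is_time_derive; rewrite /dbeta /=; ring.
Qed.

Let b0 : 0 < beta (f t). Proof. exact: beta_gt0. Qed.

Lemma is_time_derive_entropy :
  is_time_derive T (fun s => phys_entropy (f s)) t (sdot (evar (f t)) l).
Proof.
have [rp pp] := ft.
have h1 := is_time_deriveM (is_time_deriveM drho
  (@is_time_derive_ln R T (fun s => beta (f s)) t _ b0 is_time_derive_beta))
  (is_time_derive_cst T ((gamma - 1)^-1) t).
have h2 := is_time_deriveM drho (@is_time_derive_ln R T (fun s => rho (f s)) t _ rp drho).
have h3 := is_time_deriveD h1 h2.
move: h3; congr is_time_derive; rewrite sdot_evarE /= (energy_dbeta l ft) (mom_dvel l ft).
by rewrite !vdot_lin; field; rewrite ?g1 ?r0 ?(gt_eqF b0).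
Qed.

Lemma is_time_derive_evar :
  is_time_derive T (fun s => evar (f s)) t (devar (f t) l).
Proof.
have [rp pp] := ft.
have dv := is_time_derive_vdot is_time_derive_velc is_time_derive_velc.
refine (is_time_derive_state (fun o => _)); case: o => [[k|]|] /=.
- under eq_fun do rewrite /evar state_mkE mxE.
  rewrite /devar state_mkE mxE.
  exact: (is_time_deriveM is_time_derive_beta (@is_time_derive_velc k)).
- under eq_fun do rewrite /evar state_mkE.
  by rewrite /devar state_mkE; apply: is_time_deriveN; exact: is_time_derive_beta.
- have E s : rho (evar (f s)) = gamma / (gamma - 1) + ln (beta (f s)) * (gamma - 1)^-1
      + ln (rho (f s)) - beta (f s) * vdot (velc (f s)) (velc (f s)) * 2^-1.
    by rewrite /evar state_mkE; congr (_ - _ * _ / _).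
  under eq_fun do rewrite E.
  have h1 := is_time_deriveM (@is_time_derive_ln R T (fun s => beta (f s)) t _ b0 is_time_derive_beta)
    (is_time_derive_cst T ((gamma - 1)^-1) t).
  have h2 := is_time_deriveM (is_time_deriveM is_time_derive_beta dv)
    (is_time_derive_cst T (2^-1 : R) t).
  have h3 := is_time_deriveB (is_time_deriveD (is_time_deriveD
    (is_time_derive_cst T (gamma / (gamma - 1)) t) h1) (@is_time_derive_ln R T (fun s => rho (f s)) t _ rp drho)) h2.
  move: h3; congr is_time_derive; rewrite /devar state_mkE /= (vdotC (dvel _ _)).
  by field; rewrite ?g1 ?r0 ?(gt_eqF b0).
Qed.
End Along.

Lemma is_time_derive_sdot (f g : R -> state R d) t f' g' :
  is_time_derive T f t f' -> is_time_derive T g t g' ->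
  is_time_derive T (fun s => sdot (f s) (g s)) t (sdot f' (g t) + sdot (f t) g').
Proof.
move=> df dg.
have m o := is_time_deriveM (@is_time_derive_coord o f t f' df) (@is_time_derive_coord o g t g' dg).
have h := is_time_deriveD (is_time_deriveD (m None)
  (@is_time_derive_sum R T R 'I_d (index_enum 'I_d) _ t _ (fun k => m (Some (Some k))))) (m (Some None)).
move: h; congr is_time_derive; rewrite /sdot /= big_split /=; ring.
Qed.

(** The two occurrences of [sdot (evar (g t)) g'] cancel. For [f' = g'] what remains is the
    left-hand side of [evar_expansion], which is quadratic in [f t - g t]. *)
Lemma is_time_derive_rel_entropy (f g : R -> state R d) t f' g' :
  is_time_derive T f t f' -> is_time_derive T g t g' ->
  admissible gamma (f t) -> admissible gamma (g t) ->
  is_time_derive T (fun s => rel_entropy (f s) (g s)) t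
    (sdot (evar (f t) - evar (g t)) f' - sdot (devar (g t) g') (f t - g t)).
Proof.
move=> df dg af ag.
have h := is_time_deriveB (is_time_deriveB (is_time_derive_entropy df af)
  (is_time_derive_entropy dg ag))
  (is_time_derive_sdot (is_time_derive_evar dg ag) (is_time_deriveB df dg)).
by move: h; congr is_time_derive; rewrite sdotBl !sdotBr; ring.
Qed.
End TimeDer.
End RelativeEntropy.

(** * Bounds on the states with given lower and upper bounds *)

Section StateBounds.
Variables (R : realType) (d : nat) (gamma : R).
Hypothesis hg : 1 < gamma.
Variables (r0 P0 B : R).
Hypotheses (r00 : 0 < r0) (P00 : 0 < P0).
Implicit Types (a b x y : state R d).

Local Notation beta := (beta gamma).
Local Notation evar := (evar gamma).

Let g0 : 0 < gamma - 1.
Proof. by rewrite subr_gt0. Qed.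

(** Takes the role of the compact set [K] in the estimates: lower bounds on density and pressure
    together with a norm bound give explicit Lipschitz and cross bounds. *)
Definition good_states : set (state R d) :=
  [set a | [/\ r0 <= rho a, P0 <= pressure gamma a & `|a| <= B]].

Local Notation S := good_states.
Definition state_dist a b : R := `|a - b|.
Local Notation dst := state_dist.

Lemma state_dist_ge0 a b : 0 <= dst a b. Proof. exact: normr_ge0. Qed.
Local Notation dst0 := state_dist_ge0.

Lemma good_admissible a : S a -> admissible gamma a.
Proof. by move=> [h1 h2 _]; split; [exact: lt_le_trans h1|exact: lt_le_trans h2]. Qed.

Lemma lip_coord o : lip_bounded S dst (state_coord o).
Proof.
exists (`|B| + 1); first by rewrite addr_ge0.
move=> a b [_ _ aB] _; split.
  rewrite (le_trans (state_norm_coord _ _)) // (le_trans aB) //.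
  by rewrite (le_trans (ler_norm B)) // lerDl.
rewrite -linearB (le_trans (state_norm_coord _ _)) // ler_peMl //.
by rewrite lerDr.
Qed.

Lemma lip_cst c : lip_bounded S dst (fun=> c). Proof. exact: (lip_bounded_cst S dst0). Qed.

Lemma lip_rho : lip_bounded S dst (@rho R d). Proof. exact: (lip_coord None). Qed.

Lemma rho_ge a : S a -> r0 <= rho a. Proof. by case. Qed.

Lemma lip_velc k : lip_bounded S dst (fun a => velc a k).
Proof.
under eq_fun do rewrite velcE.
apply: lip_boundedM; first exact: (lip_coord (Some (Some k))).
exact: (lip_boundedV dst0 r00 rho_ge lip_rho).
Qed.

Lemma lip_vdot (f g : 'I_d -> state R d -> R) (A : set (state R d)) dist :
  (forall a b : state R d, 0 <= dist a b) ->
  (forall k, lip_bounded A dist (f k)) -> (forall k, lip_bounded A dist (g k)) ->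
  lip_bounded A dist (fun a => vdot (f^~ a) (g^~ a)).
Proof.
by move=> h0 hf hg'; apply: lip_bounded_sum => // k; apply: lip_boundedM.
Qed.

Lemma pressure_vdot a : pressure gamma a =
  (gamma - 1) * (energy a - rho a * vdot (velc a) (velc a) * 2^-1).
Proof. by rewrite pressureE; congr (_ * (_ - _ * _ / _)). Qed.

Lemma lip_pressure : lip_bounded S dst (pressure gamma).
Proof.
apply: (@eq_lip_bounded _ _ _ _ (fun a =>
  (gamma - 1) * (energy a - rho a * vdot (velc a) (velc a) * 2^-1))) => [a _|].
  by rewrite pressure_vdot.
have lv : lip_bounded S dst (fun a => vdot (velc a) (velc a)).
  exact: (@lip_vdot (fun k a => velc a k) (fun k a => velc a k) S dst dst0 lip_velc lip_velc).
exact: (lip_boundedM (lip_cst _) (lip_boundedB (lip_coord (Some None))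
  (lip_boundedM (lip_boundedM lip_rho lv) (lip_cst _)))).
Qed.

Lemma lip_beta : lip_bounded S dst beta.
Proof.
apply: lip_boundedM; first exact: lip_rho.
by apply: (lip_boundedV dst0 P00); [move=> a []|exact: lip_pressure].
Qed.

Lemma beta_ge : exists2 b0, 0 < b0 & forall a, S a -> b0 <= beta a.
Proof.
have [C C0 hC] := lip_pressure.
exists (r0 / (C + 1)); first by rewrite divr_gt0 // ltr_wpDl.
move=> a Sa; have [h1 h2 _] := Sa; have [hp _] := hC a a Sa Sa.
have p0 := lt_le_trans P00 h2.
apply: ler_pM => //; first exact: ltW.
  by rewrite invr_ge0 addr_ge0.
rewrite lef_pV2 ?posrE // ?ltr_wpDl //.
by rewrite (le_trans (ler_norm _)) // (le_trans hp) // lerDl.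
Qed.

Lemma lip_lnbeta : lip_bounded S dst (fun a => ln (beta a)).
Proof. by have [b0 b00 hb] := beta_ge; apply: (lip_bounded_ln dst0 b00 hb); exact: lip_beta. Qed.

Lemma lip_lnrho : lip_bounded S dst (fun a => ln (rho a)).
Proof. by apply: (lip_bounded_ln dst0 r00 rho_ge); exact: lip_rho. Qed.

Lemma rho_evar a : rho (evar a) = gamma / (gamma - 1) + ln (beta a) * (gamma - 1)^-1
  + ln (rho a) - beta a * vdot (velc a) (velc a) * 2^-1.
Proof. by rewrite /evar state_mkE; congr (_ - _ * _ / _). Qed.

Lemma lip_evar o : lip_bounded S dst (fun a => state_coord o (evar a)).
Proof.
have cst c : lip_bounded S dst (fun=> c) by exact: (lip_bounded_cst S dst0).
case: o => [[k|]|] /=.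
- under eq_fun do rewrite /evar state_mkE mxE.
  by apply: lip_boundedM; [exact: lip_beta|exact: lip_velc].
- under eq_fun do rewrite /evar state_mkE.
  by apply: (lip_boundedN); exact: lip_beta.
- under eq_fun do rewrite rho_evar.
  have lv : lip_bounded S dst (fun a => vdot (velc a) (velc a)).
    exact: (@lip_vdot (fun k a => velc a k) (fun k a => velc a k) S dst dst0 lip_velc lip_velc).
  exact: (lip_boundedB (lip_boundedD (lip_boundedD (cst _)
    (lip_boundedM lip_lnbeta (cst _))) lip_lnrho)
    (lip_boundedM (lip_boundedM lip_beta lv) (cst _))).
Qed.

Lemma evar_lipschitz : exists2 C, 0 <= C & forall a b, S a -> S b ->
  `|evar a - evar b| <= C * `|a - b|.
Proof.
pose P o C := 0 <= C /\ forall a b, S a -> S b ->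
  `|state_coord o (evar a) - state_coord o (evar b)| <= C * `|a - b|.
have [C hC] : {C : option (option 'I_d) -> R & forall o, P o (C o)}.
  apply: choice => o; have [C C0 h] := lip_evar o.
  by exists C; split => // a b Sa Sb; have [] := h a b Sa Sb.
exists (\sum_o C o) => [|a b Sa Sb]; first by apply: sumr_ge0 => o _; have [] := hC o.
apply: state_norm_le => [|o].
  by rewrite mulr_ge0 // sumr_ge0 // => o _; have [] := hC o.
rewrite linearB; have [C0 h] := hC o; rewrite (le_trans (h a b Sa Sb)) //.
by rewrite ler_wpM2r // (bigD1 o) //= lerDl sumr_ge0 // => i _; have [] := hC i.
Qed.

Lemma cross_frho m : cross_bounded S dst (frho m).
Proof.
apply: (cross_boundedM dst0); first exact: (cross_bounded_logmean dst0 r00 rho_ge lip_rho).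
apply: (cross_boundedM dst0).
  apply: cross_boundedD; first exact: (cross_bounded_l dst0 (lip_velc m)).
  exact: (cross_bounded_r dst0 (lip_velc m)).
exact: (cross_bounded_l dst0 (lip_bounded_cst S dst0 _)).
Qed.

Lemma cross_fnum m o : cross_bounded S dst (fun a b => state_coord o (fnum gamma m a b)).
Proof.
have cst c : cross_bounded S dst (fun _ _ => c).
  exact: (cross_bounded_l dst0 (lip_bounded_cst S dst0 _)).
have left f : lip_bounded S dst f -> cross_bounded S dst (fun a _ => f a).
  exact: (cross_bounded_l dst0).
have right f : lip_bounded S dst f -> cross_bounded S dst (fun _ b => f b).
  exact: (cross_bounded_r dst0).
have average f : lip_bounded S dst f -> cross_bounded S dst (fun a b => avg (f a) (f b)).
  move=> lf; apply: (cross_boundedM dst0); last exact: cst.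
  by apply: cross_boundedD; [exact: left|exact: right].
case: o => [[k|]|] /=.
- under eq_fun do under eq_fun do rewrite mom_fnum.
  apply: cross_boundedD; apply: (cross_boundedM dst0).
  + by apply: average; exact: lip_velc.
  + exact: cross_frho.
  + exact: cst.
  + by apply: average; exact: lip_pressure.
- under eq_fun do under eq_fun do rewrite energy_fnum.
  apply: cross_boundedD; first apply: cross_boundedD.
  + apply: (cross_boundedM dst0); last exact: cross_frho.
    apply: (cross_boundedM dst0); first exact: cst.
    apply: (cross_bounded_sum dst0) => k; apply: (cross_boundedM dst0).
      by apply: left; exact: lip_velc.
    by apply: right; exact: lip_velc.
  + apply: (cross_boundedM dst0); last exact: cross_frho.
    have [b0 b00 hb] := beta_ge; have [C C0 hC] := lip_beta.
    apply: (@cross_boundedV _ _ _ _ dst0 _ ((gamma - 1) * b0)).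
    * by rewrite mulr_gt0.
    * move=> a b Sa Sb; rewrite ler_pM2l //.
      have up e : S e -> b0 <= beta e <= C.
        by move=> Se; rewrite hb // (le_trans (ler_norm _)) // (hC e e Se Se).1.
      by case/andP: (logmean_between b00 (up a Sa) (up b Sb)).
    * apply: (cross_boundedM dst0); first exact: cst.
      exact: (cross_bounded_logmean dst0 b00 hb lip_beta).
  + have lP := lip_pressure; have lv := lip_velc m.
    apply: (cross_boundedM dst0); last exact: cst.
    by apply: cross_boundedD; apply: (cross_boundedM dst0);
      [exact: left|exact: right|exact: right|exact: left].
- by under eq_fun do under eq_fun do rewrite rho_fnum; exact: cross_frho.
Qed.

Lemma fnum_cross_bound : exists2 C, 0 <= C & forall m a a' b b',
  S a -> S a' -> S b -> S b' ->
  [/\ `|fnum gamma m a b| <= C,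
      `|fnum gamma m a' b - fnum gamma m a b| <= C * `|a' - a| &
      `|fnum gamma m a' b' - fnum gamma m a' b - fnum gamma m a b' + fnum gamma m a b|
        <= C * (`|a' - a| * `|b' - b|)].
Proof.
pose P (mo : 'I_d * option (option 'I_d)) C := 0 <= C /\
  cross_bound S dst C (fun a b => state_coord mo.2 (fnum gamma mo.1 a b)).
have [C hC] : {C : 'I_d * option (option 'I_d) -> R & forall mo, P mo (C mo)}.
  by apply: choice => mo; have [C C0 h] := cross_fnum mo.1 mo.2; exists C.
pose K := \sum_mo C mo.
have K0 : 0 <= K by apply: sumr_ge0 => mo _; have [] := hC mo.
have CK mo : C mo <= K.
  by rewrite /K (bigD1 mo) //= lerDl sumr_ge0 // => i _; have [] := hC i.
exists K => // m a a' b b' Sa Sa' Sb Sb'.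
have h o := cross_bound_le dst0 (CK (m, o)) (hC (m, o)).2 Sa Sa' Sb Sb'.
split.
- by apply: state_norm_le => // o; case: (h o).
- apply: state_norm_le => [|o]; first exact: mulr_ge0.
  by rewrite linearB; case: (h o).
- apply: state_norm_le => [|o]; first by rewrite !mulr_ge0.
  by rewrite linearD !linearB; case: (h o).
Qed.

(** Bookkeeping of orders in [a - b] and in [x], so that a remainder estimate follows from the shape
    of an algebraic expansion. *)
Definition has_order n m (f : state R d -> state R d -> state R d -> R) :=
  exists2 C, 0 <= C & forall a b x, S a -> S b ->
    `|f a b x| <= C * (`|a - b| ^+ n * `|x| ^+ m).

Lemma has_orderM n m n' m' f g : has_order n m f -> has_order n' m' g ->
  has_order (n + n') (m + m') (fun a b x => f a b x * g a b x).
Proof.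
move=> [C C0 hC] [D D0 hD]; exists (C * D); first exact: mulr_ge0.
move=> a b x Sa Sb; rewrite (le_trans (normM_le (hC a b x Sa Sb) (hD a b x Sa Sb))) //.
by rewrite !exprD le_eqVlt; apply/orP; left; apply/eqP; ring.
Qed.

Lemma has_orderD n m f g : has_order n m f -> has_order n m g ->
  has_order n m (fun a b x => f a b x + g a b x).
Proof.
move=> [C C0 hC] [D D0 hD]; exists (C + D); first exact: addr_ge0.
by move=> a b x Sa Sb; rewrite mulrDl normD_le ?hC ?hD.
Qed.

Lemma has_orderN n m f : has_order n m f -> has_order n m (fun a b x => - f a b x).
Proof. by move=> [C C0 hC]; exists C => // a b x Sa Sb; rewrite normrN hC. Qed.

Lemma has_orderB n m f g : has_order n m f -> has_order n m g ->
  has_order n m (fun a b x => f a b x - g a b x).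
Proof. by move=> hf hg'; apply: has_orderD => //; exact: has_orderN. Qed.

Lemma has_order_sum n m (I : Type) (r : seq I) f : (forall i, has_order n m (f i)) ->
  has_order n m (fun a b x => \sum_(i <- r) f i a b x).
Proof.
move=> h; elim: r => [|i r [C C0 hC]].
  by exists 0 => // a b x _ _; rewrite big_nil normr0 mul0r.
have [D D0 hD] := h i; exists (D + C); first exact: addr_ge0.
by move=> a b x Sa Sb; rewrite big_cons mulrDl normD_le ?hC ?hD.
Qed.

Lemma has_order_l f : lip_bounded S dst f -> has_order 0 0 (fun a _ _ => f a).
Proof.
by move=> [C C0 h]; exists C => // a b x Sa Sb; rewrite !expr0 !mulr1; have [] := h a a Sa Sa.
Qed.

Lemma has_order_r f : lip_bounded S dst f -> has_order 0 0 (fun _ b _ => f b).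
Proof.
by move=> [C C0 h]; exists C => // a b x Sa Sb; rewrite !expr0 !mulr1; have [] := h b b Sb Sb.
Qed.

Lemma has_order_diff f : lip_bounded S dst f -> has_order 1 0 (fun a b _ => f a - f b).
Proof.
by move=> [C C0 h]; exists C => // a b x Sa Sb; rewrite expr0 mulr1; have [] := h a b Sa Sb.
Qed.

Lemma has_order_coord o : has_order 0 1 (fun _ _ x => state_coord o x).
Proof.
by exists 1 => // a b x _ _; rewrite expr0 expr1 !mul1r; exact: state_norm_coord.
Qed.

Lemma has_order_log f c0 : 0 < c0 -> (forall a, S a -> c0 <= f a) ->
  lip_bounded S dst f ->
  has_order 2 0 (fun a b _ => f a / f b - 1 - ln (f a / f b)).
Proof.
move=> c00 fc [C C0 h]; exists (C ^+ 2 / c0 ^+ 2).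
  by rewrite divr_ge0 ?exprn_ge0 // ltW.
move=> a b x Sa Sb; rewrite mulr1.
have fa := lt_le_trans c00 (fc a Sa); have fb := lt_le_trans c00 (fc b Sb).
have /andP[l1 l2] := sub1_ln_bounds (divr_gt0 fa fb).
rewrite ger0_norm // (le_trans l2) //.
have -> : (f a / f b - 1) ^+ 2 / (f a / f b) = (f a - f b) ^+ 2 * ((f a)^-1 * (f b)^-1).
  by field; rewrite !gt_eqF.
have [_ h1] := h a b Sa Sb.
have -> : C ^+ 2 / c0 ^+ 2 * `|a - b| ^+ 2 = (C * `|a - b|) ^+ 2 * (c0^-1 * c0^-1).
  by rewrite exprMn expr2 -invfM -expr2; ring.
apply: ler_pM; rewrite ?sqr_ge0 ?mulr_ge0 ?invr_ge0 ?(ltW fa) ?(ltW fb) //.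
  by rewrite -real_normK ?num_real // lerXn2r ?nnegrE ?mulr_ge0.
by apply: ler_pM; rewrite ?invr_ge0 ?(ltW fa) ?(ltW fb) // lef_pV2 ?posrE // fc.
Qed.

Lemma has_order_vdot_diff : has_order 2 0 (fun a b _ =>
  vdot (fun k => velc a k - velc b k) (fun k => velc a k - velc b k)).
Proof.
apply: has_order_sum => k.
exact: (has_orderM (has_order_diff (lip_velc k)) (has_order_diff (lip_velc k))).
Qed.

Lemma has_order_dvel k : has_order 0 1 (fun _ b x => dvel b x k).
Proof.
apply: (@has_orderM 0 1 0 0); last first.
  exact: (has_order_r (lip_boundedV dst0 r00 rho_ge lip_rho)).
apply: has_orderB; first exact: (has_order_coord (Some (Some k))).
exact: (@has_orderM 0 1 0 0 _ _ (has_order_coord None) (has_order_r (lip_velc k))).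
Qed.

Lemma has_order_dbeta : has_order 0 1 (fun _ b x => dbeta gamma b x).
Proof.
have lPV : lip_bounded S dst (fun b => (pressure gamma b)^-1).
  by apply: (lip_boundedV dst0 P00); [move=> a []|exact: lip_pressure].
apply: has_orderB.
  exact: (@has_orderM 0 1 0 0 _ _ (has_order_coord None) (has_order_r lPV)).
have dp : has_order 0 1 (fun _ b x => dpress gamma b x).
  apply: (@has_orderM 0 0 0 1 _ _ (has_order_r (lip_cst _))).
  apply: has_orderD; first apply: has_orderB.
  - exact: (has_order_coord (Some None)).
  - apply: has_order_sum => k.
    exact: (@has_orderM 0 0 0 1 _ _ (has_order_r (lip_velc k)) (has_order_coord (Some (Some k)))).
  - apply: (@has_orderM 0 1 0 0); last exact: (has_order_r (lip_cst _)).
    apply: (@has_orderM 0 1 0 0); first exact: (has_order_coord None).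
    apply: has_order_r.
    exact: (@lip_vdot (fun k a => velc a k) (fun k a => velc a k) S dst dst0 lip_velc lip_velc).
apply: (@has_orderM 0 1 0 0).
  exact: (@has_orderM 0 0 0 1 _ _ (has_order_r lip_rho) dp).
apply: has_order_r; apply: (@eq_lip_bounded _ _ _ _ (fun b => (pressure gamma b)^-1 * (pressure gamma b)^-1)).
  by move=> a _; rewrite -invfM -expr2.
exact: (lip_boundedM lPV lPV).
Qed.

(** Each summand of [evar_expansion] has order two in [a - b] and is linear in [x]. *)
Lemma evar_quadratic : exists2 C, 0 <= C & forall a b x, S a -> S b ->
  `|sdot (evar a - evar b) x - sdot (devar gamma b x) (a - b)| <= C * (`|a - b| ^+ 2 * `|x|).
Proof.
have [b0 b00 hb] := beta_ge.
have half : has_order 2 0 (fun a b _ =>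
    vdot (fun k => velc a k - velc b k) (fun k => velc a k - velc b k) / 2).
  exact: (@has_orderM 2 0 0 0 _ _ has_order_vdot_diff (has_order_r (lip_cst _))).
have skew : has_order 1 0 (fun a b _ => rho b * (beta a - beta b) - (rho a - rho b) * beta b).
  apply: has_orderB.
    exact: (@has_orderM 0 0 1 0 _ _ (has_order_r lip_rho) (has_order_diff lip_beta)).
  exact: (@has_orderM 1 0 0 0 _ _ (has_order_diff lip_rho) (has_order_r lip_beta)).
have lbV : lip_bounded S dst (fun a => (beta a)^-1) by exact: (lip_boundedV dst0 b00 hb lip_beta).
suff [C C0 h] : has_order 2 1 (fun a b x => 
    rho x * ((beta a / beta b - 1 - ln (beta a / beta b)) * - (gamma - 1)^-1
             - (rho a / rho b - 1 - ln (rho a / rho b))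
             - beta a * (vdot (fun k => velc a k - velc b k) (fun k => velc a k - velc b k) / 2))
    + (rho b * (beta a - beta b) - (rho a - rho b) * beta b)
      * vdot (dvel b x) (fun k => velc a k - velc b k)
    + dbeta gamma b x * ((beta a - beta b) * (rho b * (beta a - beta b) - (rho a - rho b) * beta b)
                     * ((beta b)^-1 * (beta b)^-1 * (beta a)^-1 * (gamma - 1)^-1)
             + rho a * (vdot (fun k => velc a k - velc b k) (fun k => velc a k - velc b k) / 2))).
  exists C => // a b x Sa Sb; have := h a b x Sa Sb; rewrite expr1; congr (`|_| <= _).
  rewrite (evar_expansion hg x (good_admissible Sa) (good_admissible Sb)).
  have -> : (beta b ^+ 2)^-1 = (beta b)^-1 * (beta b)^-1 by rewrite -invfM -expr2.
  by rewrite !mulrA.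
apply: has_orderD; first apply: has_orderD.
- apply: (@has_orderM 0 1 2 0 _ _ (has_order_coord None)).
  apply: has_orderB; first apply: has_orderB.
  + exact: (@has_orderM 2 0 0 0 _ _ (has_order_log b00 hb lip_beta) (has_order_r (lip_cst _))).
  + exact: (has_order_log r00 rho_ge lip_rho).
  + exact: (@has_orderM 0 0 2 0 _ _ (has_order_l lip_beta) half).
- apply: (@has_orderM 1 0 1 1 _ _ skew); apply: has_order_sum => k.
  exact: (@has_orderM 0 1 1 0 _ _ (has_order_dvel k) (has_order_diff (lip_velc k))).
- apply: (@has_orderM 0 1 2 0 _ _ has_order_dbeta); apply: has_orderD.
  + apply: (@has_orderM 2 0 0 0).
      exact: (@has_orderM 1 0 1 0 _ _ (has_order_diff lip_beta) skew).
    apply: (@has_orderM 0 0 0 0); last exact: (has_order_r (lip_cst _)).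
    apply: (@has_orderM 0 0 0 0); last exact: (has_order_l lbV).
    exact: (@has_orderM 0 0 0 0 _ _ (has_order_r lbV) (has_order_r lbV)).
  + exact: (@has_orderM 0 0 2 0 _ _ (has_order_l lip_rho) half).
Qed.

Lemma rel_entropy_upper : exists2 C, 0 <= C & forall a b, S a -> S b ->
  `|rel_entropy gamma a b| <= C * `|a - b| ^+ 2.
Proof.
have [b0 b00 hb] := beta_ge.
(* The ratios in [rel_entropyE] are [b] over [a], the reverse of those in [has_order_log]. *)
have flip f : has_order 2 0 f -> has_order 2 0 (fun a b x => f b a x).
  move=> [C C0 h]; exists C => // a b x Sa Sb.
  by rewrite -normrN opprB; exact: h.
suff [C C0 h] : has_order 2 0 (fun a b _ =>
    rho a * (beta b * (vdot (fun k => velc a k - velc b k) (fun k => velc a k - velc b k) / 2))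
    + rho a * ((gamma - 1)^-1 * (beta b / beta a - 1 - ln (beta b / beta a)))
    + rho a * (rho b / rho a - 1 - ln (rho b / rho a))).
  exists C => // a b Sa Sb; have := h a b 0 Sa Sb; rewrite expr0 mulr1.
  by rewrite (rel_entropyE hg (good_admissible Sa) (good_admissible Sb)) !mulrA.
apply: has_orderD; first apply: has_orderD.
- apply: (@has_orderM 0 0 2 0 _ _ (has_order_l lip_rho)).
  apply: (@has_orderM 0 0 2 0 _ _ (has_order_r lip_beta)).
  exact: (@has_orderM 2 0 0 0 _ _ has_order_vdot_diff (has_order_r (lip_cst _))).
- apply: (@has_orderM 0 0 2 0 _ _ (has_order_l lip_rho)).
  apply: (@has_orderM 0 0 2 0 _ _ (has_order_r (lip_cst _))).
  exact: flip (has_order_log b00 hb lip_beta).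
- apply: (@has_orderM 0 0 2 0 _ _ (has_order_l lip_rho)).
  exact: flip (has_order_log r00 rho_ge lip_rho).
Qed.

(** Distance in density, velocity and [beta], the variables that the relative entropy separates. *)
Definition prim_dist a b : R :=
  `|rho a - rho b| + \sum_k `|velc a k - velc b k| + `|beta a - beta b|.

Lemma prim_dist_ge0 a b : 0 <= prim_dist a b.
Proof. by rewrite !addr_ge0 // sumr_ge0. Qed.

(** The calculus of [lip_bounded] is run again with [prim_dist] as the distance: the primitive
    variables are Lipschitz for it with constant 1, and the conserved variables are built from them
    by sums, products and inverses. *)
Lemma norm_le_prim_dist : exists2 C, 0 <= C & forall a b, S a -> S b ->
  `|a - b| <= C * prim_dist a b.
Proof.
have [b0 b00 hb] := beta_ge.
have pd0 := prim_dist_ge0.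
have sub f : lip_bounded S dst f -> (forall a b, `|f a - f b| <= prim_dist a b) ->
    lip_bounded S prim_dist f.
  move=> [C C0 h] hf; exists (C + 1); first by rewrite addr_ge0.
  move=> a b Sa Sb; split; first by rewrite (le_trans (h a a Sa Sa).1) // lerDl.
  by rewrite (le_trans (hf a b)) // ler_peMl // lerDr.
have sumv k a b : `|velc a k - velc b k| <= \sum_k `|velc a k - velc b k|.
  by rewrite (bigD1 k) //= lerDl sumr_ge0.
have lr : lip_bounded S prim_dist (@rho R d).
  apply: sub lip_rho _ => a b; rewrite /prim_dist -addrA lerDl.
  by rewrite addr_ge0 // sumr_ge0.
have lb : lip_bounded S prim_dist beta.
  apply: sub lip_beta _ => a b; rewrite /prim_dist lerDr.
  by rewrite addr_ge0 // sumr_ge0.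
have lv k : lip_bounded S prim_dist (fun a => velc a k).
  apply: sub (lip_velc k) _ => a b; rewrite (le_trans (sumv k a b)) //.
  by rewrite /prim_dist addrAC lerDr addr_ge0.
have lc o : lip_bounded S prim_dist (state_coord o).
  case: o => [[k|]|] //=.
  - apply: (@eq_lip_bounded _ _ _ _ (fun a => rho a * velc a k)) => [a [ra _ _]|].
      by rewrite -momE // gt_eqF // (lt_le_trans r00).
    exact: lip_boundedM.
  - apply: (@eq_lip_bounded _ _ _ _ (fun a =>
      rho a * (beta a)^-1 * (gamma - 1)^-1 + rho a * vdot (velc a) (velc a) * 2^-1)).
      by move=> a /good_admissible /(energy_beta hg) h; rewrite /= h.
    apply: lip_boundedD; apply: lip_boundedM; try exact: (lip_bounded_cst S pd0).
      apply: lip_boundedM => //.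
      exact: (lip_boundedV pd0 b00 hb lb).
    apply: lip_boundedM => //.
    exact: (@lip_vdot (fun k a => velc a k) (fun k a => velc a k) S prim_dist pd0 lv lv).
pose P o C := 0 <= C /\ forall a b, S a -> S b ->
  `|state_coord o a - state_coord o b| <= C * prim_dist a b.
have [C hC] : {C : option (option 'I_d) -> R & forall o, P o (C o)}.
  apply: choice => o; have [C C0 h] := lc o.
  by exists C; split => // a b Sa Sb; have [] := h a b Sa Sb.
exists (\sum_o C o) => [|a b Sa Sb]; first by apply: sumr_ge0 => o _; have [] := hC o.
apply: state_norm_le => [|o].
  by rewrite mulr_ge0 // sumr_ge0 // => o _; have [] := hC o.
rewrite linearB; have [C0 h] := hC o; rewrite (le_trans (h a b Sa Sb)) //.
by rewrite ler_wpM2r // (bigD1 o) //= lerDl sumr_ge0 // => i _; have [] := hC i.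
Qed.

Definition prim_sqdist a b : R := (rho a - rho b) ^+ 2
  + vdot (fun k => velc a k - velc b k) (fun k => velc a k - velc b k)
  + (beta a - beta b) ^+ 2.

Lemma vdot_ge0 (f : 'I_d -> R) : 0 <= vdot f f.
Proof. by apply: sumr_ge0 => k _; rewrite -expr2 sqr_ge0. Qed.

Lemma prim_dist_sqr a b : prim_dist a b ^+ 2 <= (d%:R + 2) ^+ 2 * prim_sqdist a b.
Proof.
set Q := prim_sqdist a b.
have v0 := vdot_ge0 (fun k => velc a k - velc b k).
have s1 := sqr_ge0 (rho a - rho b); have s2 := sqr_ge0 (beta a - beta b).
have Q0 : 0 <= Q by rewrite !addr_ge0.
have root (z : R) : z ^+ 2 <= Q -> `|z| <= Num.sqrt Q.
  by move=> h; rewrite -sqrtr_sqr ler_wsqrtr.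
have h1 : `|rho a - rho b| <= Num.sqrt Q by apply: root; rewrite /Q /prim_sqdist; lra.
have h2 : `|beta a - beta b| <= Num.sqrt Q by apply: root; rewrite /Q /prim_sqdist; lra.
have h3 k : `|velc a k - velc b k| <= Num.sqrt Q.
  apply: root; rewrite (@le_trans _ _ (vdot (fun k => velc a k - velc b k) (fun k => velc a k - velc b k))) //.
    by rewrite /vdot (bigD1 k) //= -expr2 lerDl sumr_ge0 // => i _; rewrite -expr2 sqr_ge0.
  by rewrite /Q /prim_sqdist; lra.
have h4 : \sum_k `|velc a k - velc b k| <= d%:R * Num.sqrt Q.
  rewrite mulr_natl (_ : _ *+ d = \sum_(k < d) Num.sqrt Q).
    by apply: ler_sum => k _.
  by rewrite sumr_const card_ord.
have -> : (d%:R + 2) ^+ 2 * Q = ((d%:R + 2) * Num.sqrt Q) ^+ 2.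
  by rewrite exprMn sqr_sqrtr.
rewrite lerXn2r ?nnegrE ?prim_dist_ge0 ?mulr_ge0 ?sqrtr_ge0 ?addr_ge0 //.
by rewrite /prim_dist; lra.
Qed.

(** Each of the three nonnegative terms of [rel_entropyE] controls the square of one primitive
    difference, and the primitive differences control [a - b]. *)
Lemma rel_entropy_lower : exists2 c, 0 < c & forall a b, S a -> S b ->
  c * `|a - b| ^+ 2 <= rel_entropy gamma a b.
Proof.
have [b0 b00 hb] := beta_ge.
have [C C0 hC] := norm_le_prim_dist.
have [Cb Cb0 hCb] := lip_beta; have [Cr Cr0 hCr] := lip_rho.
pose Mb := Cb + 1; pose Mr := Cr + 1.
have Mb0 : 0 < Mb by rewrite ltr_wpDl.
have Mr0 : 0 < Mr by rewrite ltr_wpDl.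
have bM e : S e -> beta e <= Mb.
  by move=> Se; rewrite (le_trans (ler_norm _)) // (le_trans (hCb e e Se Se).1) // lerDl.
have rM e : S e -> rho e <= Mr.
  by move=> Se; rewrite (le_trans (ler_norm _)) // (le_trans (hCr e e Se Se).1) // lerDl.
(* [K1], [K2], [K3] belong to velocity, [beta] and density; the square roots come from
   [sub1_ln_lower] with [Mb / b0] and [Mr / r0] as upper bounds on the ratios. *)
pose K1 := 2 / (r0 * b0).
pose K2 := Mb ^+ 2 * (Num.sqrt (Mb / b0) + 1) ^+ 2 * ((gamma - 1) / r0).
pose K3 := Mr ^+ 2 * (Num.sqrt (Mr / r0) + 1) ^+ 2 / r0.
have K10 : 0 <= K1 by rewrite divr_ge0 // mulr_ge0 // ltW.
have K20 : 0 <= K2 by rewrite mulr_ge0 ?divr_ge0 ?mulr_ge0 ?sqr_ge0 // ltW.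
have K30 : 0 <= K3 by rewrite divr_ge0 ?mulr_ge0 ?sqr_ge0 // ltW.
have main a b : S a -> S b ->
    prim_sqdist a b <= (K1 + K2 + K3) * rel_entropy gamma a b.
  move=> Sa Sb; have ha := good_admissible Sa; have hb' := good_admissible Sb.
  rewrite (rel_entropyE hg ha hb').
  have ra : 0 < rho a by case: ha. have rb : 0 < rho b by case: hb'.
  have ba : 0 < beta a := beta_gt0 ha. have bb : 0 < beta b := beta_gt0 hb'.
  set V := vdot _ _; set z := beta b / beta a; set z' := rho b / rho a.
  have z0 : 0 < z by rewrite divr_gt0.
  have z'0 : 0 < z' by rewrite divr_gt0.
  have V0 : 0 <= V := vdot_ge0 _.
  have /andP[l0 _] := sub1_ln_bounds z0; have /andP[l'0 _] := sub1_ln_bounds z'0.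
  have ratio (u v U c : R) : 0 < c -> c <= v -> u <= U -> 0 < u -> u / v <= U / c.
    move=> c0 cv uU u0; have v0 := lt_le_trans c0 cv.
    by apply: ler_pM; rewrite ?invr_ge0 ?(ltW u0) ?(ltW v0) // lef_pV2 ?posrE.
  have q := @sub1_ln_lower R z (Mb / b0) z0 (ratio _ _ _ _ b00 (hb _ Sa) (bM _ Sb) bb).
  have q' := @sub1_ln_lower R z' (Mr / r0) z'0 (ratio _ _ _ _ r00 (rho_ge Sa) (rM _ Sb) rb).
  pose T1 := rho a * beta b * V / 2.
  pose T2 := rho a / (gamma - 1) * (z - 1 - ln z).
  pose T3 := rho a * (z' - 1 - ln z').
  have T10 : 0 <= T1 by rewrite /T1 divr_ge0 // mulr_ge0 // mulr_ge0 // ltW.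
  have T20 : 0 <= T2 by rewrite /T2 mulr_ge0 // divr_ge0 // ltW.
  have T30 : 0 <= T3 by rewrite /T3 mulr_ge0 // ltW.
  have h1 : V <= K1 * T1.
    have -> : K1 * T1 = V * ((rho a / r0) * (beta b / b0)).
      by rewrite /K1 /T1; field; rewrite !gt_eqF.
    rewrite ler_peMr // mulr_ege1 // ler_pdivlMr // mul1r ?rho_ge ?hb //.
  have h2 : (beta a - beta b) ^+ 2 <= K2 * T2.
    have -> : (beta a - beta b) ^+ 2 = beta a ^+ 2 * (z - 1) ^+ 2.
      by rewrite /z; field; rewrite gt_eqF.
    have -> : K2 * T2 = Mb ^+ 2 *
        (((Num.sqrt (Mb / b0) + 1) ^+ 2 * (z - 1 - ln z)) * (rho a / r0)).
      by rewrite /K2 /T2; field; rewrite !gt_eqF.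
    apply: ler_pM; rewrite ?sqr_ge0 //.
      by rewrite lerXn2r ?nnegrE ?(ltW ba) ?(ltW Mb0) // bM.
    rewrite (le_trans q) // ler_peMr //; first by rewrite mulr_ge0 ?sqr_ge0.
    by rewrite ler_pdivlMr // mul1r rho_ge.
  have h3 : (rho a - rho b) ^+ 2 <= K3 * T3.
    have -> : (rho a - rho b) ^+ 2 = rho a ^+ 2 * (z' - 1) ^+ 2.
      by rewrite /z'; field; rewrite gt_eqF.
    have -> : K3 * T3 = Mr ^+ 2 *
        (((Num.sqrt (Mr / r0) + 1) ^+ 2 * (z' - 1 - ln z')) * (rho a / r0)).
      by rewrite /K3 /T3; field; rewrite !gt_eqF.
    apply: ler_pM; rewrite ?sqr_ge0 //.
      by rewrite lerXn2r ?nnegrE ?(ltW ra) ?(ltW Mr0) // rM.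
    rewrite (le_trans q') // ler_peMr //; first by rewrite mulr_ge0 ?sqr_ge0.
    by rewrite ler_pdivlMr // mul1r rho_ge.
  rewrite -/T1 -/T2 -/T3 /prim_sqdist -/V.
  have := mulr_ge0 K10 T20; have := mulr_ge0 K10 T30; have := mulr_ge0 K20 T10.
  have := mulr_ge0 K20 T30; have := mulr_ge0 K30 T10; have := mulr_ge0 K30 T20.
  move: h1 h2 h3; rewrite !mulrDl !mulrDr; lra.
pose D := (C ^+ 2 * (d%:R + 2) ^+ 2) * (K1 + K2 + K3) + 1.
have D0 : 0 < D by rewrite ltr_wpDl // !mulr_ge0 ?addr_ge0 ?sqr_ge0.
exists D^-1; first by rewrite invr_gt0.
move=> a b Sa Sb; rewrite ler_pdivrMl //.
have E0 : 0 <= rel_entropy gamma a b.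
  have := main a b Sa Sb; have : 0 <= prim_sqdist a b.
    by rewrite !addr_ge0 ?sqr_ge0 ?vdot_ge0.
  move=> h /(le_trans h) h2; have K0 : 0 < K1 + K2 + K3.
    by rewrite addrAC ltr_wpDr // ltr_pwDl // divr_gt0 // mulr_gt0.
  by rewrite pmulr_rge0 in h2.
rewrite (@le_trans _ _ ((C ^+ 2 * (d%:R + 2) ^+ 2) * prim_sqdist a b)) //.
  rewrite -mulrA (@le_trans _ _ (C ^+ 2 * prim_dist a b ^+ 2)) //.
    by rewrite -exprMn lerXn2r ?nnegrE ?mulr_ge0 ?prim_dist_ge0 ?hC.
  by rewrite ler_wpM2l ?sqr_ge0 // prim_dist_sqr.
rewrite /D mulrDl mul1r (@le_trans _ _ (C ^+ 2 * (d%:R + 2) ^+ 2 * (K1 + K2 + K3) * rel_entropy gamma a b)) ?lerDl //.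
by rewrite -[X in _ <= X]mulrA ler_wpM2l ?mulr_ge0 ?sqr_ge0 // main.
Qed.
End StateBounds.

(** * Uniform bounds on derivatives on the torus *)

Section UniformCk.
Variables (R : realType) (d : nat).
Implicit Types (x y : 'rV[R]_d) (f g : 'rV[R]_d -> R).

(** A recursive counterpart of [Ck_torus] with one bound for all derivatives up to order [k]. The
    recursion suits the product rule, and the explicit [B] makes uniformity over a family of
    functions expressible. *)
Fixpoint Ck_bounded (k : nat) (B : R) f : Prop :=
  [/\ continuous f, forall x, `|f x| <= B &
    if k is k'.+1 then forall m : 'I_d, (forall x, derivable f x (evec m)) /\
      Ck_bounded k' B (fun x => 'D_(evec m) f x) else True].

Lemma Ck_bounded_continuous k B f : Ck_bounded k B f -> continuous f.
Proof. by case: k => [|k] []. Qed.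

Lemma Ck_bounded_bound k B f x : Ck_bounded k B f -> `|f x| <= B.
Proof. by case: k => [|k] []. Qed.

Lemma Ck_bounded_le k B B' f : B <= B' -> Ck_bounded k B f -> Ck_bounded k B' f.
Proof.
move=> BB; elim: k f => [|k IH] f [h1 h2 h3].
  by split => // x; exact: le_trans BB.
split => // [x|m]; first exact: le_trans BB.
by have [h4 h5] := h3 m; split => //; exact: IH.
Qed.

Lemma Ck_bounded_pred k B f : Ck_bounded k.+1 B f -> Ck_bounded k B f.
Proof.
elim: k f => [|k IH] f [h1 h2 h3]; first by split.
by split => // m; have [h4 h5] := h3 m; split => //; exact: IH.
Qed.

Lemma Ck_bounded_cst k B c : `|c| <= B -> Ck_bounded k B (fun=> c).
Proof.
move=> cB; elim: k c cB => [|k IH] c cB.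
  by split => //; exact: cst_continuous.
split => [|//|m]; first exact: cst_continuous.
split => [x|]; first exact: derivable_cst.
under eq_fun do rewrite derive_cst.
by apply: IH; rewrite normr0 (le_trans _ cB).
Qed.

Lemma Ck_boundedD k B C f g : Ck_bounded k B f -> Ck_bounded k C g ->
  Ck_bounded k (B + C) (fun x => f x + g x).
Proof.
elim: k f g => [|k IH] f g [f1 f2 f3] [g1 g2 g3].
  split => // [|x]; last exact: normD_le.
  by move=> x; apply: continuousD; [exact: f1|exact: g1].
split => [|x|m].
- by move=> x; apply: continuousD; [exact: f1|exact: g1].
- exact: normD_le.
- have [f4 f5] := f3 m; have [g4 g5] := g3 m; split => [x|].
    by apply: derivableD.
  have -> : (fun x => 'D_(evec m) (fun x => f x + g x) x) =
      (fun x => 'D_(evec m) f x + 'D_(evec m) g x).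
    by apply/funext => x; rewrite -deriveD.
  exact: IH.
Qed.

(** [D] is fixed before [f] and [g], which keeps later constants independent of time and base
    point. *)
Lemma Ck_boundedM k B C : 0 <= B -> 0 <= C -> exists2 D, 0 <= D &
  forall f g, Ck_bounded k B f -> Ck_bounded k C g -> Ck_bounded k D (fun x => f x * g x).
Proof.
move=> B0 C0; elim: k => [|k [D D0 IH]].
  exists (B * C) => [|f g [f1 f2 _] [g1 g2 _]]; first exact: mulr_ge0.
  split => // [x|x]; last exact: normM_le.
  by apply: continuousM; [exact: f1|exact: g1].
exists (B * C + (D + D)) => [|f g Hf Hg].
  by rewrite !addr_ge0 ?mulr_ge0.
have [f1 f2 f3] := Hf; have [g1 g2 g3] := Hg.
split => [x|x|m].
- by apply: continuousM; [exact: f1|exact: g1].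
- by rewrite (le_trans (normM_le (f2 x) (g2 x))) // lerDl addr_ge0.
- have [f4 f5] := f3 m; have [g4 g5] := g3 m; split => [x|].
    by apply: derivableM.
  have -> : (fun x => 'D_(evec m) (fun x => f x * g x) x) =
      (fun x => f x * 'D_(evec m) g x + g x * 'D_(evec m) f x).
    by apply/funext => x; have := deriveM (f4 x) (g4 x); rewrite /GRing.scale.
  apply: (@Ck_bounded_le _ (D + D)); first by rewrite lerDr mulr_ge0.
  apply: Ck_boundedD; first by apply: IH => //; exact: Ck_bounded_pred.
  have -> : (fun x => g x * 'D_(evec m) f x) = (fun x => 'D_(evec m) f x * g x).
    by apply/funext => x; rewrite mulrC.
  by apply: IH => //; exact: Ck_bounded_pred.
Qed.

Lemma pds_rcons {W : normedModType R} (s : seq 'I_d) m (f : 'rV[R]_d -> W) :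
  pds (rcons s m) f = pds s (fun x => 'D_(evec m) f x).
Proof. by rewrite /pds foldr_rcons. Qed.

Lemma Ck_bounded_pds k B f s : (size s <= k)%N -> Ck_bounded k B f ->
  Ck_bounded (k - size s) B (pds s f).
Proof.
elim/last_ind: s k f => [|s m IH] k f; first by rewrite subn0.
rewrite size_rcons pds_rcons; case: k => // k; rewrite ltnS subSS => sk [_ _ h].
by have [_ h2] := h m; exact: IH.
Qed.

Lemma pds_Ck_bounded k B f :
  (forall s : seq 'I_d, (size s <= k)%N ->
    [/\ continuous (pds s f), forall x, `|pds s f x| <= B &
        (size s < k)%N -> forall m x, derivable (pds s f) x (evec m)]) ->
  Ck_bounded k B f.
Proof.
elim: k f => [|k IH] f h; first by have [] := h [::] isT; split.
have [h1 h2 h3] := h [::] isT; split => // m; split; first exact: h3.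
apply: IH => s sk; have [] := h (rcons s m) _; first by rewrite size_rcons.
by rewrite pds_rcons size_rcons; split.
Qed.

Lemma Ck_bounded_torus (L : R) k B f : Defs.periodic L f -> Ck_bounded k B f -> Ck_torus L k f.
Proof.
move=> pf hf; split => // s sk; have h := Ck_bounded_pds sk hf; split.
  exact: Ck_bounded_continuous h.
move=> sk' m x; move: h; rewrite -subn_gt0 in sk'.
by case: (k - size s)%N sk' => // n _ [_ _ h]; have [] := h m.
Qed.

Lemma Ck_bounded_norm k B f : 0 <= B -> Ck_bounded k B f -> Ck_norm k f <= B.
Proof.
move=> B0 hf; apply: ge_sup.
  by exists `|f 0|; exists [::]; split => //; exists 0.
move=> _ [s [sk [x ->]]]; exact: Ck_bounded_bound (Ck_bounded_pds sk hf).
Qed.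

Lemma is_derive_line {W : normedModType R} (f : 'rV[R]_d -> W) x v (s : R) :
  derivable f (x + s *: v) v ->
  is_derive s 1 (fun h : R => f (x + h *: v)) ('D_v f (x + s *: v)).
Proof.
have E : (fun h : R => h^-1 *: (((fun h : R => f (x + h *: v)) \o shift s) (h *: 1) - f (x + s *: v))) =
   (fun h : R => h^-1 *: ((f \o shift (x + s *: v)) (h *: v) - f (x + s *: v))).
  apply/funext => h /=; congr (_ *: (f _ - _)).
  rewrite (_ : h%:A = h); last exact: mulr1.
  by rewrite scalerDl addrCA.
by move=> h; split; rewrite ?/derivable ?/derive E.
Qed.

Lemma Ck_bounded_axis_lipschitz B f m x (h : R) : Ck_bounded 1 B f ->
  `|f (x + h *: evec m) - f x| <= B * `|h|.
Proof.
move=> [_ _ hf]; have [df [_ bf _]] := hf m.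
have B0 : 0 <= B := le_trans (normr_ge0 _) (bf x).
have d1 (s : R) : is_derive s 1 (fun t : R => f (x + t *: evec m)) ('D_(evec m) f (x + s *: evec m)).
  exact: is_derive_line.
have d2 (s : R) : is_derive s 1 (fun t : R => f (x + (h * t) *: evec m))
    ('D_(evec m) f (x + (h * s) *: evec m) * h).
  have h1 : is_derive s 1 (fun t : R => h * t) h.
    have := is_derive_affine 0 h s; apply: eq_is_derive1 => // t.
    by rewrite add0r.
  exact: (@is_derive1_comp R (fun t : R => f (x + t *: evec m)) (fun t => h * t) s _ _ (d1 _) h1).
have := @mean_bound R _ _ (B * `|h|) (fun s _ => d2 s).
rewrite mulr1 mulr0 scale0r addr0; apply => s _.
by rewrite normrM ler_wpM2r.
Qed.

Lemma row_sum_evec (x : 'rV[R]_d) : x = \sum_(m < d) x ord0 m *: evec m.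
Proof. exact: row_sum_delta. Qed.

(** Only partial derivatives are given, so [x] and [y] are joined by a path parallel to the axes;
    hence the factor [d]. *)
Lemma Ck_bounded_lipschitz B f x y : Ck_bounded 1 B f ->
  `|f y - f x| <= B * d%:R * `|y - x|.
Proof.
move=> hf; have B0 : 0 <= B := le_trans (normr_ge0 _) (Ck_bounded_bound x hf).
have key (c : 'I_d -> R) (r : seq 'I_d) : forall z,
    `|f (z + \sum_(m <- r) c m *: evec m) - f z| <= \sum_(m <- r) B * `|c m|.
  elim: r => [|m r IH] z; first by rewrite !big_nil addr0 subrr normr0.
  rewrite !big_cons (addrA z); set w := z + c m *: evec m.
  set w' := w + _; rewrite (_ : f w' - f z = (f w - f z) + (f w' - f w)); last by ring.
  by apply: normD_le; [exact: Ck_bounded_axis_lipschitz|exact: IH].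
have := key (fun m => (y - x) ord0 m) (index_enum 'I_d) x.
rewrite -row_sum_evec subrKC => /le_trans; apply.
rewrite -mulr_sumr -mulrA ler_wpM2l // mulr_natl.
have -> : `|y - x| *+ d = \sum_(m < d) `|y - x| by rewrite sumr_const card_ord.
apply: ler_sum => m _.
rewrite [X in _ <= X]/Num.Def.normr /= mx_normrE.
exact: (@le_bigmax_cond _ _ _ _ (ord0, m) _ (fun i => `|(y - x) i.1 i.2|)).
Qed.

Section Periodic.
Variables (L : R) (W : Type).

Lemma periodicMn (g : 'rV[R]_d -> W) m x (n : nat) : Defs.periodic L g ->
  g (x + (L * n%:R) *: evec m) = g x.
Proof.
move=> pg; elim: n x => [|n IH] x; first by rewrite mulr0 scale0r addr0.
by rewrite -natr1 mulrDr mulr1 scalerDl addrA pg IH.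
Qed.

Lemma periodicMz (g : 'rV[R]_d -> W) m x (z : int) : Defs.periodic L g ->
  g (x + (L * z%:~R) *: evec m) = g x.
Proof.
move=> pg; case: z => n; first exact: periodicMn.
rewrite -[RHS](@periodicMn g m _ n.+1 pg) NegzE mulrNz mulrN scaleNr.
rewrite -(@periodicMn g m (x - _) (n.+1 + n.+1) pg); congr g.
by rewrite natrD mulrDr scalerDl addrA subrK.
Qed.

Lemma periodic_lattice (g : 'rV[R]_d -> W) x (k : 'rV[int]_d) : Defs.periodic L g ->
  g (x + L *: map_mx intr k) = g x.
Proof.
move=> pg; rewrite [map_mx _ _]row_sum_evec scaler_sumr.
elim: (index_enum _) x => [|m r IH] x; first by rewrite big_nil addr0.
rewrite big_cons addrA IH scalerA mxE; exact: periodicMz.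
Qed.
End Periodic.

Lemma periodic_derive {W : normedModType R} (L : R) (g : 'rV[R]_d -> W) v :
  Defs.periodic L g -> Defs.periodic L (fun x => 'D_v g x).
Proof.
move=> pg m x; rewrite /derive.
suff -> : (fun h => h^-1 *: ((g \o shift (x + L *: evec m)) (h *: v) - g (x + L *: evec m)))
  = (fun h => h^-1 *: ((g \o shift x) (h *: v) - g x)) by [].
by apply/funext => h /=; rewrite addrA !pg.
Qed.

Lemma periodic_pds {W : normedModType R} (L : R) (g : 'rV[R]_d -> W) s :
  Defs.periodic L g -> Defs.periodic L (pds s g).
Proof. by move=> pg; elim: s => //= m s IH; exact: periodic_derive. Qed.

Lemma periodic_reduce (L : R) x : 0 < L -> exists k : 'rV[int]_d,
  forall m, 0 <= (x + L *: map_mx intr k) ord0 m <= L.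
Proof.
move=> L0; exists (\row_m (- Num.floor (x ord0 m / L))) => m.
rewrite !mxE mulrNz.
have /andP[] := floor_itv (x ord0 m / L); rewrite intrD.
move: (Num.floor _)%:~R => z h1 h2.
have : z * L <= x ord0 m by rewrite -ler_pdivlMr.
have : x ord0 m < (z + 1) * L by rewrite -ltr_pdivrMr.
by move=> h3 h4; apply/andP; split; lra.
Qed.

(** Periodicity moves every point into the compact cube [[0, L]^d]. *)
Lemma continuous_tx_bounded {W : normedModType R} (L T : R) (f : R -> 'rV[R]_d -> W) :
  0 < L -> 0 <= T -> periodic_tx L T f -> continuous_tx T f ->
  exists2 B, 0 <= B & forall t x, 0 <= t <= T -> `|f t x| <= B.
Proof.
move=> L0 T0 pf cf.
pose A := `[0, T]%classic `*` [set x : 'rV[R]_d | forall m, `[0, L]%classic (x ord0 m)].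
have cA : compact A.
  apply: compact_setX; first exact: segment_compact.
  by apply: (@rV_compact R d (fun=> `[0, L]%classic)) => _; exact: segment_compact.
have A0 : A !=set0.
  exists (0, 0); split => /=; first by rewrite in_itv /= lexx.
  by move=> m; rewrite /= mxE in_itv /= lexx ltW.
have cn : {within A, continuous (fun z : R * 'rV[R]_d => `|f z.1 z.2|)}.
  have cf' : {within A, continuous (fun z : R * 'rV[R]_d => f z.1 z.2)}.
    by apply: continuous_subspaceW cf => z [].
  by move=> z; apply: cvg_norm; exact: cf'.
have [c _ hc] := compact_EVT_max A0 cA cn.
exists `|f c.1 c.2| => // t x tT.
have [k hk] := periodic_reduce x L0.
rewrite -(periodic_lattice x k (pf t tT)).
apply: (hc (t, _)); rewrite inE; split => /=; first by rewrite in_itv.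
by move=> m; rewrite /= in_itv /=.
Qed.

Lemma continuous_tx_slice {W : normedModType R} (T : R) (f : R -> 'rV[R]_d -> W) t :
  continuous_tx T f -> 0 <= t <= T -> continuous (f t).
Proof.
move=> /subspace_continuousP cf tT x A nA.
have := cf (t, x) _ A nA; rewrite /=.
have tx : (`[0, T]%classic `*` [set: 'rV[R]_d]) (t, x) by split; rewrite //= in_itv.
move=> /(_ tx); rewrite /within /=.
change (nbhs (t, x) (fun z : R * 'rV[R]_d => (`[0, T]%classic `*` [set: 'rV[R]_d]) z -> A (f z.1 z.2))
  -> nbhs x (fun y => A (f t y))).
move=> [[P Q] [/= nP nQ] PQ]; apply: filterS nQ => y Qy.
apply: (PQ (t, y)); first by split => //=; exact: nbhs_singleton nP.
by split; rewrite //= in_itv.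
Qed.

Lemma pds_tx_space {W : normedModType R} (T : R) (s : seq 'I_d) (f : R -> 'rV[R]_d -> W) t :
  pds_tx T (map Some s) f t = pds s (f t).
Proof. by elim: s => //= m s IH; apply/funext => x; rewrite /pd_tx IH. Qed.

Lemma pds_coord (n : nat) (g : 'rV[R]_d -> 'rV[R]_n) j k :
  (forall s : seq 'I_d, (size s < k)%N -> forall m x, derivable (pds s g) x (evec m)) ->
  forall s : seq 'I_d, (size s <= k)%N ->
  pds s (fun x => g x ord0 j) = fun x => pds s g x ord0 j.
Proof.
move=> dg; elim=> //= m s IH sk; rewrite IH; last exact: ltnW.
apply/funext => x; rewrite [in RHS](derive_mx (dg s sk m x)) mxE.
by [].
Qed.

Lemma coord_norm_le (n : nat) (a : 'rV[R]_n) j : `|a ord0 j| <= `|a|.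
Proof.
rewrite [X in _ <= X]/Num.Def.normr /= mx_normrE.
exact: (@le_bigmax_cond _ _ _ _ (ord0, j) _ (fun i => `|a i.1 i.2|)).
Qed.

Lemma Ck_tx_bounded (n : nat) (L T : R) k (u : R -> 'rV[R]_d -> 'rV[R]_n) :
  0 < L -> 0 <= T -> Ck_tx L T k u ->
  exists2 B, 0 <= B & forall t j, 0 <= t <= T -> Ck_bounded k B (fun x => u t x ord0 j).
Proof.
move=> L0 T0 [pu hu].
have hs (s : seq 'I_d) : (size s <= k)%N -> exists2 B, 0 <= B &
    forall t x, 0 <= t <= T -> `|pds s (u t) x| <= B.
  move=> sk; have sk' : (size (map Some s) <= k)%N by rewrite size_map.
  have [cu _] := hu _ sk'.
  have pt : periodic_tx L T (pds_tx T (map Some s) u).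
    by move=> t tT; rewrite pds_tx_space; apply: periodic_pds; exact: pu.
  have [B B0 hB] := continuous_tx_bounded L0 T0 pt cu.
  by exists B => // t x tT; have := hB t x tT; rewrite pds_tx_space.
pose P (s : seq 'I_d) B := 0 <= B /\ ((size s <= k)%N ->
    forall t x, 0 <= t <= T -> `|pds s (u t) x| <= B).
have [B hB] : {B : seq 'I_d -> R & forall s, P s (B s)}.
  apply: choice => s; have [sk|sk] := boolP (size s <= k)%N.
    by have [B B0 h] := hs s sk; exists B.
  by exists 0; split => //; rewrite (negbTE sk).
have B0 s : 0 <= B s by have [] := hB s.
(* Only finitely many sequences of directions have length at most [k]; tuples enumerate them, and
   the sum dominates each bound. *)
pose K := \sum_(i < k.+1) \sum_(s : i.-tuple 'I_d) B s.
have BK (s : seq 'I_d) : (size s <= k)%N -> B s <= K.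
  rewrite -ltnS => sk; rewrite /K (bigD1 (Ordinal sk)) //= (bigD1 (in_tuple s)) //=.
  rewrite -addrA lerDl addr_ge0 ?sumr_ge0 // => i _.
  by apply: sumr_ge0.
exists K; first by apply: sumr_ge0 => i _; apply: sumr_ge0.
move=> t j tT.
have dg (s : seq 'I_d) : (size s < k)%N -> forall m x, derivable (pds s (u t)) x (evec m).
  move=> sk m x; have [|_] := hu (map Some s); first by rewrite size_map ltnW.
  by rewrite size_map => /(_ sk (Some m) t x tT); rewrite /pd_tx_exists pds_tx_space.
have cg (s : seq 'I_d) : (size s <= k)%N -> continuous (pds s (u t)).
  move=> sk; have [|cu _] := hu (map Some s); first by rewrite size_map.
  by rewrite -(pds_tx_space T); exact: (continuous_tx_slice cu tT).
apply: pds_Ck_bounded => s sk; rewrite (pds_coord j dg sk); split.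
- move=> x; apply: (@cvg_comp _ _ _ (pds s (u t)) (fun a : 'rV[R]_n => a ord0 j)).
    exact: cg.
  exact: coord_continuous.
- move=> x; rewrite (le_trans (coord_norm_le _ _)) // (le_trans _ (BK s sk)) //.
  by have [_] := hB s; apply.
- move=> sk' m x; have /derivable_mxP := dg s sk' m x; exact.
Qed.
End UniformCk.

(** * Approximation near the diagonal *)

Section TorusApproximation.
Variables (R : realType) (d : nat) (L : R) (Theta : Type) (P : set Theta)
  (xb : Theta -> 'rV[R]_d) (K : nat).
Hypothesis K0 : (0 < K)%N.
Implicit Types (phi psi : Theta -> 'rV[R]_d -> R).

(* The SBP accuracy applies to [g th], while the two-point flux [phi th] is only
   known near the diagonal; a stencil sees their difference at order [K]. *)
Definition torus_approx phi := exists g : Theta -> 'rV[R]_d -> R,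
  exists2 C, 0 <= C & forall th, P th ->
  [/\ Defs.periodic L (g th), Ck_bounded K C (g th), (forall y, `|phi th y| <= C),
      (forall y, `|phi th y - g th y| <= C * `|y - xb th| ^+ K) &
      (forall y, `|phi th y - phi th (xb th)| <= C * `|y - xb th|)].

Lemma torus_approx_Ck (f : Theta -> 'rV[R]_d -> R) B : 0 <= B ->
  (forall th, P th -> Defs.periodic L (f th) /\ Ck_bounded K B (f th)) ->
  torus_approx f.
Proof.
move=> B0 h; exists f, (B + B * d%:R); first by rewrite addr_ge0 ?mulr_ge0.
move=> th Pth; have [h1 h2] := h th Pth; split => //.
- by apply: Ck_bounded_le h2; rewrite lerDl mulr_ge0.
- by move=> y; rewrite (le_trans (Ck_bounded_bound y h2)) // lerDl mulr_ge0.
- by move=> y; rewrite subrr normr0 mulr_ge0 ?addr_ge0 ?mulr_ge0 ?exprn_ge0.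
- move=> y; have h3 : Ck_bounded 1 B (f th).
    move: h2; case: (K) K0 => // n _; elim: n => // n IH h2.
    by apply: IH; exact: Ck_bounded_pred.
  rewrite (le_trans (Ck_bounded_lipschitz _ _ h3)) // ler_wpM2r // lerDr //.
Qed.

Lemma torus_approx_cst (c : Theta -> R) B : 0 <= B ->
  (forall th, P th -> `|c th| <= B) -> torus_approx (fun th _ => c th).
Proof.
move=> B0 h; apply: (@torus_approx_Ck _ B) => // th Pth; split => //.
by apply: Ck_bounded_cst; exact: h.
Qed.

Lemma torus_approxD phi psi : torus_approx phi -> torus_approx psi ->
  torus_approx (fun th y => phi th y + psi th y).
Proof.
move=> [g [C C0 h]] [g' [C' C'0 h']].
exists (fun th y => g th y + g' th y), (C + C'); first exact: addr_ge0.
move=> th Pth; have [h1 h2 h3 h4 h5] := h th Pth.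
have [k1 k2 k3 k4 k5] := h' th Pth; split.
- by move=> m x; rewrite h1 k1.
- exact: Ck_boundedD.
- by move=> y; exact: normD_le.
- by move=> y; rewrite opprD addrACA mulrDl; exact: normD_le.
- by move=> y; rewrite opprD addrACA mulrDl; exact: normD_le.
Qed.

Lemma torus_approxM phi psi : torus_approx phi -> torus_approx psi ->
  torus_approx (fun th y => phi th y * psi th y).
Proof.
move=> [g [C C0 h]] [g' [C' C'0 h']].
have [D D0 hD] := Ck_boundedM d K C0 C'0.
exists (fun th y => g th y * g' th y), (D + (C * C' + C * C')).
  by rewrite !addr_ge0 ?mulr_ge0.
have CC : 0 <= C * C' by rewrite mulr_ge0.
move=> th Pth; have [h1 h2 h3 h4 h5] := h th Pth.
have [k1 k2 k3 k4 k5] := h' th Pth; split.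
- by move=> m x; rewrite h1 k1.
- by apply: (@Ck_bounded_le _ _ _ D); [rewrite lerDl addr_ge0|exact: hD].
- by move=> y; rewrite (le_trans (normM_le (h3 y) (k3 y))) //; lra.
- move=> y; rewrite (_ : _ - _ = phi th y * (psi th y - g' th y)
      + (phi th y - g th y) * g' th y); last by ring.
  have q1 := normM_le (h3 y) (k4 y).
  have q2 := normM_le (h4 y) (Ck_bounded_bound y k2).
  rewrite (le_trans (normD_le q1 q2)) //.
  have := mulr_ge0 D0 (exprn_ge0 K (normr_ge0 (y - xb th))).
  move: (`|_| ^+ K) => z; rewrite -mulrA [z * _]mulrC !mulrA mulrDl mulrDl; lra.
- move=> y; rewrite (_ : _ - _ = phi th y * (psi th y - psi th (xb th))
      + (phi th y - phi th (xb th)) * psi th (xb th)); last by ring.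
  have q1 := normM_le (h3 y) (k5 y); have q2 := normM_le (h5 y) (k3 (xb th)).
  rewrite (le_trans (normD_le q1 q2)) //.
  have := mulr_ge0 D0 (normr_ge0 (y - xb th)).
  move: (`|_|) => z; rewrite -mulrA [z * _]mulrC !mulrA mulrDl mulrDl; lra.
Qed.

Lemma torus_approxN phi : torus_approx phi -> torus_approx (fun th y => - phi th y).
Proof.
move=> h; have c : torus_approx (fun _ _ => -1).
  by apply: (@torus_approx_cst (fun=> -1) 1) => // th _; rewrite normrN1.
have := torus_approxM c h.
by rewrite (_ : (fun th y => -1 * phi th y) = fun th y => - phi th y) //;
  apply/funext => th; apply/funext => y; rewrite mulN1r.
Qed.

Lemma torus_approxB phi psi : torus_approx phi -> torus_approx psi ->
  torus_approx (fun th y => phi th y - psi th y).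
Proof. by move=> h1 h2; apply: torus_approxD => //; exact: torus_approxN. Qed.

Lemma torus_approx_sum (I : Type) (r : seq I) (phi : I -> Theta -> 'rV[R]_d -> R) :
  (forall i, torus_approx (phi i)) -> torus_approx (fun th y => \sum_(i <- r) phi i th y).
Proof.
move=> h; elim: r => [|i r IH].
  under eq_fun do under eq_fun do rewrite big_nil.
  by apply: (@torus_approx_cst (fun=> 0) 0) => // th _; rewrite normr0.
under eq_fun do under eq_fun do rewrite big_cons.
exact: torus_approxD.
Qed.

Lemma torus_approxX phi n : torus_approx phi -> torus_approx (fun th y => phi th y ^+ n).
Proof.
move=> h; elim: n => [|n IH].
  under eq_fun do under eq_fun do rewrite expr0.
  by apply: (@torus_approx_cst (fun=> 1) 1) => // th _; rewrite normr1.
under eq_fun do under eq_fun do rewrite exprS.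
exact: torus_approxM.
Qed.

Lemma torus_approx_at phi : torus_approx phi -> torus_approx (fun th _ => phi th (xb th)).
Proof.
move=> [g [C C0 h]]; apply: (@torus_approx_cst _ C) => // th Pth.
by have [] := h th Pth.
Qed.

(** An error of order [K] at the base point is already tolerated by [torus_approx], so [phi] keeps
    the approximant of [psi]. This is the way from polynomial expressions to inverses and
    logarithmic means. *)
Lemma torus_approx_perturb phi psi C : 0 <= C -> torus_approx psi ->
  (forall th y, P th -> `|phi th y| <= C) ->
  (forall th y, P th -> `|phi th y - psi th y| <= C * `|y - xb th| ^+ K) ->
  torus_approx phi.
Proof.
move=> C0 [g [C' C'0 h]] hb hp; pose D : R := C + C + C'.
exists g, D; first by rewrite /D !addr_ge0.
move=> th Pth; have [h1 h2 h3 h4 h5] := h th Pth; split => //.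
- by apply: Ck_bounded_le h2; rewrite /D; lra.
- by move=> y; rewrite (le_trans (hb th y Pth)) // /D; lra.
- move=> y; rewrite -(subrK (psi th y) (phi th y)) -addrA.
  rewrite (le_trans (normD_le (hp th y Pth) (h4 y))) //.
  have := mulr_ge0 C0 (exprn_ge0 K (normr_ge0 (y - xb th))).
  by rewrite /D; move: (`|_| ^+ K) => z; lra.
(* Within distance 1 the [K]-th power is below the distance, and [phi] and [psi] coincide at the
   base point as [0 < K]; beyond distance 1 boundedness suffices. *)
- move=> y; have [y1|y1] := leP `|y - xb th| 1.
    have e0 : phi th (xb th) = psi th (xb th).
      apply/eqP; rewrite -subr_eq0 -normr_le0 (le_trans (hp _ _ Pth)) //.
      by rewrite subrr normr0 expr0n eqn0Ngt K0 mulr0.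
    rewrite e0 -(subrK (psi th y) (phi th y)) -addrA.
    rewrite (le_trans (normD_le (hp th y Pth) (h5 y))) //.
    have yK : `|y - xb th| ^+ K <= `|y - xb th|.
      by case: (K) K0 => // n _; rewrite exprS ler_piMr // exprn_ile1.
    have := ler_wpM2l C0 yK; have := mulr_ge0 C0 (normr_ge0 (y - xb th)).
    by rewrite /D; lra.
  rewrite (le_trans (normB_le (hb th y Pth) (hb th (xb th) Pth))) //.
  have D0 : 0 <= D by rewrite /D !addr_ge0.
  by rewrite (@le_trans _ _ D) ?ler_peMr ?(ltW y1) // /D lerDl.
Qed.

Section Positive.
Variables (phi : Theta -> 'rV[R]_d -> R) (c0 : R).
Hypotheses (hphi : torus_approx phi) (c00 : 0 < c0)
  (phi_ge : forall th y, P th -> c0 <= phi th y).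

Let diff_approx : torus_approx (fun th y => phi th (xb th) - phi th y).
Proof. by apply: torus_approxB => //; exact: torus_approx_at. Qed.

Let inv_base n (c : R) : 0 <= c -> torus_approx (fun th _ => c / phi th (xb th) ^+ n).
Proof.
move=> cp; apply: (@torus_approx_cst _ (c / c0 ^+ n)) => [|th Pth].
  by rewrite divr_ge0 // exprn_ge0 // ltW.
have p0 : 0 < phi th (xb th) := lt_le_trans c00 (phi_ge _ Pth).
rewrite ger0_norm ?divr_ge0 ?exprn_ge0 ?(ltW p0) // ler_wpM2l //.
by rewrite lef_pV2 ?posrE ?exprn_gt0 // lerXn2r ?nnegrE ?(ltW p0) ?(ltW c00) ?phi_ge.
Qed.

(** The geometric series of the inverse about the value at the base point, cut off after [K] terms,
    is polynomial in [phi]; its remainder contains the [K]-th power of a difference that is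
    Lipschitz in [y]. *)
Lemma torus_approxV : torus_approx (fun th y => (phi th y)^-1).
Proof.
have [g [C C0 h]] := hphi.
have ps : torus_approx (fun th y => \sum_(k < K)
    (phi th (xb th) - phi th y) ^+ k * (1 / phi th (xb th) ^+ k.+1)).
  apply: torus_approx_sum => k; apply: torus_approxM; last exact: inv_base.
  exact: (torus_approxX _ diff_approx).
apply: (@torus_approx_perturb _ _ (c0^-1 + C ^+ K / c0 ^+ K.+1) _ ps).
- by rewrite addr_ge0 ?divr_ge0 ?exprn_ge0 ?invr_ge0 // ltW.
- move=> th y Pth; have p0 := lt_le_trans c00 (phi_ge y Pth).
  rewrite gtr0_norm ?invr_gt0 // (@le_trans _ _ c0^-1) //.
    by rewrite lef_pV2 ?posrE ?phi_ge.
  by rewrite lerDl divr_ge0 ?exprn_ge0 // ltW.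
- move=> th y Pth; have [_ _ _ _ h5] := h th Pth.
  have p0 := lt_le_trans c00 (phi_ge y Pth).
  have q0 := lt_le_trans c00 (phi_ge (xb th) Pth).
  set q := phi th (xb th) in h5 q0 *; set z := phi th y in p0 *.
  have -> : z^-1 - \sum_(k < K) (q - z) ^+ k * (1 / q ^+ k.+1) = (q - z) ^+ K * (z^-1 / q ^+ K).
    have := subrXX_comm K (mulrC q (q - z)); rewrite opprB addrCA subrr addr0 => geo.
    have : \sum_(k < K) (q - z) ^+ k * (1 / q ^+ k.+1) = (q ^+ K - (q - z) ^+ K) / (z * q ^+ K).
      rewrite geo mulr_sumr mulr_suml; apply: eq_bigr => k _.
      have -> : q ^+ K = q ^+ (K - k.+1) * q ^+ k.+1.
        by rewrite -exprD subnK.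
      have n1 : q ^+ k.+1 != 0 by rewrite expf_neq0 // gt_eqF.
      have n2 : q ^+ (K - k.+1) != 0 by rewrite expf_neq0 // gt_eqF.
      have -> : (K.-1 - k)%N = (K - k.+1)%N by have := ltn_ord k; lia.
      by field; rewrite n1 n2 gt_eqF.
    move=> ->; have n1 : q ^+ K != 0 by rewrite expf_neq0 // gt_eqF.
    by field; rewrite n1 gt_eqF.
  have b1 : `|(q - z) ^+ K| <= C ^+ K * `|y - xb th| ^+ K.
    rewrite normrX -exprMn lerXn2r ?nnegrE ?mulr_ge0 // distrC; exact: h5.
  have b2 : `|z^-1 / q ^+ K| <= (c0 ^+ K.+1)^-1.
    rewrite gtr0_norm ?divr_gt0 ?invr_gt0 ?exprn_gt0 //.
    rewrite -invfM lef_pV2 ?posrE ?mulr_gt0 ?exprn_gt0 // exprS.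
    rewrite ler_pM ?exprn_ge0 ?(ltW c00) ?phi_ge //.
    by rewrite lerXn2r ?nnegrE ?(ltW q0) ?(ltW c00) ?phi_ge.
  rewrite (le_trans (normM_le b1 b2)) // mulrAC ler_wpM2r ?exprn_ge0 //.
  by rewrite lerDr invr_ge0 ltW.
Qed.

Lemma torus_approx_inv_logmean :
  torus_approx (fun th y => (logmean (phi th (xb th)) (phi th y))^-1).
Proof.
have [g [C C0 h]] := hphi.
have ps : torus_approx (fun th y => \sum_(k < K)
    (phi th (xb th) - phi th y) ^+ k * (k.+1%:R^-1 / phi th (xb th) ^+ k.+1)).
  apply: torus_approx_sum => k; apply: torus_approxM; last first.
    by apply: inv_base; rewrite invr_ge0.
  exact: (torus_approxX _ diff_approx).
apply: (@torus_approx_perturb _ _ (c0^-1 + C ^+ K / c0 ^+ K.+1) _ ps).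
- by rewrite addr_ge0 ?divr_ge0 ?exprn_ge0 ?invr_ge0 // ltW.
- move=> th y Pth; have [_ _ h3 _ _] := h th Pth.
  have up z : c0 <= phi th z <= C.
    by rewrite phi_ge //= (le_trans (ler_norm _)).
  have /andP[l1 _] := logmean_between c00 (up (xb th)) (up y).
  have l0 := lt_le_trans c00 l1.
  rewrite gtr0_norm ?invr_gt0 // (@le_trans _ _ c0^-1) //.
    by rewrite lef_pV2 ?posrE.
  by rewrite lerDl divr_ge0 ?exprn_ge0 // ltW.
- move=> th y Pth; have [_ _ _ _ h5] := h th Pth.
  have := inv_logmean_taylor K c00 (phi_ge (xb th) Pth) (phi_ge y Pth).
  have -> : \sum_(k < K) (phi th (xb th) - phi th y) ^+ k / (k.+1%:R * phi th (xb th) ^+ k.+1)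
     = \sum_(k < K) (phi th (xb th) - phi th y) ^+ k * (k.+1%:R^-1 / phi th (xb th) ^+ k.+1).
    by apply: eq_bigr => k _; rewrite invfM.
  move=> /le_trans; apply.
  rewrite (@le_trans _ _ (C ^+ K / c0 ^+ K.+1 * `|y - xb th| ^+ K)) //.
    rewrite mulrAC ler_wpM2r ?invr_ge0 ?exprn_ge0 ?(ltW c00) //.
    by rewrite -exprMn lerXn2r ?nnegrE ?mulr_ge0 // distrC.
  by rewrite ler_wpM2r ?exprn_ge0 // lerDr invr_ge0 ltW.
Qed.
End Positive.

Lemma torus_approx_logmean phi c0 : torus_approx phi -> 0 < c0 ->
  (forall th y, P th -> c0 <= phi th y) ->
  torus_approx (fun th y => logmean (phi th (xb th)) (phi th y)).
Proof.
move=> hphi c00 phi_ge; have hi := torus_approx_inv_logmean hphi c00 phi_ge.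
have [g [C C0 h]] := hphi.
rewrite (_ : (fun th y => _) = fun th y => ((logmean (phi th (xb th)) (phi th y))^-1)^-1); last first.
  by apply/funext => a; apply/funext => b; rewrite invrK.
have Cp : 0 < C + 1 by rewrite ltr_wpDl.
apply: (@torus_approxV _ (C + 1)^-1) => // [|th y Pth]; first by rewrite invr_gt0.
have [_ _ h3 _ _] := h th Pth.
have up z : c0 <= phi th z <= C.
  by rewrite phi_ge //= (le_trans (ler_norm _)).
have /andP[l1 l2] := logmean_between c00 (up (xb th)) (up y).
rewrite lef_pV2 ?posrE // ?(lt_le_trans c00) // (le_trans l2) //.
by rewrite lerDl.
Qed.
End TorusApproximation.

(** * Consistency *)

Section DerivativeComparison.
Variables (R : realType) (V : normedModType R).

(** Turns a quadratic difference bound into a derivative. It is used for the flux, for the entropy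
    and for the entropy variables. *)
Lemma is_derive_second_order (f g : V -> R) x v C : 0 <= C -> derivable g x v ->
  (\forall y \near x, `|f y - f x - (g y - g x)| <= C * `|y - x| ^+ 2) ->
  is_derive x v f ('D_v g x).
Proof.
move=> C0 dg h.
have gl : h^-1 *: ((g \o shift x) (h *: v) - g x) @[h --> 0^'] --> 'D_v g x by exact: dg.
suff fl : h^-1 *: ((f \o shift x) (h *: v) - f x) @[h --> 0^'] --> 'D_v g x.
  by split; [apply/cvg_ex; exists ('D_v g x)|exact: cvg_lim fl].
apply/cvgrPdist_le => e e0; have e2 : 0 < e / 2 by rewrite divr_gt0.
move/cvgrPdist_le : gl => /(_ _ e2) gl.
pose M := C * `|v| ^+ 2 + 1.
have M0 : 0 < M by rewrite ltr_wpDl // mulr_ge0 ?exprn_ge0.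
have n1 : \forall k \near (0 : R)^', `|k| < e / 2 / M by apply: dnbhs0_lt; rewrite divr_gt0.
have n2 : \forall k \near (0 : R)^',
    `|f (k *: v + x) - f x - (g (k *: v + x) - g x)| <= C * `|k *: v + x - x| ^+ 2.
  apply: nbhs_dnbhs.
  have : k *: v + x @[k --> (0 : R)] --> 0 *: v + x.
    by apply: cvgD; [apply: cvgZr_tmp; exact: cvg_id|exact: cvg_cst].
  by rewrite scale0r add0r => /(_ _ h).
near=> k.
have k0 : k != 0 by near: k; exact: nbhs_dnbhs_neq.
have h1 : `|'D_v g x - k^-1 *: (g (k *: v + x) - g x)| <= e / 2 by near: k; exact: gl.
have h2 : `|k| < e / 2 / M by near: k.
have h4 : `|f (k *: v + x) - f x - (g (k *: v + x) - g x)| <= C * `|k *: v + x - x| ^+ 2 by near: k.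
have kv : `|k *: v + x - x| = `|k| * `|v| by rewrite addrK normrZ.
rewrite kv in h4.
set a := f (k *: v + x) - f x in h4 *; set b := g (k *: v + x) - g x in h1 h4 *.
rewrite /= -/a /GRing.scale /= in h1 *.
rewrite (_ : _ - _ = ('D_v g x - k^-1 * b) - k^-1 * (a - b)); last by ring.
rewrite (splitr e) normB_le // normrM normfV.
have kp : 0 < `|k| by rewrite normr_gt0.
rewrite mulrC ler_pdivrMr // (le_trans h4) //.
have : `|k| * M <= e / 2 by rewrite -ler_pdivlMr // ltW.
move=> h5; have := ler_wpM2r (ltW kp) h5; rewrite /M.
have := mulr_ge0 (ltW kp) (ltW kp).
by rewrite exprMn; move: (`|v|) => w; rewrite expr2; nra.
Unshelve. all: by end_near. Qed.
End DerivativeComparison.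

Section Consistency.
Variables (R : realType) (d p : nat) (gamma L T r0 P0 B : R)
  (u : R -> 'rV[R]_d -> state R d).
Hypotheses (hg : 1 < gamma) (L0 : 0 < L) (T0 : 0 < T) (r00 : 0 < r0) (P00 : 0 < P0).
Hypothesis p0 : (0 < p)%N.
Hypothesis hu : Ck_tx L T p.+1 u.
Local Notation S := (good_states gamma r0 P0 B).
Hypothesis uS : forall t x, 0 <= t <= T -> S (u t x).

Let g0 : 0 < gamma - 1.
Proof. by rewrite subr_gt0. Qed.

Local Notation Th := (R * 'rV[R]_d)%type.
Let P : set Th := [set th | 0 <= th.1 <= T].
Let xb : Th -> 'rV[R]_d := snd.
Local Notation approx := (torus_approx L P xb p.+1).

Let approx_cst (c : R) : approx (fun _ _ => c).
Proof. by apply: (@torus_approx_cst _ _ _ _ _ _ _ _ (fun=> c) `|c|). Qed.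

Lemma approx_coord o : approx (fun th y => state_coord o (u th.1 y)).
Proof.
have [C C0 hC] := Ck_tx_bounded L0 (ltW T0) hu.
apply: (@torus_approx_Ck _ _ _ _ _ _ _ _ _ C) => // th Pth; split.
  by move=> m x; have [pu _] := hu; rewrite pu.
have -> : (fun y => state_coord o (u th.1 y)) = fun y => u th.1 y ord0 (state_index o).
  by apply/funext => y; rewrite state_coordE.
exact: hC.
Qed.

Lemma approx_rho : approx (fun th y => rho (u th.1 y)).
Proof. exact: (approx_coord None). Qed.

Lemma u_rho th y : P th -> r0 <= rho (u th.1 y).
Proof. by move=> Pth; have [] := uS y Pth. Qed.

Lemma approx_velc k : approx (fun th y => velc (u th.1 y) k).
Proof.
under eq_fun do under eq_fun do rewrite velcE.
apply: torus_approxM; first exact: (approx_coord (Some (Some k))).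
exact: (torus_approxV _ approx_rho r00 u_rho).
Qed.

Lemma approx_pressure : approx (fun th y => pressure gamma (u th.1 y)).
Proof.
rewrite (_ : (fun th y => _) = fun (th : Th) y => (gamma - 1) * (energy (u th.1 y) -
    rho (u th.1 y) * vdot (velc (u th.1 y)) (velc (u th.1 y)) * 2^-1)); last first.
  by apply/funext => th; apply/funext => y; rewrite pressure_vdot.
have he : approx (fun th y => energy (u th.1 y)) by exact: (approx_coord (Some None)).
have hv : approx (fun th y => vdot (velc (u th.1 y)) (velc (u th.1 y))).
  by apply: torus_approx_sum => // k; apply: torus_approxM; exact: approx_velc.
exact: (torus_approxM (approx_cst _) (torus_approxB (ltn0Sn p) he
  (torus_approxM (torus_approxM approx_rho hv) (approx_cst _)))).
Qed.

Lemma u_pressure th y : P th -> P0 <= pressure gamma (u th.1 y).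
Proof. by move=> Pth; have [] := uS y Pth. Qed.

Lemma approx_beta : approx (fun th y => beta gamma (u th.1 y)).
Proof.
apply: torus_approxM; first exact: approx_rho.
exact: (torus_approxV _ approx_pressure P00 u_pressure).
Qed.

Lemma approx_fnum m o :
  approx (fun th y => state_coord o (fnum gamma m (u th.1 th.2) (u th.1 y))).
Proof.
have fixed (f : state R d -> R) : approx (fun th y => f (u th.1 y)) ->
    approx (fun th y => f (u th.1 th.2)) by exact: torus_approx_at.
have average (f : state R d -> R) : approx (fun th y => f (u th.1 y)) ->
    approx (fun th y => avg (f (u th.1 th.2)) (f (u th.1 y))).
  move=> hf; apply: torus_approxM; last exact: approx_cst.
  by apply: torus_approxD => //; exact: fixed.
have hfr : approx (fun th y => frho m (u th.1 th.2) (u th.1 y)).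
  apply: torus_approxM; last exact: (average (fun a => velc a m) (approx_velc m)).
  exact: (torus_approx_logmean _ approx_rho r00 u_rho).
case: o => [[k|]|] /=.
- under eq_fun do under eq_fun do rewrite mom_fnum.
  apply: torus_approxD; apply: torus_approxM => //.
  + exact: (average (fun a => velc a k) (approx_velc k)).
  + exact: (average _ approx_pressure).
- under eq_fun do under eq_fun do rewrite energy_fnum.
  apply: torus_approxD; first apply: torus_approxD.
  + apply: torus_approxM => //; apply: torus_approxM; first exact: approx_cst.
    apply: torus_approx_sum => // k; apply: torus_approxM; last exact: approx_velc.
    exact: (fixed (fun a => velc a k) (approx_velc k)).
  + apply: torus_approxM => //.
    have [b0 b00 hb] := @beta_ge R d gamma r0 P0 B r00 P00.
    have ub th y : P th -> b0 <= beta gamma (u th.1 y) by move=> Pth; apply: hb; exact: uS.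
    have lb := torus_approx_logmean (ltn0Sn p) approx_beta b00 ub.
    apply: (@torus_approxV _ _ _ _ _ _ _ (ltn0Sn p) _ ((gamma - 1) * b0)).
    * by apply: torus_approxM => //; exact: approx_cst.
    * by rewrite mulr_gt0.
    * move=> th y Pth; rewrite ler_pM2l //.
      have [g [C C0 h]] := approx_beta.
      have hC th' y' : P th' -> beta gamma (u th'.1 y') <= C.
        by move=> Pth'; rewrite (le_trans (ler_norm _)) //; have [] := h th' Pth'.
      have up z : b0 <= beta gamma (u th.1 z) <= C by rewrite ub // hC.
      by case/andP: (logmean_between b00 (up th.2) (up y)).
  + apply: torus_approxM; last exact: approx_cst.
    apply: torus_approxD; apply: torus_approxM; try exact: approx_velc.
    * exact: (fixed _ approx_pressure).
    * exact: approx_pressure.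
    * exact: (fixed (fun a => velc a m) (approx_velc m)).
- by under eq_fun do under eq_fun do rewrite rho_fnum.
Qed.

Lemma u_lipschitz : exists2 C, 0 <= C & forall t x y, 0 <= t <= T ->
  `|u t y - u t x| <= C * `|y - x|.
Proof.
have [C C0 hC] := Ck_tx_bounded L0 (ltW T0) hu.
exists (C * d%:R); first by rewrite mulr_ge0.
move=> t x y tT; apply: state_norm_le => [|o]; first by rewrite !mulr_ge0.
rewrite state_coordE mxE mxE.
apply: (@Ck_bounded_lipschitz _ _ _ (fun z => u t z ord0 (state_index o))).
have := hC t (state_index o) tT; elim: (p) => // n IH h.
by apply: IH; exact: Ck_bounded_pred.
Qed.

(** By consistency and symmetry of the two-point flux [f], [f(y, y) - f(x, x)] equals
    [2 (f(x, y) - f(x, x))] plus a mixed second difference, which is quadratic in [y - x]. This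
    explains the factor 2, here and in the scheme. *)
Lemma euler_flux_derive m o : exists g : Th -> 'rV[R]_d -> R, exists2 C, 0 <= C &
  forall th, P th ->
  [/\ Defs.periodic L (g th), Ck_bounded p.+1 C (g th),
      (forall y, `|state_coord o (fnum gamma m (u th.1 th.2) (u th.1 y)) - g th y|
         <= C * `|y - th.2| ^+ p.+1) &
      is_derive th.2 (evec m) (fun y => state_coord o (euler_flux gamma m (u th.1 y)))
        (2 * 'D_(evec m) (g th) th.2)].
Proof.
have [g [C C0 h]] := approx_fnum m o.
have [CL CL0 hL] := u_lipschitz.
have [CX CX0 hX] := @fnum_cross_bound R d gamma hg r0 P0 B r00 P00.
exists g, C => // th Pth; have [h1 h2 h3 h4 h5] := h th Pth; split => //.
set x := th.2 in h4 h5 *; set v := u th.1.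
have dg : derivable (g th) x (evec m) by case: h2 => _ _ /(_ m)[].
have dg2 : derivable (fun y => 2 * g th y) x (evec m).
  exact: (derivableM (derivable_cst (2 : R) x (evec m)) dg).
have -> : 2 * 'D_(evec m) (g th) x = 'D_(evec m) (fun y => 2 * g th y) x.
  by symmetry; exact: (@deriveZ _ _ _ (g th) 2 x (evec m) dg).
apply: (@is_derive_second_order _ _ _ _ _ _ (2 * C + CX * CL ^+ 2)) => //.
  by rewrite addr_ge0 // mulr_ge0 // exprn_ge0.
have near1 : \forall y \near x, `|x - y| <= 1.
  by have /cvgrPdist_le := @cvg_id _ (nbhs x); apply.
apply: filterS near1 => y; rewrite distrC => y1.
have [Sx Sy] : S (v x) /\ S (v y) by split; exact: uS.
rewrite -(fnum_diag hg m (good_admissible r00 P00 Sy)) -(fnum_diag hg m (good_admissible r00 P00 Sx)).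
have [_ _ hc] := hX m (v x) (v y) (v x) (v y) Sx Sy Sx Sy.
have hLy := hL th.1 x y Pth; rewrite -/v in hLy.
have hc2 : `|state_coord o (fnum gamma m (v y) (v y)) - state_coord o (fnum gamma m (v y) (v x))
    - state_coord o (fnum gamma m (v x) (v y)) + state_coord o (fnum gamma m (v x) (v x))|
    <= CX * CL ^+ 2 * `|y - x| ^+ 2.
  rewrite -!linearB -linearD (le_trans (state_norm_coord _ _)) // (le_trans hc) //.
  rewrite -mulrA ler_wpM2l // -exprMn expr2; exact: ler_pM.
move: hc2; rewrite (fnumC gamma m (v y) (v x)) => hc2.
have hgx : state_coord o (fnum gamma m (v x) (v x)) = g th x.
  by apply/eqP; rewrite -subr_eq0 -normr_le0 (le_trans (h4 x)) // subrr normr0 expr0n mulr0.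
have hgy : `|state_coord o (fnum gamma m (v x) (v y)) - g th y| <= C * `|y - x| ^+ 2.
  rewrite (le_trans (h4 y)) // ler_wpM2l //.
  by apply: ler_wiXn2l; rewrite ?normr_ge0 // ltnS.
rewrite (_ : _ - _ = (state_coord o (fnum gamma m (v y) (v y)) - state_coord o (fnum gamma m (v x) (v y))
    - state_coord o (fnum gamma m (v x) (v y)) + state_coord o (fnum gamma m (v x) (v x)))
    + 2 * (state_coord o (fnum gamma m (v x) (v y)) - g th y)).
  rewrite (le_trans (normD_le hc2 (normM_le (lexx _) hgy))) // ger0_norm //.
  by rewrite le_eqVlt; apply/orP; left; apply/eqP; ring.
by rewrite -hgx; ring.
Qed.

Lemma mass_diff_op (D : discretization R d) m (f : 'rV[R]_d -> R) i :
  (forall i, 0 < mass D ord0 i) ->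
  mass D ord0 i * (diff_op D m *m grid_fun D f) i ord0 =
  \sum_j stiff D m i j * f (node j).
Proof.
move=> m0.
have un : diag_mx (mass D) \in unitmx.
  rewrite unitmxE det_diag unitfE; apply/prodf_neq0 => j _.
  by rewrite gt_eqF.
have : diag_mx (mass D) *m (diff_op D m *m grid_fun D f) = stiff D m *m grid_fun D f.
  by rewrite /diff_op !mulmxA mulmxV // mul1mx.
move/matrixP => /(_ i ord0); rewrite mul_diag_mx mxE => ->.
by rewrite mxE; apply: eq_bigr => j _; rewrite mxE.
Qed.

(** Passing to [2 * r] yields a lattice translate without showing that the infimum in [dper] is
    attained. *)
Lemma stencil_translate (x y : 'rV[R]_d) r : 0 < r -> dper L x y <= r ->
  exists k : 'rV[int]_d, `|y + L *: map_mx intr k - x| <= 2 * r.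
Proof.
move=> r0' hxy.
have : inf [set enorm (x - y + L *: map_mx intr k) | k in [set: 'rV[int]_d]] < 2 * r.
  by rewrite (le_lt_trans hxy) // ltr_pMl // ltr1n.
move=> /inf_lt [|_ [k _ <-] h].
  by exists (enorm (x - y + L *: map_mx intr 0)); exists 0.
exists (- k).
have E : `|y + L *: map_mx intr (- k) - x| = `|x - y + L *: map_mx intr k|.
  rewrite -normrN; congr (`|_|); apply/rowP => j; rewrite !mxE mulrNz; ring.
rewrite E (le_trans _ (ltW h)) //.
rewrite [X in X <= _]/Num.Def.normr /= mx_normrE; apply: bigmax_le; first exact: enorm_ge0.
move=> [i j] _ /=; rewrite (ord1 i) /enorm -sqrtr_sqr ler_sqrt; last first.
  by apply: sumr_ge0 => l _; exact: sqr_ge0.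
by rewrite (bigD1 j) //= lerDl sumr_ge0 // => l _; exact: sqr_ge0.
Qed.

(** SBP accuracy is applied to the smooth periodic approximant [g], and replacing the flux by [g] on
    the stencil costs an error of the same order. *)
Lemma flux_consistency (F : set (discretization R d)) :
  sbp_family L p F -> fixed_local_stencil L F ->
  exists2 C, 0 <= C & forall D, F D -> forall t m i, 0 <= t <= T ->
    `|2 *: (\sum_j stiff D m i j *: fnum gamma m (u t (node i)) (u t (node j)))
      - mass D ord0 i *: 'D_(evec m) (fun y => euler_flux gamma m (u t y)) (node i)|
    <= C * (mass D ord0 i * mesh D ^+ p).
Proof.
move=> [cM [CM [cN [CN [CD [[cM0 CM0 cN0 CN0 CD0] hF]]]]]].
move=> [om [Cq [kap [om0 Cq0 hS]]]].
pose Q (mo : 'I_d * option (option 'I_d)) C := 0 <= C /\ forall D, F D -> forall t i, 0 <= t <= T ->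
  `|2 * (\sum_j stiff D mo.1 i j * state_coord mo.2 (fnum gamma mo.1 (u t (node i)) (u t (node j))))
    - mass D ord0 i * state_coord mo.2 ('D_(evec mo.1) (fun y => euler_flux gamma mo.1 (u t y)) (node i))|
  <= C * (mass D ord0 i * mesh D ^+ p).
suff [C hC] : {C : 'I_d * option (option 'I_d) -> R & forall mo, Q mo (C mo)}.
  have C0 mo : 0 <= C mo by have [] := hC mo.
  exists (\sum_mo C mo) => [|D FD t m i tT]; first exact: sumr_ge0.
  have [h0 hm _ _ _] := hF D FD.
  have m0 : 0 <= mass D ord0 i * mesh D ^+ p.
    rewrite mulr_ge0 ?exprn_ge0 ?(ltW h0) //; have /andP[h _] := hm.1 i.
    by rewrite (le_trans _ h) // mulr_ge0 ?exprn_ge0 // ltW.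
  apply: state_norm_le => [|o]; first by rewrite mulr_ge0 ?sumr_ge0.
  have [_ h] := hC (m, o); have {h} := h D FD t i tT; rewrite /=.
  set X := 'D_(evec m) _ _ => h.
  have -> : state_coord o (2 *: (\sum_j stiff D m i j *: fnum gamma m (u t (node i)) (u t (node j)))
      - mass D ord0 i *: X) =
    2 * (\sum_j stiff D m i j * state_coord o (fnum gamma m (u t (node i)) (u t (node j))))
      - mass D ord0 i * state_coord o X.
    rewrite linearB; congr (_ - _); last by rewrite linearZ.
    rewrite linearZ linear_sum /=; congr (2 * _).
    by apply: eq_bigr => j _; rewrite linearZ.
  apply: (le_trans h); rewrite ler_wpM2r //.
  by rewrite (bigD1 (m, o)) //= lerDl sumr_ge0.
apply: choice => -[m o]; rewrite /Q /=.
have [g [C C0 hg1]] := euler_flux_derive m o.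
pose K := 2 * (kap%:R * (Cq * (C * (2 * om) ^+ p.+1)) / cM + CD * C).
have K0 : 0 <= K.
  rewrite mulr_ge0 // addr_ge0 ?mulr_ge0 ?invr_ge0 ?exprn_ge0 ?mulr_ge0 //; exact: ltW.
exists K; split => // D FD t i tT.
have [h0 [hm _] _ _ hacc] := hF D FD.
have [hst hkap hq] := hS D FD m.
have hp0 : 0 < mesh D ^+ p by rewrite exprn_gt0.
have mass0 j : 0 < mass D ord0 j.
  by have /andP[h _] := hm j; rewrite (lt_le_trans _ h) // mulr_gt0 // exprn_gt0.
have := hg1 (t, node i) tT; set gt := g (t, node i); rewrite /=.
move=> [per Ckg happ hder].
have {}Ckg : Ck_bounded p.+1 C gt by exact: Ckg.
have comp k : derivable (fun y => state_coord k (euler_flux gamma m (u t y))) (node i) (evec m).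
  have [g' [C' _ hg']] := euler_flux_derive m k.
  by have [_ _ _ []] := hg' (t, node i) tT.
have dflux : state_coord o ('D_(evec m) (fun y => euler_flux gamma m (u t y)) (node i)) =
    2 * 'D_(evec m) gt (node i).
  have df : derivable (fun y => euler_flux gamma m (u t y)) (node i) (evec m).
    apply/derivable_mxP => i' j; rewrite (ord1 i').
    have [k ->] := state_index_sur j; have := comp k.
    by under eq_fun do rewrite state_coordE.
  rewrite state_coordE (derive_mx df) mxE; have [_ <-] := hder.
  by under [in RHS]eq_fun do rewrite state_coordE.
rewrite dflux.
have acc := hacc gt (@Ck_bounded_torus _ _ L p.+1 C gt per Ckg) m i.
have accC : `|(diff_op D m *m grid_fun D gt) i ord0 - 'D_(evec m) gt (node i)| <= CD * mesh D ^+ p * C.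
  rewrite (le_trans acc) // ler_wpM2l ?mulr_ge0 ?exprn_ge0 ?(ltW CD0) ?(ltW h0) //.
  exact: (@Ck_bounded_norm _ _ p.+1 C gt C0 Ckg).
(* At most [kap] entries of size [h^(d-1)] meet an error of size [h^(p+1)], in total [h^(d+p)], and
   [h^d] is at most [m_i / cM]. *)
have tail : `|\sum_j stiff D m i j * (state_coord o (fnum gamma m (u t (node i)) (u t (node j))) - gt (node j))|
    <= kap%:R * (Cq * (C * (2 * om) ^+ p.+1)) / cM * (mass D ord0 i * mesh D ^+ p).
  have bound j : `|stiff D m i j * (state_coord o (fnum gamma m (u t (node i)) (u t (node j))) - gt (node j))|
     <= if stiff D m i j != 0 then Cq * mesh D ^+ d.-1 * (C * (2 * (om * mesh D)) ^+ p.+1) else 0.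
    case: eqVneq => [->|nz]; first by rewrite mul0r normr0.
    apply: normM_le; first exact: hq.
    have omh : 0 < om * mesh D by rewrite mulr_gt0.
    have [k hk] := stencil_translate omh (hst i j nz).
    have := happ (node j + L *: map_mx intr k).
    rewrite (periodic_lattice _ _ per) (periodic_lattice _ _ (hu.1 t tT)).
    by move=> /le_trans; apply; rewrite ler_wpM2l // lerXn2r ?nnegrE // mulr_ge0 // ltW.
  have S1 := le_trans (ler_norm_sum _ _ _) (ler_sum _ (fun j _ => bound j)).
  apply: (le_trans (S1 (index_enum _) xpredT)); rewrite -big_mkcond /= sumr_const -[X in X <= _]mulr_natl.
  have E : (2 * (om * mesh D)) ^+ p.+1 = (2 * om) ^+ p.+1 * (mesh D * mesh D ^+ p).
    by rewrite mulrA exprMn -[mesh D * _]exprS.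
  set cnt := (#|_|)%N.
  have card : (cnt <= kap)%N by apply: leq_trans (hkap i); rewrite cardsE.
  rewrite E; have c1 : cnt%:R <= kap%:R :> R by rewrite ler_nat.
  have mi : cM * mesh D ^+ d <= mass D ord0 i by have /andP[] := hm i.
  (* A direction [m : 'I_d] exists, so [d] is positive and the truncated predecessor is the true
     one. *)
  have hd : mesh D ^+ d.-1 * mesh D = mesh D ^+ d.
    by rewrite -exprSr (ltn_predK (ltn_ord m)).
  pose Z := Cq * (C * (2 * om) ^+ p.+1).
  have Z0 : 0 <= Z by rewrite /Z !mulr_ge0 ?exprn_ge0 ?mulr_ge0 // ltW.
  rewrite (_ : _ * (_ * _) = cnt%:R * (Z * (mesh D ^+ d.-1 * mesh D) * mesh D ^+ p)); last first.
    by rewrite /Z; ring.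
  rewrite (@le_trans _ _ (kap%:R * (Z * (mass D ord0 i / cM) * mesh D ^+ p))) //.
    apply: ler_pM => //; first by rewrite mulr_ge0 ?(ltW hp0) // mulr_ge0 // hd exprn_ge0 // ltW.
    rewrite ler_wpM2r ?(ltW hp0) // ler_wpM2l // hd.
    by rewrite ler_pdivlMr // mulrC.
  by rewrite /Z le_eqVlt; apply/orP; left; apply/eqP; ring.
have main : \sum_j stiff D m i j * gt (node j) = mass D ord0 i * (diff_op D m *m grid_fun D gt) i ord0.
  by rewrite mass_diff_op.
rewrite (_ : _ - _ = 2 * ((\sum_j stiff D m i j *
     (state_coord o (fnum gamma m (u t (node i)) (u t (node j))) - gt (node j)))
   + mass D ord0 i * ((diff_op D m *m grid_fun D gt) i ord0 - 'D_(evec m) gt (node i)))); last first.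
  rewrite mulrBr -main.
  have -> : \sum_j stiff D m i j * (state_coord o (fnum gamma m (u t (node i)) (u t (node j))) - gt (node j))
    = \sum_j stiff D m i j * state_coord o (fnum gamma m (u t (node i)) (u t (node j)))
      - \sum_j stiff D m i j * gt (node j).
    by rewrite -sumrB; apply: eq_bigr => j _; rewrite mulrBr.
  ring.
rewrite normrM (ger0_norm (ler0n R 2)) /K -[2 * _ * _]mulrA ler_wpM2l //.
have t2 := normM_le (lexx `|mass D ord0 i|) accC.
rewrite (le_trans (normD_le tail t2)) // gtr0_norm // [X in _ <= X]mulrDl lerD2l.
by rewrite le_eqVlt; apply/orP; left; apply/eqP; ring.
Qed.
End Consistency.

(** * Bounds on the entropy Hessian *)

Lemma nbhs_cvg_sum (R : realType) (V : topologicalType) (I : Type) (r : seq I)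
    (f : I -> V -> R) (x : V) (l : I -> R) : (forall i, f i y @[y --> x] --> l i) ->
  \sum_(i <- r) f i y @[y --> x] --> \sum_(i <- r) l i.
Proof. by move=> h; apply: cvg_big => [|i _]; [exact: add_continuous|exact: h]. Qed.

Section HessianBounds.
Variables (R : realType) (d : nat) (gamma : R).
Hypothesis hg : 1 < gamma.
Implicit Types (a b x y v : state R d).

(** Relaxing the constants gives a full neighbourhood, so that the quadratic bounds can be turned
    into derivatives. *)
Lemma near_good_states (r0 P0 B : R) a : 0 < r0 -> 0 < P0 ->
  good_states gamma r0 P0 B a ->
  \forall b \near a, good_states gamma (r0 / 2) (P0 / 2) (B + 1) b.
Proof.
move=> r00 P00 [ra pa aB].
have cr : continuous (@rho R d) by exact: (@state_coord_continuous _ _ None).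
have ra0 : rho a != 0 by rewrite gt_eqF // (lt_le_trans r00).
have cv k : velc b k @[b --> a] --> velc a k.
  rewrite velcE; under eq_fun do rewrite velcE.
  have cm : mom b ord0 k @[b --> a] --> mom a ord0 k.
    exact: (@state_coord_continuous _ _ (Some (Some k)) a).
  exact: cvgM cm (cvgV ra0 (cr a)).
have cp : pressure gamma b @[b --> a] --> pressure gamma a.
  rewrite pressure_vdot; under eq_fun do rewrite pressure_vdot.
  have ce : energy b @[b --> a] --> energy a by exact: (@state_coord_continuous _ _ (Some None) a).
  have cvv : vdot (velc b) (velc b) @[b --> a] --> vdot (velc a) (velc a).
    by apply: nbhs_cvg_sum => k; exact: cvgM (cv k) (cv k).
  have h1 : rho b * vdot (velc b) (velc b) @[b --> a] --> rho a * vdot (velc a) (velc a).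
    exact: cvgM (cr a) cvv.
  have h2 : rho b * vdot (velc b) (velc b) / 2 @[b --> a] --> rho a * vdot (velc a) (velc a) / 2.
    exact: cvgMr_tmp h1.
  have h3 : energy b - rho b * vdot (velc b) (velc b) / 2 @[b --> a] -->
      energy a - rho a * vdot (velc a) (velc a) / 2 by exact: cvgB ce h2.
  exact: cvgMl_tmp h3.
near=> b; split.
- near: b; apply: (cvgr_ge (rho a) (cr a)); rewrite (lt_le_trans _ ra) //.
  by rewrite ltr_pdivrMr // ltr_pMr // ltr1n.
- near: b; apply: (cvgr_ge _ cp); rewrite (lt_le_trans _ pa) //.
  by rewrite ltr_pdivrMr // ltr_pMr // ltr1n.
- near: b; apply: (cvgr_le _ (cvg_norm (@cvg_id _ (nbhs a)))).
  by rewrite (le_lt_trans aB) // ltrDl.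
Unshelve. all: by end_near. Qed.

Lemma admissible_good a : admissible gamma a ->
  good_states gamma (rho a) (pressure gamma a) `|a| a.
Proof. by []. Qed.

Lemma near_admissible a : admissible gamma a -> \forall b \near a, admissible gamma b.
Proof.
move=> [r0 P0]; have := near_good_states r0 P0 (admissible_good (conj r0 P0)).
apply: filterS => b; apply: good_admissible; exact: divr_gt0.
Qed.

Lemma is_derive_sdot x a v : is_derive a v (sdot x : state R d -> R) (sdot x v).
Proof.
have fl : h^-1 *: ((sdot x \o shift a) (h *: v) - sdot x a) @[h --> (0 : R)^'] --> sdot x v.
  have fc : (fun=> sdot x v) h @[h --> (0 : R)^'] --> sdot x v by exact: cvg_cst.
  refine (cvg_trans _ fc).
  apply: near_eq_cvg; near=> h => /=.
  have h0 : h != 0 by near: h; exact: nbhs_dnbhs_neq.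
  by rewrite sdotDr addrK sdotZr scalerA mulVf // scale1r.
by split; [apply/cvg_ex; exists (sdot x v)|exact: cvg_lim fl].
Unshelve. all: by end_near. Qed.

(** The relative entropy is the first-order Taylor remainder of the entropy, and [rel_entropy_upper]
    bounds it quadratically. *)
Lemma is_derive_entropy a v : admissible gamma a ->
  is_derive a v (entropy gamma) (sdot (evar gamma a) v).
Proof.
move=> adm; have [r0 P0] := adm.
have [r2 P2] : 0 < rho a / 2 /\ 0 < pressure gamma a / 2 by split; exact: divr_gt0.
have [C C0 hC] := @rel_entropy_upper R d gamma hg _ _ (`|a| + 1) r2 P2.
have near_good := near_good_states r0 P0 (admissible_good adm).
have Sa := nbhs_singleton near_good.
have E b : admissible gamma b -> entropy gamma b = phys_entropy gamma b.
  by move=> [rb Pb]; rewrite entropyE.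
have <- : 'D_v (sdot (evar gamma a)) a = sdot (evar gamma a) v.
  by have [_ ->] := is_derive_sdot (evar gamma a) a v.
apply: (@is_derive_second_order _ _ _ _ _ _ C) => //.
  by have [] := is_derive_sdot (evar gamma a) a v.
apply: filterS near_good => b Sb.
have := hC b a Sb Sa; rewrite /rel_entropy -sdotBr (E _ adm) E //.
exact: good_admissible Sb.
Qed.

Lemma is_derive_evar a x v : admissible gamma a ->
  is_derive a v (fun b => sdot (evar gamma b) x) (sdot (devar gamma a x) v).
Proof.
move=> adm; have [r0 P0] := adm.
have [r2 P2] : 0 < rho a / 2 /\ 0 < pressure gamma a / 2 by split; exact: divr_gt0.
have [C C0 hC] := @evar_quadratic R d gamma hg _ _ (`|a| + 1) r2 P2.
have near_good := near_good_states r0 P0 (admissible_good adm).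
have Sa := nbhs_singleton near_good.
have <- : 'D_v (sdot (devar gamma a x)) a = sdot (devar gamma a x) v.
  by have [_ ->] := is_derive_sdot (devar gamma a x) a v.
apply: (@is_derive_second_order _ _ _ _ _ _ (C * `|x|)); first exact: mulr_ge0.
  by have [] := is_derive_sdot (devar gamma a x) a v.
apply: filterS near_good => b Sb.
have := hC b a x Sb Sa; rewrite -sdotBr -sdotBl => /le_trans; apply.
by rewrite [`|b - a| ^+ 2 * _]mulrC mulrA.
Qed.

Lemma entropy_hessianE a v : admissible gamma a ->
  (v *m entropy_hessian gamma a *m v^T) ord0 ord0 = sdot (devar gamma a v) v.
Proof.
move=> adm.
have sdot_evec x (j : 'I_(1 + (d + 1))) : sdot x (evec j) = x ord0 j.
  rewrite sdotE (bigD1 j) //= big1 => [|i ij]; rewrite /evec mxE eqxx /=.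
    by rewrite eqxx mulr1 addr0.
  by rewrite (negbTE ij) mulr0.
have hess i j : entropy_hessian gamma a i j = sdot (devar gamma a (evec j)) (evec i).
  rewrite mxE.
  have [_ <-] := is_derive_evar (evec j) (evec i) adm.
  (* The inner derivative is known at admissible points only, which suffices because they fill a
     neighbourhood of [a]. *)
  apply: near_eq_derive => //; near=> b.
  have admb : admissible gamma b by near: b; exact: near_admissible.
  by have [_ ->] := is_derive_entropy (evec j) admb.
(* Linearity of [devar] in its direction is inherited, through the derivative, from linearity of
   [sdot]. *)
have expand x : sdot (devar gamma a v) x = \sum_j v ord0 j * sdot (devar gamma a (evec j)) x.
  have [_ <-] := is_derive_evar v x adm.
  have df j := is_derive_evar (evec j) x adm.
  have E : (fun b => sdot (evar gamma b) v) =
      \sum_j (v ord0 j *: (fun b => sdot (evar gamma b) (evec j))).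
    apply/funext => b; rewrite fct_sumE sdotE; apply: eq_bigr => j _.
    by rewrite -sdot_evec mulrC.
  rewrite E; apply: (etrans (derive_sum _)) => [j|].
    by apply: derivableZ; have [] := df j.
  apply: eq_bigr => j _; rewrite deriveZ; last by have [] := df j.
  by have [_ ->] := df j.
rewrite expand mxE; apply: eq_bigr => j _.
rewrite [v^T _ _]mxE mulrC; congr (_ * _).
rewrite mxE sdotE; apply: eq_bigr => i _.
by rewrite hess sdot_evec mulrC.
Unshelve. all: by end_near. Qed.

(** For [b = a + t v] the product [(w(b) - w(a)).(b - a)] is the sum of both relative entropies,
    hence at least [2 c |b - a|^2], and the Lipschitz bound on [w] limits it from above. For small
    [t] it differs little from [t^2] times the Hessian form. *)
Lemma hessian_bounds_good (r0 P0 B : R) (K : set (state R d)) : 0 < r0 -> 0 < P0 ->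
  K `<=` good_states gamma r0 P0 B -> exists cU CU, hessian_bounds gamma K cU CU.
Proof.
move=> r00 P00 KS.
have [r2 P2] : 0 < r0 / 2 /\ 0 < P0 / 2 by split; exact: divr_gt0.
have [Cq Cq0 hq] := @evar_quadratic R d gamma hg _ _ (B + 1) r2 P2.
have [Cl Cl0 hl] := @evar_lipschitz R d gamma _ _ (B + 1) r2 P2.
have [c c0 hc] := @rel_entropy_lower R d gamma hg _ _ (B + 1) r2 P2.
have key a v : good_states gamma r0 P0 B a -> c * `|v| ^+ 2 <= sdot (devar gamma a v) v
    <= (sdim R d * Cl + c) * `|v| ^+ 2.
  move=> Sa; set q := sdot _ v.
  have near_good := near_good_states r00 P00 Sa.
  have Sa' := nbhs_singleton near_good.
  have nt : \forall t \near (0 : R)^',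
      good_states gamma (r0 / 2) (P0 / 2) (B + 1) (t *: v + a).
    apply: nbhs_dnbhs.
    have : t *: v + a @[t --> (0 : R)] --> 0 *: v + a.
      by apply: cvgD; [apply: cvgZr_tmp; exact: cvg_id|exact: cvg_cst].
    by rewrite scale0r add0r => /(_ _ near_good).
  have M0 : 0 < Cq * `|v| + 1 by rewrite ltr_wpDl // mulr_ge0.
  (* At this size of [t] the Taylor error consumes at most [c] of the constant [2 c] in the lower
     bound. *)
  have nt2 : \forall t \near (0 : R)^', `|t| < c / (Cq * `|v| + 1).
    by apply: dnbhs0_lt; rewrite divr_gt0.
  have [t [t0 St ht]] : exists t : R, [/\ t != 0,
      good_states gamma (r0 / 2) (P0 / 2) (B + 1) (t *: v + a) & `|t| < c / (Cq * `|v| + 1)].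
    apply: (@filter_ex _ (0 : R)^'); near=> t; split; near: t => //.
    exact: nbhs_dnbhs_neq.
  have h1 := hq _ _ v St Sa'; have h2 := hl _ _ St Sa'.
  have h3 := hc _ _ St Sa'; have h4 := hc _ _ Sa' St.
  set X := sdot (evar gamma (t *: v + a) - evar gamma a) v in h1.
  rewrite addrK sdotZr -/q normrZ in h1 h2 h3.
  rewrite distrC addrK normrZ in h4.
  have tX : c * (`|t| * `|v|) ^+ 2 + c * (`|t| * `|v|) ^+ 2 <= t * X.
    rewrite (le_trans (lerD h3 h4)) // /rel_entropy /X -sdotZr.
    set b := t *: v + a; have -> : t *: v = b - a by rewrite addrK.
    rewrite !sdotBl !sdotBr.
    by rewrite le_eqVlt; apply/orP; left; apply/eqP; ring.
  have aX : `|X| <= sdim R d * (Cl * (`|t| * `|v|) * `|v|).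
    by rewrite (le_trans (sdot_norm _ _)) // ler_pM2l ?sdim_gt0 // ler_wpM2r.
  have tC : `|t| * (Cq * `|v|) <= c.
    rewrite (@le_trans _ _ (`|t| * (Cq * `|v| + 1))) //.
      by rewrite ler_wpM2l // lerDl.
    by rewrite -ler_pdivlMr // ltW.
  have tt : 0 < `|t| ^+ 2 by rewrite exprn_gt0 // normr_gt0.
  have t2 : t * t = `|t| ^+ 2 by rewrite real_normK ?num_real.
  have diff : `|t * X - `|t| ^+ 2 * q| <= `|t| ^+ 2 * (c * `|v| ^+ 2).
    rewrite -t2 -mulrA -mulrBr normrM.
    rewrite (le_trans (ler_wpM2l (normr_ge0 t) h1)) //.
    rewrite [X in X <= _](_ : _ = `|t| ^+ 2 * ((`|t| * (Cq * `|v|)) * `|v| ^+ 2)); last by ring.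
    by rewrite t2 ler_pM2l // ler_wpM2r // exprn_ge0.
  have tX2 : t * X <= `|t| ^+ 2 * (sdim R d * Cl * `|v| ^+ 2).
    rewrite (le_trans (ler_norm _)) // normrM (le_trans (ler_wpM2l (normr_ge0 t) aX)) //.
    by rewrite le_eqVlt; apply/orP; left; apply/eqP; ring.
  move: diff; rewrite ler_norml => /andP[d1 d2].
  rewrite exprMn in tX.
  rewrite -(ler_pM2l tt) -(ler_pM2l tt (q)) [X in _ && (_ <= X)](_ : _ =
    `|t| ^+ 2 * (sdim R d * Cl * `|v| ^+ 2) + `|t| ^+ 2 * (c * `|v| ^+ 2)); last by ring.
  by apply/andP; split; lra.
(* The division by [sdim] converts the lower bound from the sup norm to the Euclidean norm; the
   upper bound converts without loss. *)
exists (c / sdim R d), (sdim R d * Cl + c); split.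
- by rewrite divr_gt0 // sdim_gt0.
- rewrite ler_pdivrMr ?sdim_gt0 //; have s1 : 1 <= sdim R d by rewrite /sdim ler1n.
  by have := mulr_ge0 (ltW (sdim_gt0 R d)) Cl0; nra.
move=> a Ka v /=; have Sa := KS a Ka.
rewrite entropy_hessianE; last exact: good_admissible Sa.
have /andP[k1 k2] := key a v Sa; apply/andP; split.
  apply: le_trans k1; rewrite -mulrA ler_pM2l // mulrC ler_pdivrMr ?sdim_gt0 //.
  by rewrite mulrC enorm_le_norm.
apply: (le_trans k2); rewrite ler_wpM2l //.
  by rewrite addr_ge0 ?(ltW c0) // mulr_ge0 // ltW // sdim_gt0.
by rewrite lerXn2r ?nnegrE ?norm_le_enorm ?enorm_ge0.
Unshelve. all: by end_near. Qed.

(** A closed ball is convex, so a norm bound on the neighbourhood survives the convex hull and its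
    closure. *)
Lemma Kset_bounded (T rhomin Pmin eps : R) (u : R -> 'rV[R]_d -> state R d) (B : R) :
  (forall t z, 0 <= t <= T -> `|u t z| <= B) ->
  Kset gamma T rhomin Pmin u eps `<=` good_states gamma rhomin Pmin (B + eps).
Proof.
move=> uB a [Ka [ra Pa]]; split => //.
pose A : set (state R d) := [set b | `|b| <= B + eps].
have cA : closed A.
  apply: (@closed_comp _ _ (fun b : state R d => `|b|) [set r | r <= B + eps]) => [b _|].
    exact: norm_continuous.
  exact: closed_le.
suff : convex_hull (solution_nbhd T u eps) `<=` A.
  by move=> /closure_subset /(_ a Ka); rewrite -(closure_id A).1.
apply: smallest_sub => [|b [t [x [tT hb]]]].
  apply/convex_setW => x y; rewrite !inE /A /= => Ax Ay k k0 k1.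
  rewrite inE /conv /= (le_trans (ler_normD _ _)) // !normrZ.
  have o0 : 0 < 1 - k%:num by rewrite subr_gt0.
  rewrite (gtr0_norm k0) (gtr0_norm o0).
  by have := ler_wpM2l (ltW k0) Ax; have := ler_wpM2l (ltW o0) Ay; lra.
rewrite /A /= -(subrK (u t x) b) addrC (le_trans (ler_normD _ _)) //.
by rewrite lerD ?uB // (le_trans (norm_le_enorm _)).
Qed.
End HessianBounds.

(** * Discrete entropy balance *)

Section SkewSum.
Variables (R : realType) (n : nat) (Q : 'M[R]_n).
Hypothesis Qskew : Q + Q^T = 0.
Hypothesis Qrow : Q *m const_mx 1 = 0 :> 'cV[R]_n.
Implicit Types (X Y : 'I_n -> 'I_n -> R) (f g : 'I_n -> R).

Definition stencil_sum X : R := \sum_i \sum_j Q i j * X i j.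

Lemma stencil_sum_ext X Y : (forall i j, X i j = Y i j) -> stencil_sum X = stencil_sum Y.
Proof. by move=> h; apply: eq_bigr => i _; apply: eq_bigr => j _; rewrite h. Qed.

Lemma stencil_sumD X Y : stencil_sum (fun i j => X i j + Y i j) = stencil_sum X + stencil_sum Y.
Proof.
rewrite -big_split; apply: eq_bigr => i _; rewrite -big_split.
by apply: eq_bigr => j _; rewrite mulrDr.
Qed.

Lemma stencil_sumN X : stencil_sum (fun i j => - X i j) = - stencil_sum X.
Proof.
rewrite /stencil_sum -sumrN; apply: eq_bigr => i _; rewrite -sumrN.
by apply: eq_bigr => j _; rewrite mulrN.
Qed.

Lemma stencil_sumB X Y : stencil_sum (fun i j => X i j - Y i j) = stencil_sum X - stencil_sum Y.
Proof. by rewrite stencil_sumD stencil_sumN. Qed.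

Lemma stencil_sumC X : stencil_sum X = - stencil_sum (fun i j => X j i).
Proof.
rewrite /stencil_sum exchange_big /= -sumrN; apply: eq_bigr => i _; rewrite -sumrN.
apply: eq_bigr => j _; rewrite -mulNr; congr (_ * _).
by apply/eqP; rewrite -addr_eq0; move/matrixP : Qskew => /(_ j i); rewrite !mxE => ->.
Qed.

Lemma stencil_sum_l f : stencil_sum (fun i _ => f i) = 0.
Proof.
apply: big1 => i _; rewrite -mulr_suml.
move/matrixP : Qrow => /(_ i ord0); rewrite !mxE.
by under eq_bigr do rewrite mxE mulr1; move=> ->; rewrite mul0r.
Qed.

(** Disposes of the potential differences left by entropy conservation, even when the two arguments
    of the flux come from different families of states. *)
Lemma stencil_sum_diff f g : stencil_sum (fun i j => f i - g j) = 0.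
Proof.
by rewrite stencil_sumB stencil_sum_l sub0r (stencil_sumC (fun _ j => g j)) stencil_sum_l !oppr0.
Qed.
End SkewSum.

Section DiscreteEntropyBalance.
Variables (R : realType) (d n : nat) (gamma : R) (Q : 'M[R]_n).
Hypothesis hg : 1 < gamma.
Hypothesis Qskew : Q + Q^T = 0.
Hypothesis Qrow : Q *m const_mx 1 = 0 :> 'cV[R]_n.
Local Notation S := (stencil_sum Q).

(* Entropy conservation removes every term that is of first order in [Y - U]. *)
Lemma stencil_entropy_balance m (Y U : 'I_n -> state R d) :
  (forall i, admissible gamma (Y i)) -> (forall i, admissible gamma (U i)) ->
  let f := fnum gamma m in
  let w i := evar gamma (Y i) in
  let z i := evar gamma (U i) in
  - (2 * S (fun i j => sdot (w i - z i) (f (Y i) (Y j) - f (U i) (U j)))) =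
  S (fun i j => sdot (z i - z j)
       (f (Y i) (Y j) - f (Y i) (U j) - f (U i) (Y j) + f (U i) (U j)))
  - 2 * S (fun i j => sdot (w i - z i)
       (f (Y i) (U j) - f (U i) (U j) - f (Y i) (U i) + f (U i) (U i))).
Proof.
move=> hY hU f w z.
(* The suffixes [a], [b], [b'], [c] stand for the flux at [(Y, Y)], [(Y, U)], [(U, Y)], [(U, U)];
   the letter [w] or [z] says which entropy variable is paired with it, and a [j] that it is taken
   at the second index. The premises are entropy conservation and index exchange. *)
have arith (wa wja za zja wb zb zjb zb' zjb' wc zc zjc : R) : wa - wja = 0 -> wa = - wja ->
    za = - zja -> zc - zjc = 0 -> wb - zjb = 0 -> zb' = - zjb -> zb = - zjb' ->
    - (2 * (wa - za - (wc - zc))) =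
    za - zja - (zb - zjb) - (zb' - zjb') + (zc - zjc) - 2 * (wb - zb - (wc - zc)) by lra.
pose psi (a : state R d) := rho a * velc a m.
have fC := fnumC gamma m; rewrite -/f in fC.
have ec a b : admissible gamma a -> admissible gamma b ->
    sdot (evar gamma a) (f a b) - sdot (evar gamma b) (f a b) = psi a - psi b.
  by move=> ha hb; rewrite -sdotBl entropy_conservative.
pose wa := S (fun i j => sdot (w i) (f (Y i) (Y j))).
pose wja := S (fun i j => sdot (w j) (f (Y i) (Y j))).
pose za := S (fun i j => sdot (z i) (f (Y i) (Y j))).
pose zja := S (fun i j => sdot (z j) (f (Y i) (Y j))).
pose wb := S (fun i j => sdot (w i) (f (Y i) (U j))).
pose zb := S (fun i j => sdot (z i) (f (Y i) (U j))).
pose zjb := S (fun i j => sdot (z j) (f (Y i) (U j))).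
pose zb' := S (fun i j => sdot (z i) (f (U i) (Y j))).
pose zjb' := S (fun i j => sdot (z j) (f (U i) (Y j))).
pose wc := S (fun i j => sdot (w i) (f (U i) (U j))).
pose zc := S (fun i j => sdot (z i) (f (U i) (U j))).
pose zjc := S (fun i j => sdot (z j) (f (U i) (U j))).
have swap (g V W : 'I_n -> state R d) :
    S (fun i j => sdot (g i) (f (V i) (W j))) = - S (fun i j => sdot (g j) (f (W i) (V j))).
  rewrite (stencil_sumC Qskew); congr (- _); apply: stencil_sum_ext => i j.
  by rewrite (fC (V j) (W i)).
have balance (V W : 'I_n -> state R d) :
    (forall i, admissible gamma (V i)) -> (forall i, admissible gamma (W i)) ->
    S (fun i j => sdot (evar gamma (V i)) (f (V i) (W j)))
    - S (fun i j => sdot (evar gamma (W j)) (f (V i) (W j))) = 0.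
  move=> hV hW; rewrite -stencil_sumB -(stencil_sum_diff Qskew Qrow (psi \o V) (psi \o W)).
  by apply: stencil_sum_ext => i j; exact: ec.
have E1 : wa - wja = 0 := balance Y Y hY hY.
have E2 : wa = - wja := swap w Y Y.
have E3 : za = - zja := swap z Y Y.
have E4 : zc - zjc = 0 := balance U U hU hU.
have E5 : wb - zjb = 0 := balance Y U hY hU.
have E6 : zb' = - zjb := swap z U Y.
have E7 : zb = - zjb' := swap z Y U.
have F1 : S (fun i j => sdot (w i - z i) (f (Y i) (Y j) - f (U i) (U j))) =
    (wa - za) - (wc - zc).
  rewrite -!stencil_sumB; apply: stencil_sum_ext => i j.
  by rewrite (sdotBr (w i - z i)) !(sdotBl _ (w i)).
have F2 : S (fun i j => sdot (z i - z j)
       (f (Y i) (Y j) - f (Y i) (U j) - f (U i) (Y j) + f (U i) (U j))) =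
    (za - zja) - (zb - zjb) - (zb' - zjb') + (zc - zjc).
  have e i j a b a' b' : sdot (z i - z j) (a - b - a' + b') = (sdot (z i) a - sdot (z j) a)
      - (sdot (z i) b - sdot (z j) b) - (sdot (z i) a' - sdot (z j) a')
      + (sdot (z i) b' - sdot (z j) b').
    by rewrite sdotDr !sdotBr !sdotBl.
  rewrite (stencil_sum_ext _ (fun i j => e i j _ _ _ _)).
  rewrite stencil_sumD !stencil_sumB; exact: erefl.
(* The part with [f (Y i) (U i)] and its partner is independent of [j] and is annihilated by the
   zero row sums; it is there only to complete a mixed difference. *)
have F3 : S (fun i j => sdot (w i - z i)
       (f (Y i) (U j) - f (U i) (U j) - f (Y i) (U i) + f (U i) (U i))) =
    (wb - zb) - (wc - zc).
  have e i j : sdot (w i - z i) (f (Y i) (U j) - f (U i) (U j) - f (Y i) (U i) + f (U i) (U i)) =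
      (sdot (w i) (f (Y i) (U j)) - sdot (z i) (f (Y i) (U j)))
      - (sdot (w i) (f (U i) (U j)) - sdot (z i) (f (U i) (U j)))
      - sdot (w i - z i) (f (Y i) (U i) - f (U i) (U i)).
    by rewrite -sdotBl -sdotBl -!sdotBr opprB addrA addrAC.
  rewrite (stencil_sum_ext _ e) [LHS]stencil_sumB (stencil_sum_l Qrow) subr0.
  rewrite !stencil_sumB; exact: erefl.
refine (etrans (congr1 (fun x => - (2 * x)) F1) _).
refine (etrans (arith _ _ _ _ _ _ _ _ _ _ _ _ E1 E2 E3 E4 E5 E6 E7) (esym _)).
exact (congr2 (fun x y => x - 2 * y) F2 F3).
Qed.
End DiscreteEntropyBalance.

(** * Growth rate of the total relative entropy *)

Section EnergyRate.
Variables (R : realType) (d p : nat) (gamma L T r0 P0 B : R)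
  (s u : R -> 'rV[R]_d -> state R d) (F : set (discretization R d)).
Hypotheses (hg : 1 < gamma) (L0 : 0 < L) (T0 : 0 < T) (r00 : 0 < r0) (P00 : 0 < P0).
Hypothesis p0 : (0 < p)%N.
Hypothesis hu : Ck_tx L T p.+1 u.
Local Notation S := (good_states gamma r0 P0 B).
Hypothesis uS : forall t x, 0 <= t <= T -> S (u t x).
Hypothesis heuler : euler_solution gamma T s u.
Hypotheses (hF : sbp_family L p F) (hFloc : fixed_local_stencil L F).

Lemma stencil_states_close : exists2 C, 0 <= C & forall D, F D -> forall t m i j,
  0 <= t <= T -> stiff D m i j != 0 -> `|u t (node i) - u t (node j)| <= C * mesh D.
Proof.
have [C C0 hC] := u_lipschitz L0 T0 hu.
have [om [Cq [kap [om0 Cq0 hS]]]] := hFloc.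
have [cM [CM [cN [CN [CD [_ hm]]]]]] := hF.
exists (C * (2 * om)) => [|D FD t m i j tT Q0]; first by rewrite !mulr_ge0 // ltW.
have [h0 _ _ _ _] := hm D FD.
have [hst _ _] := hS D FD m.
have [k hk] := stencil_translate (mulr_gt0 om0 h0) (hst i j Q0).
have := hC t (node i) (node j + L *: map_mx intr k) tT.
rewrite (periodic_lattice _ _ (hu.1 t tT)) distrC => /le_trans; apply.
by rewrite -!mulrA ler_wpM2l // mulrA -mulrA.
Qed.

(** Skew-symmetry makes the sparsity pattern symmetric, so the bound on the entries of a row holds
    for columns too and each [e i] is counted at most [2 * kappa] times. *)
Lemma stencil_sum_bound : exists2 C, 0 <= C & forall D, F D -> forall m K X (e : 'I_(nnodes D) -> R),
  0 <= K -> (forall i, 0 <= e i) ->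
  (forall i j, stiff D m i j != 0 -> `|X i j| <= K * mesh D * (e i + e j)) ->
  `|stencil_sum (stiff D m) X| <= C * K * \sum_i mass D ord0 i * e i.
Proof.
have [om [Cq [kap [om0 Cq0 hS]]]] := hFloc.
have [cM [CM [cN [CN [CD [[cM0 _ _ _ _] hm]]]]]] := hF.
exists (Cq * (kap%:R * 2) / cM) => [|D FD m K X e K0 e0 hX].
  by rewrite divr_ge0 ?mulr_ge0 // ltW.
have [h0 [mi _] skew _ _] := hm D FD.
have [_ hkap hq] := hS D FD m.
pose nz i j : R := (stiff D m i j != 0)%:R.
have nz01 i j : 0 <= nz i j by [].
have nzC i j : nz i j = nz j i.
  rewrite /nz; congr (_%:R); congr (nat_of_bool _).
  have : stiff D m i j = - stiff D m j i.
    by apply/eqP; rewrite -addr_eq0; move/matrixP : (skew m) => /(_ i j); rewrite !mxE => ->.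
  by move=> ->; rewrite oppr_eq0.
have hh : mesh D ^+ d.-1 * mesh D = mesh D ^+ d.
  by rewrite -exprSr (ltn_predK (ltn_ord m)).
have term i j : `|stiff D m i j * X i j| <= Cq * K * mesh D ^+ d * (nz i j * (e i + e j)).
  rewrite /nz; case: eqVneq => [->|Q0] /=; first by rewrite !mul0r normr0 mulr0.
  rewrite (le_trans (normM_le (hq i j) (hX i j Q0))) // -hh mul1r.
  by rewrite le_eqVlt; apply/orP; left; apply/eqP; ring.
have row i : \sum_j nz i j <= kap%:R.
  rewrite -natr_sum ler_nat (leq_trans _ (hkap i)) // cardsE -sum1_card.
  by rewrite [X in (_ <= X)%N]big_mkcond; apply: leq_sum => j _; rewrite unfold_in; case: eqP.
have T1 : \sum_i \sum_j nz i j * e i <= kap%:R * \sum_i e i.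
  rewrite mulr_sumr; apply: ler_sum => i _.
  by rewrite -mulr_suml ler_wpM2r.
have T2 : \sum_i \sum_j nz i j * e j = \sum_i \sum_j nz i j * e i.
  by rewrite exchange_big; apply: eq_bigr => i _; apply: eq_bigr => j _; rewrite nzC.
have T3 : \sum_i \sum_j nz i j * (e i + e j) <= kap%:R * 2 * \sum_i e i.
  have -> : \sum_i \sum_j nz i j * (e i + e j) =
      \sum_i \sum_j nz i j * e i + \sum_i \sum_j nz i j * e j.
    rewrite -big_split; apply: eq_bigr => i _; rewrite -big_split.
    by apply: eq_bigr => j _; rewrite mulrDr.
  by rewrite T2; lra.
have T4 : mesh D ^+ d * \sum_i e i <= (\sum_i mass D ord0 i * e i) / cM.
  rewrite ler_pdivlMr // mulr_sumr mulr_suml; apply: ler_sum => i _.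
  rewrite mulrAC ler_wpM2r // mulrC.
  by have /andP[] := mi i.
rewrite (le_trans (ler_norm_sum _ _ _)) //
  (@le_trans _ _ (Cq * K * mesh D ^+ d * \sum_i \sum_j nz i j * (e i + e j))) //.
  rewrite mulr_sumr; apply: ler_sum => i _; rewrite (le_trans (ler_norm_sum _ _ _)) //.
  by rewrite mulr_sumr; apply: ler_sum => j _.
have CK : 0 <= Cq * K by rewrite mulr_ge0 // ltW.
have h1 := ler_wpM2l (ltW (exprn_gt0 d h0)) T3.
have h2 : kap%:R * 2 * (mesh D ^+ d * \sum_i e i) <= kap%:R * 2 * ((\sum_i mass D ord0 i * e i) / cM).
  by rewrite ler_wpM2l // mulr_ge0.
rewrite -mulrA (@le_trans _ _ (Cq * K * (kap%:R * 2 * ((\sum_i mass D ord0 i * e i) / cM)))) //.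
  by rewrite ler_wpM2l // (le_trans h1) // mulrCA.
by rewrite le_eqVlt; apply/orP; left; apply/eqP; ring.
Qed.

Lemma time_derive_solution t x : 0 <= t <= T ->
  is_time_derive T (u^~ x) t (time_derive T (u^~ x) t).
Proof.
move=> tT; apply: time_derivableP; have [_ hc] := hu.
by have [//|_ /(_ isT None t x tT)] := hc [::].
Qed.

Lemma time_derive_bounded : exists2 C, 0 <= C & forall t x, 0 <= t <= T ->
  `|time_derive T (u^~ x) t| <= C.
Proof.
have [pu hc] := hu; have [//|ct _] := hc [:: None].
apply: (continuous_tx_bounded L0 (ltW T0) _ ct) => t tT m x /=.
apply: (is_time_derive_val T0 tT).
apply: (@eq_is_time_derive _ T _ (u^~ x)) => // [t' t'T|]; last exact: time_derive_solution.
by rewrite (pu t' t'T).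
Qed.

(** The Euler equation at the node, times its mass, is subtracted from the scheme; the same source
    value stands in both and cancels. *)
Lemma semidiscrete_defect (D : discretization R d) t i (Y : 'I_(nnodes D) -> state R d) Y' :
  0 <= t <= T ->
  mass D ord0 i *: Y' + \sum_(m < d) 2 *: (\sum_j stiff D m i j *: fnum gamma m (Y i) (Y j))
    = mass D ord0 i *: s t (node i) ->
  mass D ord0 i *: (Y' - time_derive T (u^~ (node i)) t) =
  - \sum_(m < d) (2 *: (\sum_j stiff D m i j *:
        (fnum gamma m (Y i) (Y j) - fnum gamma m (u t (node i)) (u t (node j))))
      + (2 *: (\sum_j stiff D m i j *: fnum gamma m (u t (node i)) (u t (node j)))
      - mass D ord0 i *: 'D_(evec m) (fun y => euler_flux gamma m (u t y)) (node i))).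
Proof.
move=> tT E.
have hs := heuler (node i) tT.
have E1 : mass D ord0 i *: Y' = mass D ord0 i *: s t (node i) -
    \sum_(m < d) 2 *: (\sum_j stiff D m i j *: fnum gamma m (Y i) (Y j)).
  by rewrite -E addrK.
rewrite scalerBr E1 -hs scalerDr addrAC (addrC (mass D ord0 i *: time_derive T _ t)) addrK.
rewrite scaler_sumr -sumrB -sumrN; apply: eq_bigr => m _.
have -> : \sum_j stiff D m i j *: (fnum gamma m (Y i) (Y j) - fnum gamma m (u t (node i)) (u t (node j)))
  = \sum_j stiff D m i j *: fnum gamma m (Y i) (Y j)
    - \sum_j stiff D m i j *: fnum gamma m (u t (node i)) (u t (node j)).
  by rewrite -sumrB; apply: eq_bigr => j _; rewrite scalerBr.
by rewrite scalerBr addrA subrK opprB.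
Qed.

(** Stated at a single time for states [Y] and vectors [Y'] tied only by the equation, so that
    trajectories come in later. *)
Lemma energy_rate : exists2 C, 0 <= C & forall D, F D ->
  forall t (Y Y' : 'I_(nnodes D) -> state R d), 0 <= t <= T -> (forall i, S (Y i)) ->
  (forall i, mass D ord0 i *: Y' i
     + \sum_(m < d) 2 *: (\sum_j stiff D m i j *: fnum gamma m (Y i) (Y j))
     = mass D ord0 i *: s t (node i)) ->
  \sum_i mass D ord0 i *
    (sdot (evar gamma (Y i) - evar gamma (u t (node i))) (Y' i)
     - sdot (devar gamma (u t (node i)) (time_derive T (u^~ (node i)) t)) (Y i - u t (node i)))
  <= C * (\sum_i mass D ord0 i * `|Y i - u t (node i)| ^+ 2 + mesh D ^+ p ^+ 2).
Proof.
have arith (S1 S2 S3 a b E q : R) : S1 <= a * E -> - (a * E) <= S2 -> - (b * (E + q)) <= S3 ->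
    0 <= a * q -> S1 - 2 * S2 - S3 <= (3 * a + b) * (E + q) by lra.
have amgm (a b : R) : 0 <= a -> 0 <= b -> a * b <= a ^+ 2 + b ^+ 2.
  by move=> a0 b0; have := sqr_ge0 (a - b); have := mulr_ge0 a0 b0; nra.
have arith2 (M q CC E : R) : M * q <= CC * q -> 0 <= CC * E -> 0 <= q ->
    E + M * q <= (1 + CC) * (E + q) by lra.
have [Cd Cd0 hCd] := time_derive_bounded.
have [Cq Cq0 hCq] := @evar_quadratic R d gamma hg r0 P0 B r00 P00.
have [Cl Cl0 hCl] := @evar_lipschitz R d gamma r0 P0 B r00 P00.
have [CX CX0 hCX] := @fnum_cross_bound R d gamma hg r0 P0 B r00 P00.
have [Cs Cs0 hCs] := stencil_states_close.
have [Cb Cb0 hCb] := stencil_sum_bound.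
have [Cc Cc0 hCc] := flux_consistency hg L0 T0 r00 P00 p0 hu uS hF hFloc.
have [cM [CM [cN [CN [CD [[cM0 CM0 _ CN0 _] hm]]]]]] := hF.
pose n := sdim R d; have n0 : 0 <= n by rewrite ltW // sdim_gt0.
(* [Cl] comes from the entropy variables, [Cs] from the closeness of exact states on a stencil, [CX]
   from the cross bound on the flux. *)
pose K1 := n * (Cl * Cs * CX).
have K10 : 0 <= K1 by rewrite !mulr_ge0.
(* The 3 counts the first stencil sum once and the second twice; [CM * CN] bounds the total mass,
   which multiplies [h^(2p)] in the consistency term. *)
pose K2 := 3 * (Cb * K1) + n * (Cl * Cc) * (1 + CM * CN).
have K20 : 0 <= K2 by rewrite addr_ge0 ?mulr_ge0 ?addr_ge0 ?mulr_ge0 // ltW.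
exists (Cq * Cd + d%:R * K2) => [|D FD t Y Y' tT SY eqY]; first by rewrite addr_ge0 // mulr_ge0.
have [h0 [mi Nh] skew row _] := hm D FD.
have hp0 : 0 < mesh D ^+ p by rewrite exprn_gt0.
pose U (i : 'I_(nnodes D)) : state R d := u t (node i).
pose mm (i : 'I_(nnodes D)) : R := mass D ord0 i.
have SU i : S (U i) by exact: uS.
have mm0 i : 0 <= mm i.
  by have /andP[h _] := mi i; rewrite (le_trans _ h) // mulr_ge0 ?exprn_ge0 // ltW.
pose e i : R := `|Y i - U i|; pose E := \sum_i mm i * e i ^+ 2.
have e0 i : 0 <= e i by exact: normr_ge0.
have E0 : 0 <= E by apply: sumr_ge0 => i _; rewrite mulr_ge0 // exprn_ge0.
pose U' (i : 'I_(nnodes D)) := time_derive T (u^~ (node i)) t.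
pose de i : state R d := evar gamma (Y i) - evar gamma (U i).
have de_le i : `|de i| <= Cl * e i by exact: hCl.
pose cons m i : state R d := 2 *: (\sum_j stiff D m i j *: fnum gamma m (U i) (U j))
   - mm i *: 'D_(evec m) (fun y => euler_flux gamma m (u t y)) (node i).
pose df m i j : state R d := fnum gamma m (Y i) (Y j) - fnum gamma m (U i) (U j).
pose A m := - (2 * stencil_sum (stiff D m) (fun i j => sdot (de i) (df m i j))) - \sum_i sdot (de i) (cons m i).
have split_i i : mm i * (sdot (de i) (Y' i) - sdot (devar gamma (U i) (U' i)) (Y i - U i)) =
    mm i * (sdot (de i) (U' i) - sdot (devar gamma (U i) (U' i)) (Y i - U i))
    + \sum_(m < d) (- (2 * \sum_j stiff D m i j * sdot (de i) (df m i j)) - sdot (de i) (cons m i)).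
  have -> : \sum_(m < d) (- (2 * \sum_j stiff D m i j * sdot (de i) (df m i j)) - sdot (de i) (cons m i))
      = sdot (de i) (mm i *: (Y' i - U' i)).
    rewrite (semidiscrete_defect tT (eqY i)) sdotNr sdot_sumr -sumrN; apply: eq_bigr => m _.
    rewrite [in RHS]sdotDr [in RHS]sdotZr [in RHS]sdot_sumr [RHS]opprD.
    have -> : \sum_j sdot (de i) (stiff D m i j *: (fnum gamma m (Y i) (Y j) - fnum gamma m (U i) (U j)))
        = \sum_j stiff D m i j * sdot (de i) (df m i j) by apply: eq_bigr => j _; rewrite sdotZr.
    by [].
  by rewrite sdotZr (sdotBr (de i) (Y' i)); ring.
under eq_bigr do rewrite split_i.
rewrite big_split /= exchange_big /=.
have A_le m : A m <= K2 * (E + mesh D ^+ p ^+ 2).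
  have bal := stencil_entropy_balance hg (skew m) (row m) m (fun i => good_admissible r00 P00 (SY i))
    (fun i => good_admissible r00 P00 (SU i)).
  rewrite /A bal.
  have e20 i : 0 <= e i ^+ 2 by rewrite exprn_ge0.
  set X1 := (X in stencil_sum _ X - _); set X2 := (X in _ - 2 * stencil_sum _ X).
  have b1 : `|stencil_sum (stiff D m) X1| <= Cb * K1 * E.
    apply: hCb => // i j Q0; rewrite (le_trans (sdot_norm _ _)) // /K1 -/n -!(mulrA n) ler_wpM2l //.
    have h1 := le_trans (hCl _ _ (SU i) (SU j)) (ler_wpM2l Cl0 (hCs D FD t m i j tT Q0)).
    have [_ _ h2] := hCX m (U i) (Y i) (U j) (Y j) (SU i) (SY i) (SU j) (SY j).
    rewrite (le_trans (ler_pM _ _ h1 h2)) //.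
    rewrite [X in X <= _](_ : _ = Cl * Cs * CX * mesh D * (e i * e j)); last by rewrite /e; ring.
    rewrite ler_wpM2l ?mulr_ge0 ?(ltW h0) //.
    exact: amgm.
  have b2 : `|stencil_sum (stiff D m) X2| <= Cb * K1 * E.
    apply: hCb => // i j Q0; rewrite (le_trans (sdot_norm _ _)) // /K1 -/n -!(mulrA n) ler_wpM2l //.
    have [_ _ h2] := hCX m (U i) (Y i) (U i) (U j) (SU i) (SY i) (SU i) (SU j).
    rewrite (addrAC (fnum gamma m (Y i) (U j)) (- fnum gamma m (U i) (U j))).
    have h3 := hCs D FD t m i j tT Q0; rewrite distrC in h3.
    rewrite (le_trans (ler_pM _ _ (de_le i) h2)) //.
    rewrite (@le_trans _ _ (Cl * e i * (CX * (e i * (Cs * mesh D))))) //.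
      by rewrite !ler_wpM2l ?mulr_ge0.
    rewrite [X in X <= _](_ : _ = Cl * Cs * CX * mesh D * (e i ^+ 2)); last by ring.
    by rewrite ler_wpM2l ?mulr_ge0 ?(ltW h0) // lerDl.
  have b3 : `|\sum_i sdot (de i) (cons m i)| <= n * (Cl * Cc) * (1 + CM * CN) * (E + mesh D ^+ p ^+ 2).
    have t1 i : `|sdot (de i) (cons m i)| <= n * (Cl * Cc) * (mm i * e i ^+ 2 + mm i * mesh D ^+ p ^+ 2).
      rewrite (le_trans (sdot_norm _ _)) // -/n -mulrA ler_wpM2l //.
      rewrite (le_trans (ler_pM _ _ (de_le i) (hCc D FD t m i tT))) //.
      rewrite [X in X <= _](_ : _ = Cl * Cc * (mm i * (e i * mesh D ^+ p))); last by rewrite /mm; ring.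
      rewrite ler_wpM2l ?mulr_ge0 // -mulrDr ler_wpM2l //.
      by apply: amgm => //; exact: ltW.
    rewrite (le_trans (ler_norm_sum _ _ _)) // (le_trans (ler_sum _ (fun i _ => t1 i))) //.
    rewrite -mulr_sumr big_split /= -/E -mulr_suml -mulrA ler_wpM2l ?mulr_ge0 //.
    have mass_le : \sum_i mm i <= CM * CN.
      rewrite (@le_trans _ _ (\sum_(i < nnodes D) CM * mesh D ^+ d)) //.
        by apply: ler_sum => i _; have /andP[] := mi i.
      rewrite sumr_const card_ord -mulr_natl mulrCA ler_wpM2l ?(ltW CM0) //.
      by have /andP[] := Nh.
    have q0 : 0 <= mesh D ^+ p ^+ 2 by rewrite exprn_ge0 // ltW.
    have CC : 0 <= CM * CN by rewrite mulr_ge0 // ltW.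
    by apply: arith2 => //; [exact: ler_wpM2r|exact: mulr_ge0].
  have q0 : 0 <= mesh D ^+ p ^+ 2 by rewrite exprn_ge0 // ltW.
  have CK : 0 <= Cb * K1 * (mesh D ^+ p ^+ 2) by rewrite mulr_ge0 // mulr_ge0.
  exact: (arith _ _ _ _ _ _ _ (le_trans (ler_norm _) b1) (lerNnormlW b2) (lerNnormlW b3) CK).
have -> : \sum_(m < d) \sum_i (- (2 * \sum_j stiff D m i j * sdot (de i) (df m i j)) - sdot (de i) (cons m i))
   = \sum_(m < d) A m.
  by apply: eq_bigr => m _; rewrite /A big_split /= sumrN sumrN mulr_sumr.
have A_sum : \sum_(m < d) A m <= d%:R * (K2 * (E + mesh D ^+ p ^+ 2)).
  rewrite (le_trans (ler_sum _ (fun m _ => A_le m))) // sumr_const card_ord.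
  by rewrite -[_ *+ d]mulr_natl.
have quad : \sum_i mm i * (sdot (de i) (U' i) - sdot (devar gamma (U i) (U' i)) (Y i - U i)) <= Cq * Cd * E.
  rewrite /E mulr_sumr; apply: ler_sum => i _; rewrite mulrCA ler_wpM2l //.
  rewrite (le_trans (ler_norm _)) // (le_trans (hCq _ _ _ (SY i) (SU i))) //.
  rewrite -[Cq * Cd * _]mulrA ler_wpM2l // mulrC ler_wpM2r ?exprn_ge0 //; exact: hCd.
rewrite (le_trans (lerD quad A_sum)) // [X in _ <= X]mulrDl lerD // ?mulrA //.
by rewrite ler_wpM2l ?mulr_ge0 // lerDl exprn_ge0 // ltW.
Qed.
End EnergyRate.

(** * First exit and truncation *)

Section Exit.
Variables (R : realType) (T : R).
Hypothesis T0 : 0 < T.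

(** A bootstrap: the weak bound [b] on an initial interval improves to [a], and the gap between the
    two lets continuity carry the bound past the supremum of the good times. *)
Lemma first_exit (f : R -> R) a b : a < b -> {within `[0, T], continuous f} -> f 0 <= a ->
  (forall t1, 0 <= t1 <= T -> (forall t, 0 <= t <= t1 -> f t <= b) ->
     forall t, 0 <= t <= t1 -> f t <= a) ->
  forall t, 0 <= t <= T -> f t <= a.
Proof.
move=> ab cf f0 step.
pose A := [set t1 | 0 <= t1 <= T /\ forall t, 0 <= t <= t1 -> f t <= a].
have A0 : A 0.
  split => [|t]; first by rewrite lexx ltW.
  by rewrite -eq_le => /eqP <-.
have supA : has_sup A by split; [exists 0|exists T => t [/andP[]]].
have s0 : 0 <= sup A by apply: sup_upper_bound => //; exact: A0.
have sT : sup A <= T by apply: ge_sup => [|t [/andP[]]] //; exists 0.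
(* Half of the gap is spent twice, from a good time to the supremum and from the supremum to a later
   time. *)
have e0 : 0 < (b - a) / 2 by rewrite divr_gt0 // subr_gt0.
move/subspace_continuousP : cf => /(_ (sup A)) /=; rewrite in_itv /= s0 sT => /(_ isT).
move/cvgrPdist_le => /(_ _ e0).
rewrite /within /= => /nbhs_ballP[del /= del0 hdel].
have near x : 0 <= x <= T -> `|sup A - x| < del -> `|f (sup A) - f x| <= (b - a) / 2.
  by move=> xT hx; apply: hdel; rewrite //= in_itv.
have [t1 [t1T ht1] t1s] := sup_adherent del0 supA.
have t1_le : t1 <= sup A by apply: sup_upper_bound.
have fs : f (sup A) <= a + (b - a) / 2.
  have close : `|sup A - t1| < del by rewrite ger0_norm ?subr_ge0 //; lra.
  have : f t1 <= a by apply: ht1; case/andP: t1T => -> _; exact: lexx.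
  by move: (near t1 t1T close); rewrite ler_norml => /andP[]; lra.
pose t2 := Num.min T (sup A + del / 2).
have t2T : t2 <= T by rewrite ge_min lexx.
have t2s : t2 <= sup A + del / 2 by rewrite ge_min lexx orbT.
have t20 : 0 <= t2 by rewrite le_min (ltW T0) addr_ge0 // divr_ge0 // ltW.
have At2 : A t2.
  split; first by rewrite t20.
  apply: step => [|t /andP[t0 tt2]]; first by rewrite t20.
  have [tt1|t1t] := leP t t1.
    by rewrite (@le_trans _ _ a) ?(ltW ab) //; apply: ht1; rewrite t0.
  have := near t; rewrite t0 (le_trans tt2 t2T) => /(_ isT) => h.
  have : `|sup A - t| < del by rewrite ltr_norml; apply/andP; split; lra.
  by move=> /h; rewrite ler_norml => /andP[]; lra.
have t2_le : t2 <= sup A by apply: sup_upper_bound.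
have t2E : t2 = T.
  have [h|h] := leP T (sup A + del / 2); first by rewrite /t2 min_l.
  by move: t2_le; rewrite /t2 min_r ?(ltW h) //; lra.
by move: At2; rewrite t2E => -[].
Qed.

Lemma within_continuous_lipschitz (W : normedModType R) (I : Type) (r : seq I) (f : I -> R -> W) (g : R -> R) C :
  0 <= C -> (forall i, {within `[0, T], continuous (f i)}) ->
  (forall t t', 0 <= t <= T -> 0 <= t' <= T ->
    `|g t - g t'| <= C * \sum_(i <- r) `|f i t - f i t'|) ->
  {within `[0, T], continuous g}.
Proof.
move=> C0 cf hg; apply/subspace_continuousP => t /=; rewrite in_itv /= => tT.
apply/cvgrPdist_le => e e0.
have M0 : 0 < C * (size r)%:R + 1 by rewrite ltr_wpDl // mulr_ge0.
have d0 : 0 < e / (C * (size r)%:R + 1) by rewrite divr_gt0.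
have near_f : \forall t' \near within `[0, T] (nbhs t),
    \sum_(i <- r) `|f i t - f i t'| <= (size r)%:R * (e / (C * (size r)%:R + 1)).
  elim: r {hg M0} (e / _) d0 => [|i r IH] del d0.
    by apply: nearW => t'; rewrite big_nil mul0r.
  have /subspace_continuousP /(_ t) /= := cf i; rewrite in_itv /= => /(_ tT).
  move=> /cvgrPdist_le /(_ _ d0) h1; have h2 := IH del d0.
  near=> t'; rewrite big_cons /= -natr1 addrC mulrDl mul1r lerD //; near: t'; [exact: h2|exact: h1].
have near_T : \forall t' \near within `[0, T] (nbhs t), 0 <= t' <= T.
  change (nbhs t (fun t' => t' \in `[0, T] -> 0 <= t' <= T)).
  by apply: (@filterE _ (nbhs t)) => x; rewrite in_itv.
near=> t'.
have t'T : 0 <= t' <= T by near: t'.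
have h : \sum_(i <- r) `|f i t - f i t'| <= (size r)%:R * (e / (C * (size r)%:R + 1)) by near: t'.
rewrite (le_trans (hg t t' tT t'T)) // (le_trans (ler_wpM2l C0 h)) //.
rewrite [X in X <= _](_ : _ = e * (C * (size r)%:R) / (C * (size r)%:R + 1)); last by ring.
by rewrite ler_pdivrMr // ler_wpM2l ?(ltW e0) // lerDl.
Unshelve. all: by end_near. Qed.
End Exit.

(** * Clipping states to a box *)

Section BoxClip.
Variables (R : realType) (d : nat).
Implicit Types (a b : state R d) (r x : R).

Definition coord_state (f : option (option 'I_d) -> R) : state R d :=
  mkstate (f None) (\row_k f (Some (Some k))) (f (Some None)).

Lemma state_coord_coord_state f o : state_coord o (coord_state f) = f o.
Proof. by case: o => [[k|]|] /=; rewrite /coord_state state_mkE // mxE. Qed.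

Lemma state_coord_inj a b : (forall o, state_coord o a = state_coord o b) -> a = b.
Proof.
move=> h; apply: state_eq; first exact: (h None); last exact: (h (Some None)).
by move=> k; exact: (h (Some (Some k))).
Qed.

Definition clip r x : R := Num.max (- r) (Num.min r x).

(** Clipping acts on each component, since a ball of the sup norm is a box; Lipschitz bounds then
    reduce to one real variable. *)
Definition box_clip r a b : state R d :=
  coord_state (fun o => state_coord o a + clip r (state_coord o (b - a))).

Lemma clipE r x : 0 <= r ->
  clip r x = if x <= - r then - r else if r <= x then r else x.
Proof.
move=> r0; rewrite /clip; have [h1|h1] := leP r x.
  by rewrite max_r; [have [h2|h2] := leP x (- r)|]; lra.
by have [h2|h2] := leP x (- r); lra.
Qed.

Lemma clip_le r x : 0 <= r -> `|clip r x| <= r.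
Proof.
move=> r0; rewrite clipE // ler_norml.
by have [h1|h1] := leP x (- r); [|have [h2|h2] := leP r x]; lra.
Qed.

Lemma clip_id r x : `|x| <= r -> clip r x = x.
Proof.
move=> xr; rewrite clipE ?(le_trans _ xr) //; move: xr; rewrite ler_norml => /andP[? ?].
by have [h1|h1] := leP x (- r); [|have [h2|h2] := leP r x]; lra.
Qed.

Lemma clip_lipschitz r x y : 0 <= r -> `|clip r x - clip r y| <= `|x - y|.
Proof.
move=> r0; rewrite !clipE //.
wlog xy : x y / y <= x.
  move=> h; have [/h //|/ltW/h] := leP y x.
  by rewrite distrC [X in _ -> _ <= X]distrC.
rewrite (@ger0_norm _ (x - y)) ?subr_ge0 // ler_norml.
have [h1|h1] := leP x (- r); have [h2|h2] := leP y (- r);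
  have [h3|h3] := leP r x; have [h4|h4] := leP r y; lra.
Qed.

Lemma box_clipE r a b o :
  state_coord o (box_clip r a b) = state_coord o a + clip r (state_coord o (b - a)).
Proof. exact: state_coord_coord_state. Qed.

Lemma box_clip_le r a b : 0 <= r -> `|box_clip r a b - a| <= r.
Proof.
move=> r0; apply: state_norm_le => // o.
by rewrite linearB /= box_clipE addrAC subrr add0r clip_le.
Qed.

Lemma box_clip_id r a b : `|b - a| <= r -> box_clip r a b = b.
Proof.
move=> h; apply: state_coord_inj => o; rewrite box_clipE clip_id.
  by rewrite linearB addrC subrK.
exact: le_trans (state_norm_coord _ _) h.
Qed.

(** The centre of the box follows the exact solution, so the dependence on it matters for continuity
    in time. *)
Lemma box_clip_lipschitz r a b a' b' o : 0 <= r ->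
  `|state_coord o (box_clip r a b) - state_coord o (box_clip r a' b')| <=
  `|state_coord o b - state_coord o b'| + 2 * `|state_coord o a - state_coord o a'|.
Proof.
move=> r0; rewrite !box_clipE.
have cB (v w : state R d) : state_coord o (v - w) = state_coord o v - state_coord o w by rewrite linearB.
have := @clip_lipschitz r (state_coord o (b - a)) (state_coord o (b' - a')) r0.
rewrite !cB.
move: (state_coord o a) (state_coord o b) (state_coord o a') (state_coord o b') => x y x' y'.
set c := clip _ _; set c' := clip _ _ => h.
rewrite (_ : _ - _ = (x - x') + (c - c')); last by ring.
have h2 : `|y - x - (y' - x')| <= `|y - y'| + `|x - x'|.
  by rewrite (_ : _ - _ = (y - y') - (x - x')) ?ler_normB //; ring.
have h3 := ler_normD (x - x') (c - c'); lra.
Qed.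
End BoxClip.

(** * The semidiscretization *)

Section Scheme.
Variables (R : realType) (d p : nat) (gamma L T r0 P0 B r : R)
  (s u : R -> 'rV[R]_d -> state R d) (F : set (discretization R d)).
Hypotheses (hg : 1 < gamma) (L0 : 0 < L) (T0 : 0 < T) (r00 : 0 < r0) (P00 : 0 < P0).
Hypothesis hdp : d%:R / 2 < p%:R :> R.
Hypothesis hu : Ck_tx L T p.+1 u.
Local Notation S := (good_states gamma r0 P0 B).
Hypothesis rpos : 0 < r.
Hypothesis box : forall t x b, 0 <= t <= T -> `|b - u t x| <= r -> S b.
Hypothesis heuler : euler_solution gamma T s u.
Hypotheses (hF : sbp_family L p F) (hFloc : fixed_local_stencil L F).

Let uS t x : 0 <= t <= T -> S (u t x).
Proof. by move=> tT; apply: (box tT (x := x)); rewrite subrr normr0 ltW. Qed.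

Let dp : (d < 2 * p)%N.
Proof. by rewrite -(ltr_nat R) natrM mulrC -ltr_pdivrMr. Qed.

Let p0 : (0 < p)%N.
Proof. by move: dp; case: (p) => //; rewrite muln0. Qed.

Definition scheme_flux (D : discretization R d) (c : 'I_(nnodes D) -> state R d) i : state R d :=
  (mass D ord0 i)^-1 *:
    \sum_(m < d) 2 *: (\sum_j stiff D m i j *: fnum gamma m (c i) (c j)).

Definition solves (D : discretization R d) (Y Y' : R -> 'I_(nnodes D) -> state R d) t :=
  forall i, mass D ord0 i *: Y' t i
     + \sum_(m < d) 2 *: (\sum_j stiff D m i j *: fnum gamma m (Y t i) (Y t j))
     = mass D ord0 i *: s t (node i).

Lemma mass_gt0 D i : F D -> 0 < mass D ord0 i.
Proof.
move=> FD; have [cM [CM [cN [CN [CD [[cM0 _ _ _ _] hm]]]]]] := hF.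
have [h0 [mi _] _ _ _] := hm D FD; have /andP[h _] := mi i.
by rewrite (lt_le_trans _ h) // mulr_gt0 // exprn_gt0.
Qed.

Lemma solvesE D (Y Y' : R -> 'I_(nnodes D) -> state R d) t : F D ->
  solves Y Y' t <-> forall i, Y' t i = s t (node i) - scheme_flux (Y t) i.
Proof.
move=> FD; split => h i; have m0 : mass D ord0 i != 0 by rewrite gt_eqF // mass_gt0.
  apply: (scalerI m0); rewrite scalerBr -(h i) /scheme_flux scalerA mulfV // scale1r.
  by rewrite addrK.
by rewrite h scalerBr /scheme_flux scalerA mulfV // scale1r subrK.
Qed.

(** [Lam] depends on [D]: it serves existence and uniqueness on a fixed grid, not convergence. *)
Lemma scheme_flux_lipschitz D : exists2 Lam, 0 <= Lam & forall (c c' : 'I_(nnodes D) -> state R d) del,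
  (forall i, S (c i)) -> (forall i, S (c' i)) -> (forall i, `|c i - c' i| <= del) ->
  forall i, `|scheme_flux c i - scheme_flux c' i| <= Lam * del.
Proof.
have arith (C x y z del a b : R) : x <= C * a -> y <= C * b -> C * a <= C * del -> C * b <= C * del ->
    x + y <= 2 * C * del by lra.
have [CX CX0 hCX] := @fnum_cross_bound R d gamma hg r0 P0 B r00 P00.
pose lam i : R := `|(mass D ord0 i)^-1| * \sum_(m < d) (2 * \sum_j `|stiff D m i j| * (2 * CX)).
have lam0 i : 0 <= lam i.
  rewrite mulr_ge0 // sumr_ge0 // => m _; rewrite mulr_ge0 // sumr_ge0 // => j _.
  by rewrite !mulr_ge0.
exists (\sum_i lam i) => [|c c' del Sc Sc' hc i]; first exact: sumr_ge0.
have del0 : 0 <= del by apply: le_trans (hc i).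
have fl m j : `|fnum gamma m (c i) (c j) - fnum gamma m (c' i) (c' j)| <= 2 * CX * del.
  have [_ h1 _] := hCX m (c' i) (c i) (c j) (c j) (Sc' i) (Sc i) (Sc j) (Sc j).
  have [_ h2 _] := hCX m (c' j) (c j) (c' i) (c' i) (Sc' j) (Sc j) (Sc' i) (Sc' i).
  rewrite fnumC (fnumC gamma m (c' j)) in h2.
  rewrite -(subrKA (fnum gamma m (c' i) (c j))) (le_trans (ler_normD _ _)) //.
  by apply: (arith _ _ _ 0 _ _ _ h1 h2); exact: ler_wpM2l.
rewrite (@le_trans _ _ (lam i * del)) //; last first.
  by rewrite ler_wpM2r // (bigD1 i) //= lerDl sumr_ge0.
rewrite /scheme_flux -scalerBr normrZ /lam -mulrA ler_wpM2l // -sumrB mulr_suml.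
rewrite (le_trans (ler_norm_sum _ _ _)) //; apply: ler_sum => m _.
rewrite -scalerBr normrZ ger0_norm // -[X in _ <= X]mulrA ler_wpM2l // -sumrB mulr_suml.
rewrite (le_trans (ler_norm_sum _ _ _)) //; apply: ler_sum => j _.
by rewrite -scalerBr normrZ -[X in _ <= X]mulrA ler_wpM2l.
Qed.

(** The equation is assumed only while the states are within [r] of [u], so the lemma applies both
    to the truncated system and to every solution of the scheme. *)
Lemma stay_close : exists2 h0, 0 < h0 & exists2 C, 0 <= C & forall D, F D -> mesh D < h0 ->
  forall Y Y' : R -> 'I_(nnodes D) -> state R d,
  (forall i, Y 0 i = u 0 (node i)) ->
  (forall t i, 0 <= t <= T -> is_time_derive T (Y^~ i) t (Y' t i)) ->
  (forall t, 0 <= t <= T -> (forall i, `|Y t i - u t (node i)| <= r) -> solves Y Y' t) ->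
  forall t, 0 <= t <= T -> (forall i, `|Y t i - u t (node i)| <= r) /\
    \sum_i mass D ord0 i * enorm (Y t i - u t (node i)) ^+ 2 <= C * mesh D ^+ p ^+ 2.
Proof.
have [c c0 hc] := @rel_entropy_lower R d gamma hg r0 P0 B r00 P00.
have [Cr Cr0 hCr] := energy_rate hg L0 T0 r00 P00 p0 hu uS heuler hF hFloc.
have [cM [CM [cN [CN [CD [[cM0 CM0 _ CN0 _] hm]]]]]] := hF.
pose K := Cr / c + 1.
have K0 : 0 < K by rewrite ltr_wpDl // divr_ge0 // ltW.
pose n := sdim R d; have n0 : 0 < n by exact: sdim_gt0.
(* [Cr / K * expR (K * T)] is the Gronwall factor, and [n / c] converts relative entropy to the
   squared Euclidean error. *)
pose C := n / c * (Cr / K * expR (K * T)).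
have C0 : 0 <= C by rewrite !mulr_ge0 ?invr_ge0 ?expR_ge0 ?(ltW n0) ?(ltW c0) ?(ltW K0).
(* Chosen so that [C h^(2p)] is below [cM h^d r^2], the energy at which one node could reach the
   boundary of its box; [h <= 1] is used to compare powers. *)
pose h0 := Num.min 1 (cM * r ^+ 2 / (C + 1)).
have C1 : 0 < C + 1 by rewrite ltr_wpDl.
have r20 : 0 < cM * r ^+ 2 by rewrite mulr_gt0 // exprn_gt0.
exists h0; first by rewrite lt_min ltr01 divr_gt0.
exists C => // D FD; rewrite lt_min => /andP[h1 hr] Y Y' Y0 dY eqY.
have [h0' [mi _] _ _ _] := hm D FD.
pose q := mesh D ^+ p ^+ 2; have q0 : 0 <= q by rewrite exprn_ge0 // exprn_ge0 // ltW.
pose phi t := \sum_i mass D ord0 i * sdot (Y t i - u t (node i)) (Y t i - u t (node i)).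
have m0 i : 0 < mass D ord0 i by exact: mass_gt0.
have sd0 (x : state R d) : 0 <= sdot x x by rewrite -state_enorm_sdot exprn_ge0 // enorm_ge0.
have du t x : 0 <= t <= T -> is_time_derive T (u^~ x) t (time_derive T (u^~ x) t).
  exact: (time_derive_solution hu).
have phi_cont : {within `[0, T], continuous phi}.
  apply: (@time_derivable_continuous _ T _ phi T) => // t tT.
  eexists; apply: is_time_derive_sum => i; apply: is_time_deriveM; first exact: is_time_derive_cst.
  by apply: is_time_derive_sdot; apply: is_time_deriveB; [exact: dY|exact: du|exact: dY|exact: du].
have phi0 : phi 0 = 0.
  by apply: big1 => i _; rewrite Y0 subrr sdot0r mulr0.
have in_box t : phi t <= cM * mesh D ^+ d * r ^+ 2 -> forall i, `|Y t i - u t (node i)| <= r.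
  move=> phit i.
  have h2 : mass D ord0 i * sdot (Y t i - u t (node i)) (Y t i - u t (node i)) <= phi t.
    rewrite /phi (bigD1 i) //= lerDl; apply: sumr_ge0 => j _.
    by rewrite mulr_ge0 // ltW.
  have /andP[mi1 _] := mi i.
  have hd0 : 0 < cM * mesh D ^+ d by rewrite mulr_gt0 // exprn_gt0.
  have h3 : cM * mesh D ^+ d * sdot (Y t i - u t (node i)) (Y t i - u t (node i))
      <= cM * mesh D ^+ d * r ^+ 2.
    by rewrite (le_trans _ phit) // (le_trans _ h2) // ler_wpM2r.
  rewrite ler_pM2l // -state_enorm_sdot in h3.
  rewrite (le_trans (norm_le_enorm _)) //.
  by rewrite -(@ler_pXn2r _ 2) // nnegrE ?enorm_ge0 // ltW.
(* as [mesh D ^+ (2 * p)] is at most [mesh D ^+ (d + 1)] *)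
have ab : C * q < cM * mesh D ^+ d * r ^+ 2.
  have q_le : q <= mesh D ^+ d * mesh D.
    rewrite /q -exprM mulnC -(subnKC dp) addSn -addnS exprD ler_wpM2l ?exprn_ge0 ?(ltW h0') //.
    by rewrite exprS ler_piMr ?(ltW h0') // exprn_ile1 // ltW.
  have hd0 : 0 < mesh D ^+ d by rewrite exprn_gt0.
  rewrite ltr_pdivlMr // in hr.
  rewrite (le_lt_trans (ler_wpM2l C0 q_le)) // mulrCA (mulrC cM) -[X in _ < X]mulrA ltr_pM2l //.
  by rewrite (le_lt_trans _ hr) // mulrC ler_pM2l // lerDl.
pose E t := \sum_i mass D ord0 i * rel_entropy gamma (Y t i) (u t (node i)).
have bound t1 : 0 <= t1 <= T -> (forall t, 0 <= t <= t1 -> phi t <= cM * mesh D ^+ d * r ^+ 2) ->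
    forall t, 0 <= t <= t1 -> phi t <= C * q.
  move=> /andP[t10 t1T] hphi.
  have in_T t : 0 <= t <= t1 -> 0 <= t <= T.
    by move=> /andP[-> /le_trans]; apply.
  have SY t i : 0 <= t <= t1 -> S (Y t i).
    by move=> tt1; apply: (box (in_T t tt1) (x := node i)); exact: in_box (hphi t tt1) i.
  pose E' t := \sum_i mass D ord0 i *
    (sdot (evar gamma (Y t i) - evar gamma (u t (node i))) (Y' t i)
     - sdot (devar gamma (u t (node i)) (time_derive T (u^~ (node i)) t)) (Y t i - u t (node i))).
  have dE t : 0 <= t <= t1 -> is_time_derive T E t (E' t).
    move=> tt1; have tT := in_T t tt1.
    apply: is_time_derive_sum => i.
    apply: (@is_time_deriveZ R T _ (mass D ord0 i) (fun t => rel_entropy gamma (Y t i) (u t (node i)))).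
    apply: is_time_derive_rel_entropy => //; [exact: dY|exact: du| |].
    - exact: good_admissible (SY t i tt1).
    - exact: good_admissible (uS _ tT).
  have phiE t : 0 <= t <= t1 -> \sum_i mass D ord0 i * `|Y t i - u t (node i)| ^+ 2 <= c^-1 * E t.
    move=> tt1; rewrite /E mulr_sumr; apply: ler_sum => i _.
    rewrite [X in _ <= X]mulrCA ler_wpM2l ?(ltW (m0 i)) // ler_pdivlMl //.
    by apply: hc; [exact: SY|exact: uS (in_T t tt1)].
  have E_ge0 t : 0 <= t <= t1 -> 0 <= E t.
    move=> tt1; have h2 : 0 <= c^-1 * E t.
      by rewrite (le_trans _ (phiE t tt1)) // sumr_ge0 // => i _; rewrite mulr_ge0 ?exprn_ge0 // ltW.
    by move: h2; rewrite pmulr_rge0 // invr_gt0.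
  have dE_le t : 0 <= t <= t1 -> E' t <= K * E t + Cr * q.
    move=> tt1; have tT := in_T t tt1.
    have eqt : solves Y Y' t by apply: eqY => //; exact: in_box (hphi t tt1).
    have h2 := hCr D FD t (Y t) (Y' t) tT (fun i => SY t i tt1) eqt.
    rewrite (le_trans h2) // mulrDr lerD2r // (le_trans (ler_wpM2l Cr0 (phiE t tt1))) //.
    by rewrite mulrA /K [X in _ <= X]mulrDl lerDl mul1r E_ge0.
  move=> t tt1.
  have t1T' : 0 <= t1 <= T by rewrite t10.
  have h2 := @gronwall R T E E' K (Cr * q) t1 t1T' K0 dE dE_le t tt1.
  have E00 : E 0 = 0.
    apply: big1 => i _; rewrite Y0 /rel_entropy !subrr sdot0r subrr mulr0 //.
  have KT : expR (K * t) <= expR (K * T).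
    by rewrite ler_expR ler_pM2l //; case/andP: (in_T t tt1).
  have Crq : 0 <= Cr * q / K by apply: divr_ge0; [exact: mulr_ge0|exact: ltW].
  have h3 : E t <= Cr * q / K * expR (K * T).
    rewrite (le_trans h2) // E00 add0r.
    have := ler_wpM2l Crq KT; lra.
  have h4 : phi t <= n / c * E t.
    rewrite -mulrA; rewrite (@le_trans _ _ (n * \sum_i mass D ord0 i * `|Y t i - u t (node i)| ^+ 2)) //.
      rewrite /phi mulr_sumr; apply: ler_sum => i _.
      by rewrite [X in _ <= X]mulrCA ler_wpM2l ?(ltW (m0 i)) // -state_enorm_sdot enorm_le_norm.
    by rewrite ler_wpM2l ?(ltW n0) // phiE.
  rewrite (le_trans h4) //.
  rewrite [X in _ <= X](_ : _ = n / c * (Cr * q / K * expR (K * T))); last by rewrite /C; ring.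
  by rewrite ler_wpM2l // divr_ge0 ?(ltW n0) ?(ltW c0).
have phi_le : forall t, 0 <= t <= T -> phi t <= C * q.
  by apply: (first_exit T0 ab phi_cont _ bound); rewrite phi0 mulr_ge0.
move=> t tT; split.
  by apply: in_box; rewrite (le_trans (phi_le t tT)) // ltW.
rewrite (le_trans _ (phi_le t tT)) // /phi.
by under eq_bigr do rewrite state_enorm_sdot.
Qed.

(* Clipping the states to a box around the exact solution makes the right-hand
   side globally Lipschitz. *)
Lemma truncated_solution D : F D ->
  (forall x, {within `[0, T], continuous (fun t => s t x)}) ->
  exists Y Y' : R -> 'I_(nnodes D) -> state R d,
  [/\ (forall i, Y 0 i = u 0 (node i)),
      (forall t i, 0 <= t <= T -> is_time_derive T (Y^~ i) t (Y' t i)) &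
      forall t, 0 <= t <= T -> (forall i, `|Y t i - u t (node i)| <= r) -> solves Y Y' t].
Proof.
move=> FD cs.
have arith (a b z : R) : a <= z -> b <= z -> a + 2 * b <= 3 * z by lra.
have [Lam Lam0 hLam] := scheme_flux_lipschitz D.
pose st (y : 'I_(nnodes D) * option (option 'I_d) -> R) i : state R d := coord_state (fun o => y (i, o)).
pose cl t y i : state R d := box_clip r (u t (node i)) (st y i).
have Scl t y i : 0 <= t <= T -> S (cl t y i).
  by move=> tT; apply: (box tT (x := node i)); exact: box_clip_le (ltW rpos).
pose uc (k : 'I_(nnodes D) * option (option 'I_d)) t : R := state_coord k.2 (u t (node k.1)).
(* One estimate with two uses: [t = t'] gives the Lipschitz condition, and varying both arguments
   gives continuity in time. *)
have lip t t' y z c : 0 <= t <= T -> 0 <= t' <= T ->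
    `|state_coord c.2 (scheme_flux (cl t y) c.1) - state_coord c.2 (scheme_flux (cl t' z) c.1)|
    <= Lam * \sum_k (`|y k - z k| + 2 * `|uc k t - uc k t'|).
  move=> tT t'T; rewrite -linearB (le_trans (state_norm_coord _ _)) //; apply: hLam => i; try exact: Scl.
  apply: state_norm_le => [|o]; first by rewrite sumr_ge0 // => k _; rewrite addr_ge0 // mulr_ge0.
  rewrite linearB (le_trans (box_clip_lipschitz _ _ _ _ _ (ltW rpos))) // !state_coord_coord_state.
  by rewrite (bigD1 (i, o)) //= lerDl sumr_ge0 // => k _; rewrite addr_ge0 // mulr_ge0.
pose G t y (c : 'I_(nnodes D) * option (option 'I_d)) : R :=
  state_coord c.2 (s t (node c.1)) - state_coord c.2 (scheme_flux (cl t y) c.1).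
have Glip t y z c : 0 <= t <= T -> `|G t y c - G t z c| <= Lam * \sum_k `|y k - z k|.
  move=> tT; have := lip t t z y c tT tT.
  under eq_bigr do rewrite subrr normr0 mulr0 addr0 distrC.
  by move=> h; rewrite /G opprB addrC addrA subrK.
have Gcont (y : R -> 'I_(nnodes D) * option (option 'I_d) -> R) :
    (forall c, {within `[0, T], continuous (y^~ c)}) ->
    forall c, {within `[0, T], continuous (fun t => G t (y t) c)}.
  move=> cy c.
  have uc_cont k : {within `[0, T], continuous (uc k)}.
    apply: (@time_derivable_continuous _ T _ (uc k) T) => // t tT.
    exists (state_coord k.2 (time_derive T (u^~ (node k.1)) t)).
    apply: is_time_derive_coord; exact: (time_derive_solution hu).
  have flux_cont : {within `[0, T], continuous (fun t => state_coord c.2 (scheme_flux (cl t (y t)) c.1))}.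
    pose f (k : 'I_(nnodes D) * option (option 'I_d)) t : R * R := (y t k, uc k t).
    apply: (@within_continuous_lipschitz _ T _ _ (index_enum _) f _ (Lam * 3)).
    - by rewrite mulr_ge0.
    - move=> k; apply/subspace_continuousP => t tT.
      have /subspace_continuousP /(_ t tT) h1 := cy k.
      have /subspace_continuousP /(_ t tT) h2 := uc_cont k.
      exact: cvg_pair h1 h2.
    - move=> t t' tT t'T; rewrite (le_trans (lip _ _ _ _ _ tT t'T)) // -mulrA ler_wpM2l //.
      rewrite mulr_sumr; apply: ler_sum => k _.
      have h1 : `|y t k - y t' k| <= `|f k t - f k t'| by rewrite prod_normE le_max lexx.
      have h2 : `|uc k t - uc k t'| <= `|f k t - f k t'| by rewrite prod_normE le_max lexx orbT.
      exact: arith.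
  apply/subspace_continuousP => t tT.
  have /subspace_continuousP /(_ t tT) h1 := flux_cont.
  have /subspace_continuousP /(_ t tT) h2 := cs (node c.1).
  apply: cvgB => //.
  exact: (cvg_comp _ _ h2 (@state_coord_continuous _ _ c.2 _)).
have [y [y0 dy]] := @picard_lindelof R T T0 _ G Lam (fun k => uc k 0) Lam0 Glip Gcont.
pose Y t i : state R d := st (y t) i.
pose Y' t i : state R d := s t (node i) - scheme_flux (cl t (y t)) i.
exists Y, Y'; split.
- move=> i; apply: state_coord_inj => o.
  by rewrite state_coord_coord_state y0.
- move=> t i tT; apply: is_time_derive_state => o.
  rewrite linearB; have := dy t (i, o) tT.
  by congr (is_time_derive T _ t _); apply/funext => t'; rewrite state_coord_coord_state.
move=> t tT near_u; have [_ sol] := solvesE Y Y' t FD; apply: sol => i.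
have E : cl t (y t) = Y t by apply/funext => j; exact: box_clip_id (near_u j).
by rewrite /Y' E.
Qed.

(** Gronwall's inequality for the squared difference of the solutions, with zero initial value and
    no inhomogeneous term. *)
Lemma solution_unique D (Y Y' Z Z' : R -> 'I_(nnodes D) -> state R d) : F D ->
  (forall i, Y 0 i = Z 0 i) ->
  (forall t i, 0 <= t <= T -> is_time_derive T (Y^~ i) t (Y' t i)) ->
  (forall t i, 0 <= t <= T -> is_time_derive T (Z^~ i) t (Z' t i)) ->
  (forall t i, 0 <= t <= T -> S (Y t i)) -> (forall t i, 0 <= t <= T -> S (Z t i)) ->
  (forall t, 0 <= t <= T -> solves Y Y' t) -> (forall t, 0 <= t <= T -> solves Z Z' t) ->
  forall t i, 0 <= t <= T -> Y t i = Z t i.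
Proof.
move=> FD YZ0 dY dZ SY SZ eqY eqZ.
have [Lam Lam0 hLam] := scheme_flux_lipschitz D.
have amgm (a b : R) : 0 <= a -> 0 <= b -> a * b <= a ^+ 2 + b ^+ 2.
  by move=> a0 b0; have := sqr_ge0 (a - b); have := mulr_ge0 a0 b0; nra.
have arith2 (a b c e : R) : a * (b * c * e) + a * (b * c * e) <= 2 * a * b * c * e.
  by rewrite le_eqVlt; apply/orP; left; apply/eqP; ring.
have arithN (a b : R) : a * b + a * b = 2 * a * b by ring.
pose e t i : state R d := Y t i - Z t i.
pose W t := \sum_i sdot (e t i) (e t i).
pose W' t := \sum_i (sdot (Y' t i - Z' t i) (e t i) + sdot (e t i) (Y' t i - Z' t i)).
have dW t : 0 <= t <= T -> is_time_derive T W t (W' t).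
  move=> tT; apply: is_time_derive_sum => i.
  by apply: is_time_derive_sdot; apply: is_time_deriveB; [exact: dY|exact: dZ|exact: dY|exact: dZ].
have sd0 (x : state R d) : 0 <= sdot x x by rewrite -state_enorm_sdot exprn_ge0 // enorm_ge0.
pose n := sdim R d; have n0 : 0 < n by exact: sdim_gt0.
pose N : R := (nnodes D)%:R.
pose K := 2 * n * Lam * (2 * N) + 1.
have K0 : 0 < K by rewrite ltr_wpDl // !mulr_ge0 // ltW.
have dW_le t : 0 <= t <= T -> W' t <= K * W t + 0.
  move=> tT; rewrite addr0.
  pose del := \sum_j `|e t j|.
  have Ydiff i : `|Y' t i - Z' t i| <= Lam * del.
    have [/(_ (eqY t tT)) eY _] := solvesE Y Y' t FD.
    have [/(_ (eqZ t tT)) eZ _] := solvesE Z Z' t FD.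
    rewrite eY eZ.
    rewrite opprB addrC addrA subrK -normrN opprB.
    apply: hLam => [j|j|j]; [exact: SY|exact: SZ|].
    by rewrite /del (bigD1 j) //= lerDl sumr_ge0.
  have del0 : 0 <= del by apply: sumr_ge0.
  have Wt0 : 0 <= W t by apply: sumr_ge0.
  have term i : sdot (Y' t i - Z' t i) (e t i) + sdot (e t i) (Y' t i - Z' t i)
      <= 2 * n * Lam * del * `|e t i|.
    have h : sdot (Y' t i - Z' t i) (e t i) <= n * (Lam * del * `|e t i|).
      rewrite (le_trans (ler_norm _)) // (le_trans (sdot_norm _ _)) // ler_wpM2l ?(ltW n0) //.
      by rewrite ler_wpM2r.
    by rewrite (sdotC (e t i)) (le_trans (lerD h h)) // arith2.
  rewrite (le_trans (ler_sum _ (fun i _ => term i))) // -mulr_sumr -/del.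
  have delN : del * del <= 2 * N * W t.
    have sq i : `|e t i| ^+ 2 <= sdot (e t i) (e t i).
      by rewrite -state_enorm_sdot lerXn2r ?nnegrE ?enorm_ge0 // norm_le_enorm.
    rewrite {1}/del mulr_suml (@le_trans _ _ (\sum_i \sum_j (sdot (e t i) (e t i) + sdot (e t j) (e t j)))) //.
      apply: ler_sum => i _; rewrite mulr_sumr; apply: ler_sum => j _.
      by rewrite (le_trans _ (lerD (sq i) (sq j))) // amgm.
    rewrite (eq_bigr (fun i => N * sdot (e t i) (e t i) + W t)) => [|i _].
      by rewrite big_split /= -mulr_sumr -/(W t) sumr_const card_ord -[_ *+ _]mulr_natl -/N arithN.
    by rewrite big_split /= sumr_const card_ord -[_ *+ _]mulr_natl.
  have nL : 0 <= 2 * n * Lam by rewrite !mulr_ge0 // ltW.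
  rewrite -[X in X <= _]mulrA (le_trans (ler_wpM2l nL delN)) // mulrA /K [X in _ <= X]mulrDl lerDl mul1r //.
have W0 : W 0 = 0 by apply: big1 => i _; rewrite /e YZ0 subrr sdot0r.
move=> t i tT.
have TT : 0 <= T <= T by rewrite lexx ltW.
have := @gronwall R T W W' K 0 T TT K0 dW dW_le t tT.
rewrite W0 !mul0r addr0 mul0r subr0 => Wt.
have h : sdot (e t i) (e t i) <= W t.
  by rewrite /W (bigD1 i) //= lerDl sumr_ge0.
have e0 : `|e t i| ^+ 2 <= 0.
  rewrite (le_trans _ Wt) // (le_trans _ h) // -state_enorm_sdot.
  by rewrite lerXn2r ?nnegrE ?enorm_ge0 // norm_le_enorm.
apply/eqP; rewrite -subr_eq0 -normr_eq0 -/(e t i).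
by move: e0; rewrite le_eqVlt ltNge exprn_ge0 // orbF sqrf_eq0.
Qed.
End Scheme.

(** * Existence, uniqueness and convergence of the semidiscretization *)

Section Assembly.
Variables (R : realType) (d : nat) (gamma L T eps : R)
  (s u : R -> 'rV[R]_d -> state R d).

Lemma solution_nbhd_Kset rhomin Pmin :
  solution_nbhd T u eps `<=` bounded_below gamma rhomin Pmin ->
  solution_nbhd T u eps `<=` Kset gamma T rhomin Pmin u eps.
Proof.
move=> sub a ha; split; last exact: sub.
by apply: subset_closure => M [_]; exact.
Qed.

Lemma source_slice_continuous x :
  zero_source T s \/ [/\ periodic_tx L T s, continuous_tx T s & bounded_tx T s] ->
  {within `[0, T], continuous (fun t => s t x)}.
Proof.
move=> hs; apply/subspace_continuousP => t /=; rewrite in_itv /= => tT.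
case: hs => [s0|[_ /subspace_continuousP cs _]].
  have fc : (fun=> s t x) t' @[t' --> within `[0, T] (nbhs t)] --> s t x by exact: cvg_cst.
  refine (cvg_trans _ fc); apply: near_eq_cvg.
  change (nbhs t (fun t' => t' \in `[0, T] -> s t x = s t' x)).
  by apply: (@filterE _ (nbhs t)) => t'; rewrite in_itv /= => t'T; rewrite !s0.
have tx : (`[0, T]%classic `*` [set: 'rV[R]_d]) (t, x) by split; rewrite //= in_itv.
move=> A nA; have := cs (t, x) tx A nA; rewrite /within /=.
move=> [[/= U V] [nU nV] UV].
rewrite /nbhs /= /within /=; apply: filterS nU => t' Ut' t'T.
by apply: (UV (t', x)); split => //=; exact: nbhs_singleton nV.
Qed.
End Assembly.

Theorem corollary5p7 (R : realType) (d p : nat) (gamma L T eps : R)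
    (u s : R -> 'rV[R]_d -> state R d) (F : set (discretization R d))
    (hd : (1 <= d)%N) (hp : (1 <= p)%N) (hdp : d%:R / 2 < p%:R :> R)
    (hgamma : 1 < gamma) (hL : 0 < L) (hT : 0 < T) (heps : 0 < eps)
    (hu : Ck_tx L T p.+1 u)
    (hadm : forall t x, 0 <= t <= T -> admissible gamma (u t x))
    (heuler : euler_solution gamma T s u)
    (hs : zero_source T s \/
          [/\ periodic_tx L T s, continuous_tx T s & bounded_tx T s])
    (hF : sbp_family L p F) (hFloc : fixed_local_stencil L F) :
  exists h0 CT : R -> R -> R -> R -> R -> R,
  forall (rhomin Pmin : R), 0 < rhomin -> 0 < Pmin ->
    (forall t x, 0 <= t <= T ->
       2 * rhomin <= rho (u t x) /\ 2 * Pmin <= pressure gamma (u t x)) ->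
    solution_nbhd T u eps `<=` bounded_below gamma rhomin Pmin ->
  let K := Kset gamma T rhomin Pmin u eps in
  let Cw := const_w gamma T s K in
  let CS := const_S gamma K in
  let CL := const_L gamma T u in
  (exists cU CU, hessian_bounds gamma K cU CU) /\
  forall cU CU, hessian_bounds gamma K cU CU ->
    0 < h0 cU CU Cw CS CL /\
    forall D, F D -> 0 < mesh D < h0 cU CU Cw CS CL ->
    exists uh : R -> 'I_(nnodes D) -> state R d,
      [/\ semidiscrete_solution gamma T s u uh,
          (forall vh, semidiscrete_solution gamma T s u vh ->
             forall t i, 0 <= t <= T -> vh t i = uh t i),
          (forall t i, 0 <= t <= T -> K (uh t i)) &
          (forall t, 0 <= t <= T ->
             discrete_error u uh t <= CT cU CU Cw CS CL * mesh D ^+ p)].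
Proof.
(* The functions [h0] and [CT] have to be given before [rhomin] and [Pmin]. Either some pair of
   lower bounds holds on the neighbourhood and one such pair is fixed, or the claim is vacuous and
   any functions will do. *)
have [[r0 [P0 [r00 [P00 sub]]]]|none] := pselect (exists r0 P0 : R,
    0 < r0 /\ 0 < P0 /\ solution_nbhd T u eps `<=` bounded_below gamma r0 P0); last first.
  exists (fun _ _ _ _ _ => 1), (fun _ _ _ _ _ => 1) => r0 P0 r00 P00 _ sub.
  by case: none; exists r0, P0.
have [B0 B00 uB] : exists2 B0, 0 <= B0 & forall t x, 0 <= t <= T -> `|u t x| <= B0.
  have [pu hc] := hu; have [//|ct _] := hc [::].
  exact: continuous_tx_bounded hL (ltW hT) pu ct.
(* Small enough that the box of radius [r] in the sup norm lies in the Euclidean ball of radius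
   [eps]. *)
pose r := eps / sdim R d.
have n1 : 1 <= sdim R d by rewrite /sdim ler1n.
have rpos : 0 < r by rewrite divr_gt0 // sdim_gt0.
have in_nbhd t x b : 0 <= t <= T -> `|b - u t x| <= r -> solution_nbhd T u eps b.
  move=> tT hb; exists t, x; split => //.
  rewrite -(@ler_pXn2r _ 2) ?nnegrE ?enorm_ge0 ?(ltW heps) //.
  rewrite (le_trans (enorm_le_norm _)) //.
  have h1 : `|b - u t x| ^+ 2 <= r ^+ 2 by rewrite lerXn2r ?nnegrE ?(ltW rpos).
  rewrite (le_trans (ler_wpM2l _ h1)) ?(ltW (sdim_gt0 R d)) //.
  rewrite /r expr_div_n mulrCA ger_pMr ?exprn_gt0 //.
  by rewrite ler_pdivrMr ?exprn_gt0 ?sdim_gt0 // mul1r expr2 ler_peMr // ltW // sdim_gt0.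
have r_eps : r <= eps by rewrite ler_pdivrMr ?sdim_gt0 // ler_peMr // ltW.
have box t x b : 0 <= t <= T -> `|b - u t x| <= r -> good_states gamma r0 P0 (B0 + eps) b.
  move=> tT hb; have [rb Pb] := sub b (in_nbhd t x b tT hb); split => //.
  by rewrite -(subrK (u t x) b) addrC (le_trans (ler_normD _ _)) // lerD ?uB // (le_trans hb).
have [h0 h00 [C C0 close]] :=
  stay_close hgamma hL hT r00 P00 hdp hu rpos box heuler hF hFloc.
(* Every [K] in the statement contains the [eps]-neighbourhood in which the discrete
   solutions stay, so bounds obtained there from one pair [r0], [P0] serve for all. *)
exists (fun _ _ _ _ _ => h0), (fun _ _ _ _ _ => Num.sqrt C).
move=> rhomin Pmin rho0 Pm0 _ sub' K Cw CS CL; split.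
  exact: (hessian_bounds_good hgamma rho0 Pm0 (Kset_bounded uB)).
move=> cU CU _; split => // D FD /andP[D0 Dh].
have [Y [Y' [Y0 dY eqY]]] := truncated_solution hgamma hT r00 P00 hu rpos box hF FD
  (fun x => source_slice_continuous (x := x) hs).
(* The truncated solution never leaves the boxes, so it solves the scheme itself. *)
have closeY := close D FD Dh Y Y' Y0 dY eqY.
have solY t : 0 <= t <= T -> solves gamma s Y Y' t.
  by move=> tT; apply: eqY => //; have [] := closeY t tT.
have SY t i : 0 <= t <= T -> good_states gamma r0 P0 (B0 + eps) (Y t i).
  by move=> tT; apply: (box t (node i)) => //; have [] := closeY t tT.
exists Y; split.
- split => // t i tT; split.
  + exact: (good_admissible r00 P00 (SY t i tT)).
  + exact: (is_time_derive_derivable (dY t i tT)).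
  + by rewrite (is_time_derive_val hT tT (dY t i tT)); exact: solY.
- move=> Z [Z0 solZ].
  pose Z' t i := time_derive T (Z^~ i) t.
  have dZ t i : 0 <= t <= T -> is_time_derive T (Z^~ i) t (Z' t i).
    by move=> tT; have [_ dz _] := solZ t i tT; exact: time_derivableP.
  have eqZ t : 0 <= t <= T -> solves gamma s Z Z' t.
    by move=> tT i; have [_ _ h] := solZ t i tT.
  (* A competing solution is only known to be admissible; the exit argument confines it to the set
     where the flux is Lipschitz. *)
  have closeZ := close D FD Dh Z Z' Z0 dZ (fun t tT _ => eqZ t tT).
  have SZ t i : 0 <= t <= T -> good_states gamma r0 P0 (B0 + eps) (Z t i).
    by move=> tT; apply: (box t (node i)) => //; have [] := closeZ t tT.
  apply: (solution_unique hgamma hT r00 P00 hF FD _ dZ dY SZ SY eqZ solY) => i.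
  by rewrite Y0 Z0.
- move=> t i tT; apply: (solution_nbhd_Kset sub').
  by apply: (in_nbhd t (node i)) => //; have [] := closeY t tT.
move=> t tT; rewrite /discrete_error.
have [_ h] := closeY t tT.
rewrite -[X in _ * X]ger0_norm ?exprn_ge0 ?(ltW D0) // -sqrtr_sqr -sqrtrM //.
by rewrite ler_sqrt // mulr_ge0 // sqr_ge0.
Qed.
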